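(* Let $u$ be the solution of the boundary value problem $\mathcal{L}u=f$ in $\Omega$, $u=g$ on $\partial\Omega$, with Hessian $H(\boldsymbol{x})$, let $\{\mathcal{T}_h\}$ be a family of simplicial meshes of $\Omega\subset\mathbb{R}^d$, let $u_h$ be the linear finite element solution on $\mathcal{T}_h$, let $N$ be the number of elements of $\mathcal{T}_h$, and let $R$ be a recovered Hessian with element averages $R_K$, $K\in\mathcal{T}_h$. Assume that $H(\boldsymbol{x})$ and $R$ are uniformly positive definite in $\Omega$ and that $R$ satisfies $$C_{R-,K}\, I \le R_K^{-1}H(\boldsymbol{x}) \le C_{R+,K}\, I,\qquad \forall \boldsymbol{x}\in K,\ \forall K\in\mathcal{T}_h,$$ where $C_{R-,K}$ and $C_{R+,K}$ are element-wise constants satisfying $$C_{R-}\le \min_{K\in\mathcal{T}_h} C_{R-,K}\qquad\text{and}\qquad \sqrt{\frac1N\sum_{K\in\mathcal{T}_h} C_{R+,K}^2}\le C_{R+}$$ with some mesh-independent positive constants $C_{R-}$ and $C_{R+}$. Suppose $u\in H^2(\Omega)$. Then for any mesh $\mathcal{T}_h$ that is quasi-$M$-uniform with respect to the metric tensor $$M_K = \det(R_K)^{-\frac{1}{d+2}}\,\|R_K\|_2^{\frac{2}{d+2}}\,R_K,\qquad K\in\mathcal{T}_h,$$ i.e. that satisfies, with constants $C_{eq},C_{ali}\ge 1$ independent of $K$, $N$ and $\mathcal{T}_h$, $$|K|\det(M_K)^{\frac12}\le C_{eq}\frac1N\sum_{\tilde K\in\mathcal{T}_h}|\tilde K|\det(M_{\tilde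 K})^{\frac12},\qquad \frac1d\operatorname{tr}\big((F_K')^T M_K F_K'\big)\le C_{ali}\,|K|^{\frac2d}\det(M_K)^{\frac1d},\qquad\forall K\in\mathcal{T}_h,$$ the linear finite element error is bounded by $$|u-u_h|_{H^1(\Omega)}\le C\cdot C_{ali}^{\frac{d+1}{2}}\,C_{eq}^{\frac{d+2}{2d}}\cdot\frac{C_{R+}}{C_{R-}}\cdot N^{-\frac1d}\,\Big\|\det(H)^{\frac1d}H\Big\|_{L^{\frac{d}{d+2}}(\Omega)}^{\frac12},$$ where $C$ is a generic constant independent of $u$, $\mathcal{T}_h$, $N$, $R$, $C_{ali}$, $C_{eq}$, $C_{R+}$ and $C_{R-}$.
   Context: Setting: $\Omega\subset\mathbb{R}^d$ ($d\ge1$) is a polygonal or polyhedral domain, $\mathcal{L}$ is an elliptic second-order differential operator, $f$ and $g$ are given functions. $\mathcal{T}_h$ is a simplicial mesh of $\Omega$; $u_h$ is the conventional linear (continuous piecewise linear) finite element solution on $\mathcal{T}_h$. $\Pi_h$ is the nodal interpolation operator of the linear finite element space on $\mathcal{T}_h$. Standing assumption (Céa's lemma): $|u-u_h|_{H^1(\Omega)}\le C\,|u-\Pi_h u|_{H^1(\Omega)}$ for every mesh, with $C$ independent of $u$ and $\mathcal{T}_h$ (in particular, the nodal interpolant $\Pi_h u$ is presupposed to be defined). The constant in the theorem may depend on this constant, on $d$ and on the reference element. Notation: $\hat K$ is a fixed reference simplex with volume $1$; $F_K:\hat K\to K$ is the affine mapping onto the element $K$ and $F_K'$ its (constant) Jacobian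 matrix; $|K|$ is the volume of $K$. $\|\cdot\|_2$ is the spectral matrix norm, and $|\cdot|_{H^1(\Omega)}$ is the $H^1$ semi-norm. $H(\boldsymbol{x})$ is the Hessian matrix of $u$ at $\boldsymbol{x}$ (for $u\in H^2(\Omega)$ it is defined almost everywhere). A recovered Hessian $R$ is a symmetric-matrix-valued function on $\Omega$ (an approximation of $H$), and $R_K$ is an average of $R$ over $K$ (e.g. the average of the values of $R$ at the vertices of $K$). No convergence of $R$ to $H$ is assumed. ''Uniformly positive definite in $\Omega$'' means: there is $\gamma>0$ with $H(\boldsymbol{x})\ge\gamma I$ for all $\boldsymbol{x}\in\Omega$ (and analogously for $R$, hence for the averages $R_K$), where $A\ge B$ for symmetric matrices means that $A-B$ is positive semidefinite. For the product $R_K^{-1}H(\boldsymbol{x})$, which is similar to the symmetric matrix $R_K^{-1/2}H(\boldsymbol{x})R_K^{-1/2}$, the condition $C_{R-,K}I\le R_K^{-1}H(\boldsymbol{x})\le C_{R+,K}I$ means that all eigenvalues of $R_K^{-1}H(\boldsymbol{x})$ lie in $[C_{R-,K},C_{R+,K}]$. For a matrix-valued function $A$ and $p=\frac{d}{d+2}$, $\|A\|_{L^{p}(\Omega)}=\big(\int_\Omega\|A(\boldsymbol{x})\|_2^{p}\,d\boldsymbol{x}\big)^{1/p}$ (a quasi-norm since $p<1$). *)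

(* Defs.v *)
From HB Require Import structures.
From mathcomp Require Import all_boot all_order all_algebra.
From mathcomp Require Import all_classical all_reals all_analysis.
Set Implicit Arguments. Unset Strict Implicit. Unset Printing Implicit Defensive.
Import Order.TTheory GRing.Theory Num.Theory numFieldNormedType.Exports.
Local Open Scope classical_set_scope.
Local Open Scope ring_scope.

(* R^d is the type 'rV[R]_d.  It carries the product sigma-algebra (generated
   by the coordinates), which is the Borel sigma-algebra. *)
Section measurable_rV.
Context {R : realType} {n : nat}.
Definition rV_coord (i : 'I_n) (x : 'rV[R]_n) : measurableTypeR R := x 0 i.
Definition rV_measurable : set (set 'rV[R]_n) := g_sigma_preimage rV_coord.

HB.instance Definition _ := @isMeasurable.Build default_measure_display
  'rV[R]_n rV_measurable (@sigma_algebra0 _ _ _) (@sigma_algebraC _ _)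
  (@sigma_algebra_bigcup _ _ _).

Lemma measurable_rV_coord (i : 'I_n) : measurable_fun setT (rV_coord i).
Proof.
move=> _ Y mY; rewrite setTI; apply: sub_sigma_algebra => /=.
rewrite -bigcup_seq/=; exists i => /=; first by rewrite mem_index_enum.
by exists Y => //; rewrite setTI.
Qed.

Lemma measurable_rVP d (T : measurableType d) (f : T -> 'rV[R]_n) :
  (forall i, measurable_fun setT (fun t => rV_coord i (f t))) ->
  measurable_fun setT f.
Proof.
move=> mf; apply: measurability; first exact: erefl.
move=> _ [B + <-]; rewrite -bigcup_seq/= => -[i _ [Y mY <-]].
by rewrite setTI; exact: mf.
Qed.
End measurable_rV.

Section lebesgue_rV.
Context {R : realType}.

Definition rV_cons {n} (p : measurableTypeR R * 'rV[R]_n) : 'rV[R]_n.+1 :=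
  row_mx (\row_(_ < 1) p.1) p.2.

Definition rV_uncons {n} (x : 'rV[R]_n.+1) : measurableTypeR R * 'rV[R]_n :=
  (x 0 0, \row_i x 0 (lift 0 i)).

Lemma rV_consK {n} : cancel (@rV_cons n) rV_uncons.
Proof.
case=> a v; congr pair.
  by rewrite /rV_cons mxE; case: splitP => j //= _; rewrite mxE.
apply/rowP => i; rewrite mxE /rV_cons mxE.
case: splitP => j /= E; first by have := ltn_ord j; rewrite -E.
by congr (v _ _); apply/val_inj => /=; move: E; rewrite /bump/= => -[].
Qed.

Lemma measurable_rV_cons {n} : measurable_fun setT (@rV_cons n).
Proof.
apply: measurable_rVP => i; rewrite /rV_coord /rV_cons.
case: (@splitP 1 n i) => [j ij|k ik].
  rewrite (_ : (fun _ => _) = fst); first exact: measurable_fst.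
  apply/funext => -[a v]; rewrite mxE; case: splitP => k ik /=.
    by rewrite mxE.
  by exfalso; have := ltn_ord j; rewrite -ij ik.
rewrite (_ : (fun _ => _) = @rV_coord R n k \o snd); last first.
  apply/funext => -[a v]; rewrite mxE; case: splitP => l il /=.
    by exfalso; have := ltn_ord l; rewrite -il ik.
  by rewrite /rV_coord; congr (v _ _); apply/val_inj => /=; move: ik; rewrite il => -[].
by apply: measurableT_comp => //; exact: measurable_rV_coord.
Qed.

Lemma measurable_rV_uncons {n} : measurable_fun setT (@rV_uncons n).
Proof.
apply/measurable_fun_pairP; split.
  exact: (@measurable_rV_coord R n.+1 0).
apply: measurable_rVP => i.
rewrite (_ : (fun _ => _) = @rV_coord R n.+1 (lift 0 i)).
  exact: measurable_rV_coord.
by apply/funext => x; rewrite /rV_coord /= mxE.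
Qed.


Definition lebesgue_rV_step n (m : {sigma_finite_measure set 'rV[R]_n -> \bar R}) :
  set 'rV[R]_n.+1 -> \bar R := pushforward (lebesgue_measure \x m)%E rV_cons.

Section step.
Context n (m : {sigma_finite_measure set 'rV[R]_n -> \bar R}).

Let mpre A : measurable A -> measurable (@rV_cons n @^-1` A).
Proof. by move=> mA; rewrite -[X in measurable X]setTI; exact: measurable_rV_cons. Qed.

Let step0 : lebesgue_rV_step m set0 = 0%E.
Proof. by rewrite /lebesgue_rV_step /pushforward preimage_set0 measure0. Qed.

Let step_ge0 A : (0 <= lebesgue_rV_step m A)%E.
Proof. by rewrite /lebesgue_rV_step /pushforward; apply: integral_ge0 => x _; exact: measure_ge0. Qed.

Let step_sigma_additive : semi_sigma_additive (lebesgue_rV_step m).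
Proof.
move=> F mF tF mUF; rewrite /lebesgue_rV_step /pushforward preimage_bigcup.
apply: measure_semi_sigma_additive.
- by move=> k; exact: mpre.
- apply/trivIsetP => /= i j _ _ ij; rewrite -preimage_setI.
  by move/trivIsetP : tF => /(_ _ _ _ _ ij) ->//; rewrite preimage_set0.
- by rewrite -preimage_bigcup; exact: mpre.
Qed.

HB.instance Definition _ := isMeasure.Build _ _ _ (lebesgue_rV_step m)
  step0 step_ge0 step_sigma_additive.

Let step_sigma_finite : sigma_finite setT (lebesgue_rV_step m).
Proof.
have /sigma_finiteP[F [TF ndF Foo]] := sigma_finiteT (@lebesgue_measure R).
have /sigma_finiteP[G [TG ndG Goo]] := sigma_finiteT m.
exists (fun k => rV_uncons @^-1` (F k `*` G k)).
  rewrite -preimage_bigcup (_ : \bigcup_i _ = setT) ?preimage_setT//.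
  rewrite -subTset => -[x y] _.
  have [k _ Fx] : (\bigcup_i F i) x by rewrite -TF.
  have [l _ Gy] : (\bigcup_i G i) y by rewrite -TG.
  exists (maxn k l) => //; split => /=.
    by move: Fx; exact/subsetPset/ndF/leq_maxl.
  by move: Gy; exact/subsetPset/ndG/leq_maxr.
move=> k; have [mF ?] := Foo k; have [mG ?] := Goo k.
have mFG : measurable (F k `*` G k) by exact: measurableX.
split; first by rewrite -[X in measurable X]setTI; exact: measurable_rV_uncons.
rewrite /lebesgue_rV_step /pushforward -comp_preimage.
rewrite (_ : _ \o _ = id); last by apply/funext => p; exact: rV_consK.
by rewrite preimage_id product_measure1E// lte_mul_pinfty// ge0_fin_numE.
Qed.

HB.instance Definition _ := Measure_isSigmaFinite.Build _ _ _ (lebesgue_rV_step m) step_sigma_finite.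
End step.

(* Lebesgue measure on R^n, as the n-fold product of one-dimensional Lebesgue
   measure transported along R * R^n ~ R^(n+1). *)
Fixpoint lebesgue_rV n : {sigma_finite_measure set 'rV[R]_n -> \bar R} :=
  match n with
  | 0 => dirac (0 : 'rV[R]_0)
  | n'.+1 => lebesgue_rV_step (lebesgue_rV n')
  end.

Lemma lebesgue_rV_box n (A : 'I_n -> set (measurableTypeR R)) :
  (forall i, measurable (A i)) ->
  lebesgue_rV n [set x | forall i, A i (x 0 i)] =
  (\prod_(i < n) lebesgue_measure (A i))%E.
Proof.
elim: n A => [|n IH] A mA.
  by rewrite big_ord0 /= diracE mem_set// => -[].
rewrite big_ord_recl /= /lebesgue_rV_step /pushforward -IH; last by move=> i; exact: mA.
rewrite -product_measure1E//.
  congr (_ _); apply/seteqP; split => -[a v] /=.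
    move=> h; split=> [|i].
      by have := h 0; rewrite mxE; case: splitP => // j _; rewrite mxE.
    have := h (lift 0 i); rewrite mxE; case: splitP => j /= ij.
      by have := ltn_ord j; rewrite -ij.
    by rewrite (_ : j = i)//; apply/val_inj; move: ij; rewrite /bump/= => -[].
  case=> Aa Av i; rewrite mxE; case: (@splitP 1 n i) => j ij.
    by rewrite mxE (_ : i = 0)//; apply/val_inj; rewrite /= ij; case: j {ij} => -[].
  by rewrite (_ : i = lift 0 j)//; apply/val_inj; rewrite /= ij.
rewrite (_ : (fun _ => _) = \bigcap_(i in [set` 'I_n]) (rV_coord i @^-1` A (lift 0 i))).
  apply: fin_bigcap_measurable => // i _; rewrite -[X in measurable X]setTI.
  exact: measurable_rV_coord.
by apply/seteqP; split => x /= h i; [move=> _|]; exact: h.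
Qed.
End lebesgue_rV.

Section linear_algebra.
Context {R : realType} {d : nat}.
Implicit Types (A B : 'M[R]_d) (x y : 'rV[R]_d).

Definition dotv x y : R := (x *m y^T) 0 0.

Definition l2norm x : R := Num.sqrt (dotv x x).

(* Vectors are rows, so x *m A^T is the row form of the product A x. *)
Definition spectral_norm A : R :=
  sup [set l2norm (x *m A^T) | x in [set x | l2norm x <= 1]].

Definition loewner_le A B : Prop :=
  [/\ A^T = A, B^T = B & forall x, 0 <= dotv (x *m (B - A)) x].

End linear_algebra.

Section sobolev.
Context {R : realType} {d : nat}.
Local Notation V := 'rV[R]_d.
Local Notation mu := (@lebesgue_rV R d).
Implicit Types (Omega : set V) (w : V -> R) (G : V -> V).

Definition L2 Omega w : Prop :=
  measurable_fun Omega (w : V -> measurableTypeR R) /\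
  mu.-integrable Omega (fun x => (w x ^+ 2)%:E).

Definition partial_derivative (i : 'I_d) (w : V -> R) : V -> R :=
  fun x => 'D_(delta_mx 0 i) w x.

Definition gradient (w : V -> R) : V -> V := fun x => \row_i partial_derivative i w x.

Definition smooth w : Prop :=
  forall (s : seq 'I_d) x, differentiable (foldr partial_derivative w s) x.

Definition test_function Omega w : Prop :=
  smooth w /\
  exists K : set V, [/\ compact K, K `<=` Omega & forall x, ~ K x -> w x = 0].

Definition weak_partial Omega (i : 'I_d) w g : Prop :=
  forall phi, test_function Omega phi ->
    \int[mu]_(x in Omega) (w x * partial_derivative i phi x) =
    - \int[mu]_(x in Omega) (g x * phi x).

(* w is in H^1(Omega), with weak gradient G. *)
Definition weak_gradient Omega w G : Prop :=
  L2 Omega w /\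
  forall i, L2 Omega (fun x => G x 0 i) /\
            weak_partial Omega i w (fun x => G x 0 i).

(* w is in H^2(Omega), with Hessian H. *)
Definition weak_hessian Omega w (H : V -> 'M[R]_d) : Prop :=
  exists2 G, weak_gradient Omega w G &
    forall i, weak_gradient Omega (fun x => G x 0 i) (fun x => row i (H x)).

(* The weak gradient is unique almost everywhere, so the infimum is over at
   most one value; it is +oo when w is not in H^1(Omega). *)
Definition H1_seminorm Omega w : \bar R :=
  ereal_inf [set ((\int[mu]_(x in Omega) (dotv (G x) (G x))%:E) `^ 2^-1)%E
            | G in weak_gradient Omega w].

Definition Lp_spectral Omega (p : R) (A : V -> 'M[R]_d) : \bar R :=
  ((\int[mu]_(x in Omega) (spectral_norm (A x) `^ p)%:E) `^ p^-1)%E.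

Definition ae_uniformly_posdef Omega (A : V -> 'M[R]_d) : Prop :=
  exists2 gamma : R, 0 < gamma &
    {ae mu, forall x, Omega x -> loewner_le gamma%:M (A x)}.

Definition uniformly_posdef (S : set V) (A : V -> 'M[R]_d) : Prop :=
  exists2 gamma : R, 0 < gamma &
    forall x, S x -> loewner_le gamma%:M (A x).

End sobolev.

Section mesh.
Context {R : realType} {d : nat}.
Local Notation V := 'rV[R]_d.
Local Notation mu := (@lebesgue_rV R d).
Implicit Types (Omega : set V) (K : 'I_d.+1 -> V).

(* A simplex is given by its d+1 vertices. *)
Definition face K (A : {set 'I_d.+1}) : set V :=
  [set x | exists l : 'I_d.+1 -> R,
    [/\ forall i, 0 <= l i, forall i, i \notin A -> l i = 0,
        \sum_i l i = 1 & x = \sum_i l i *: K i]].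

Definition simplex K : set V := face K [set: 'I_d.+1]%SET.

Definition edge_mx K : 'M[R]_d := \matrix_i (K (lift ord0 i) - K ord0).

Definition nondegenerate_simplex K : Prop := edge_mx K \in unitmx.

Definition simplex_volume K : R := fine (mu (simplex K)).

(* The Jacobian matrix F_K' (acting on columns) of the affine map F_K that
   sends the i-th vertex of Khat to the i-th vertex of K: as rows are edges,
   edge_mx Khat *m (F_K')^T = edge_mx K. *)
Definition jac Khat K : 'M[R]_d := (invmx (edge_mx Khat) *m edge_mx K)^T.

(* A bounded domain which is the interior of a polyhedron. *)
Definition polyhedral_domain Omega : Prop :=
  [/\ open Omega, connected Omega, Omega !=set0 &
      exists (n : nat) (S : 'I_n -> 'I_d.+1 -> V),
        (forall k, nondegenerate_simplex (S k)) /\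
        Omega = interior (\bigcup_(k in [set: 'I_n]) simplex (S k))].

(* Conforming simplicial mesh with N elements: two distinct elements meet in a
   common proper (possibly empty) face. *)
Definition simplicial_mesh Omega N (T : 'I_N -> 'I_d.+1 -> V) : Prop :=
  [/\ forall e, nondegenerate_simplex (T e),
      \bigcup_(e in [set: 'I_N]) simplex (T e) = closure Omega &
      forall e e', e != e' -> exists A B : {set 'I_d.+1},
        [/\ A != [set: 'I_d.+1]%SET,
            simplex (T e) `&` simplex (T e') = face (T e) A &
            simplex (T e) `&` simplex (T e') = face (T e') B]].

Definition boundary Omega : set V := closure Omega `\` interior Omega.

Definition fe_space Omega N (T : 'I_N -> 'I_d.+1 -> V) (w : V -> R) : Prop :=
  {within closure Omega, continuous w} /\
  forall e, exists (a : V) (b : R),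
    forall x, simplex (T e) x -> w x = dotv a x + b.

(* w = Pi_h v on the closure of Omega. *)
Definition nodal_interpolant Omega N (T : 'I_N -> 'I_d.+1 -> V)
    (v w : V -> R) : Prop :=
  fe_space Omega T w /\ forall e i, w (T e i) = v (T e i).

(* RK is an average of Rec over S: the expectation of Rec at a random point of
   S.  A finitely supported point gives (weighted) means of values, such as the
   mean of the vertex values; a uniform one gives the integral mean. *)
Definition is_average (Rec : V -> 'M[R]_d) (S : set V) (RK : 'M[R]_d) : Prop :=
  exists (dsp : measure_display) (W : measurableType dsp)
         (P : probability W R) (X : W -> V),
    (forall t, S (X t)) /\
    forall i j, P.-integrable setT (fun t => (Rec (X t) i j)%:E) /\
                RK i j = \int[P]_t Rec (X t) i j.

End mesh.

Section boundary_value_problem.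
Context {R : realType} {d : nat}.
Local Notation V := 'rV[R]_d.
Local Notation mu := (@lebesgue_rV R d).

(* L w = - div (A grad w + w B) + C . grad w + E w *)
Record diff_op := DiffOp {
  opA : V -> 'M[R]_d;
  opB : V -> V;
  opC : V -> V;
  opE : V -> R }.

Implicit Types (Omega : set V) (L : diff_op).

Definition bounded_coef Omega (a : V -> R) : Prop :=
  measurable_fun Omega (a : V -> measurableTypeR R) /\
  exists M : R, forall x, Omega x -> `|a x| <= M.

Definition elliptic Omega L : Prop :=
  [/\ forall i j, bounded_coef Omega (fun x => opA L x i j),
      forall i, bounded_coef Omega (fun x => opB L x 0 i),
      forall i, bounded_coef Omega (fun x => opC L x 0 i),
      bounded_coef Omega (opE L) &
      exists2 alpha : R, 0 < alpha &
        forall x, Omega x -> forall xi : V,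
          alpha * dotv xi xi <= dotv (xi *m (opA L x)^T) xi].

(* Weak form of L; Gw and Gv stand for the gradients of w and v. *)
Definition bilinear_form Omega L (w : V -> R) (Gw : V -> V)
    (v : V -> R) (Gv : V -> V) : R :=
  \int[mu]_(x in Omega)
    (dotv (Gw x *m (opA L x)^T + w x *: opB L x) (Gv x) +
     (dotv (opC L x) (Gw x) + opE L x * w x) * v x).

(* L u = f in Omega (weakly) and u = g on the boundary. *)
Definition bvp_solution Omega L (f g u : V -> R) : Prop :=
  [/\ {within closure Omega, continuous u},
      exists2 Gu, weak_gradient Omega u Gu &
        forall phi, test_function Omega phi ->
          bilinear_form Omega L u Gu phi (gradient phi) =
          \int[mu]_(x in Omega) (f x * phi x) &
      forall x, boundary Omega x -> u x = g x].

Definition fe_solution Omega L (f g : V -> R) N (T : 'I_N -> 'I_d.+1 -> V)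
    (uh : V -> R) : Prop :=
  [/\ fe_space Omega T uh,
      forall e i, boundary Omega (T e i) -> uh (T e i) = g (T e i) &
      exists2 Guh, weak_gradient Omega uh Guh &
        forall v Gv, fe_space Omega T v ->
          (forall x, boundary Omega x -> v x = 0) ->
          weak_gradient Omega v Gv ->
          bilinear_form Omega L uh Guh v Gv =
          \int[mu]_(x in Omega) (f x * v x)].

End boundary_value_problem.

Section mesh_quality.
Context {R : realType} {d : nat}.
Local Notation V := 'rV[R]_d.

Definition metric_tensor (RK : 'M[R]_d) : 'M[R]_d :=
  (\det RK `^ (- (d.+2)%:R^-1) * spectral_norm RK `^ (2 / (d.+2)%:R)) *: RK.

Definition quasi_uniform (Khat : 'I_d.+1 -> V) (Ceq Cali : R)
    N (T : 'I_N -> 'I_d.+1 -> V) (M : 'I_N -> 'M[R]_d) : Prop :=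
  (forall e, simplex_volume (T e) * Num.sqrt (\det (M e)) <=
     Ceq * (N%:R^-1 * \sum_e' simplex_volume (T e') * Num.sqrt (\det (M e')))) /\
  (forall e, d%:R^-1 * \tr ((jac Khat (T e))^T *m M e *m jac Khat (T e)) <=
     Cali * simplex_volume (T e) `^ (2 / d%:R) * \det (M e) `^ d%:R^-1).

End mesh_quality.

(* Main.v *)
(** On an element K let c = C_{R+,K}.  The bound 0 <= H <= c R_K a.e. makes u
    convex on K and u minus half the quadratic form of c R_K concave on K: this
    is seen on mollifications of u, whose second derivatives along segments are
    averages of the weak Hessian, and the bumps are then shrunk to a point.
    Hence at interior points of K the function u has a gradient, and its first
    order Taylor remainder at the vertices lies between 0 and half the form.
    Subtracting two vertices, g = grad (u - Pi_h u) satisfies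
    |g . e| <= 2 c tr S for the edges e of K, where S = E R_K E^T and the rows of
    E are the edges at one vertex.  Inverting S and using the alignment
    condition, |g|^2 <= C ||R_K|| c^2 C_ali^(d+1) (|K|^2 det R_K)^(1/d).
    With rho_K = det(M_K)^(1/2), the factor ||R_K|| (|K|^2 det R_K)^(1/d) |K| is
    (|K| rho_K)^((d+2)/d), which equidistribution bounds uniformly in K; the
    quadratic mean of the C_{R+,K} then bounds the sum over the elements.
    Conversely C_{R-} R_K <= H bounds sum_K |K| rho_K by the integral of
    ||det(H)^(1/d) H||^(d/(d+2)).
    Finally u - Pi_h u is Lipschitz on each element, so its elementwise gradient
    is its weak gradient, and Cea's estimate applies to Pi_h u. *)

Require Import Defs.
From mathcomp Require Import all_boot all_order all_algebra.
From mathcomp Require Import all_classical all_reals all_analysis.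
From mathcomp Require Import measurable_realfun ring lra.
Set Implicit Arguments. Unset Strict Implicit. Unset Printing Implicit Defensive.
Import Order.TTheory GRing.Theory Num.Theory numFieldNormedType.Exports.
Local Open Scope classical_set_scope.
Local Open Scope ring_scope.

(** * Positive definite matrices *)

(** The Hessian exists only almost everywhere and elements may be arbitrarily anisotropic, so no
    step may use shape regularity. The constancy of R_K on an element is what makes the argument
    elementary: the two-sided Hessian bound becomes a convexity inequality for the continuous
    function u, free of derivatives, and everything on the element is then pointwise.

    The exponents arise as follows. Alignment controls only the trace of S, so S is inverted as adj
    S / det S, which costs (tr S)^(d-1); the squared edge bound adds (tr S)^2. Hence C_ali^(d+1),
    before the square root. With s the sum of the |K| rho_K, each element contributes (C_eq s /
    N)^((d+2)/d); N of them leave N^(-2/d), and the square root gives N^(-1/d) and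
    C_eq^((d+2)/(2d)). Under H >= C_R- R_K both det(H)^(1/d) and H carry one factor C_R-, so s is
    compared with the integral up to C_R-^(2d/(d+2)), and the power (d+2)/(2d) turns this into the
    single C_R- of the denominator. *)

Section dot_product.
Context {R : realType}.

Lemma dotvE n (x y : 'rV[R]_n) : dotv x y = \sum_i x 0 i * y 0 i.
Proof. by rewrite /dotv mxE; apply: eq_bigr => i _; rewrite mxE. Qed.

Lemma dotvC n (x y : 'rV[R]_n) : dotv x y = dotv y x.
Proof. by rewrite !dotvE; apply: eq_bigr => i _; rewrite mulrC. Qed.

Lemma dotvDl n (x y z : 'rV[R]_n) : dotv (x + y) z = dotv x z + dotv y z.
Proof. by rewrite /dotv mulmxDl mxE. Qed.

Lemma dotvZl n c (x z : 'rV[R]_n) : dotv (c *: x) z = c * dotv x z.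
Proof. by rewrite /dotv -scalemxAl mxE. Qed.

Lemma dotvDr n (x y z : 'rV[R]_n) : dotv z (x + y) = dotv z x + dotv z y.
Proof. by rewrite dotvC dotvDl !(dotvC _ z). Qed.

Lemma dotvZr n c (x z : 'rV[R]_n) : dotv z (c *: x) = c * dotv z x.
Proof. by rewrite dotvC dotvZl dotvC. Qed.

Lemma dotvNl n (x z : 'rV[R]_n) : dotv (- x) z = - dotv x z.
Proof. by rewrite -scaleN1r dotvZl mulN1r. Qed.

Lemma dotvNr n (x z : 'rV[R]_n) : dotv z (- x) = - dotv z x.
Proof. by rewrite dotvC dotvNl dotvC. Qed.

Lemma dotvBl n (x y z : 'rV[R]_n) : dotv (x - y) z = dotv x z - dotv y z.
Proof. by rewrite dotvDl dotvNl. Qed.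

Lemma dotvBr n (x y z : 'rV[R]_n) : dotv z (x - y) = dotv z x - dotv z y.
Proof. by rewrite dotvDr dotvNr. Qed.

Lemma dotv0l n (z : 'rV[R]_n) : dotv 0 z = 0.
Proof. by rewrite /dotv mul0mx mxE. Qed.

Lemma dotv0r n (z : 'rV[R]_n) : dotv z 0 = 0.
Proof. by rewrite dotvC dotv0l. Qed.

Lemma dotv_suml n I (r : seq I) (F : I -> 'rV[R]_n) z :
  dotv (\sum_(i <- r) F i) z = \sum_(i <- r) dotv (F i) z.
Proof.
by elim/big_rec2: _ => [|i a b _ <-]; rewrite ?dotv0l// dotvDl.
Qed.

Lemma dotv_sumr n I (r : seq I) (F : I -> 'rV[R]_n) z :
  dotv z (\sum_(i <- r) F i) = \sum_(i <- r) dotv z (F i).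
Proof.
by rewrite dotvC dotv_suml; apply: eq_bigr => i _; rewrite dotvC.
Qed.

Lemma dotv_mulmx m n (x : 'rV[R]_m) (A : 'M[R]_(m, n)) y :
  dotv (x *m A) y = dotv x (y *m A^T).
Proof. by rewrite /dotv trmx_mul trmxK mulmxA. Qed.

Lemma dotvv_ge0 n (x : 'rV[R]_n) : 0 <= dotv x x.
Proof. by rewrite dotvE sumr_ge0// => i _; rewrite -expr2 sqr_ge0. Qed.

Lemma dotvv_eq0 n (x : 'rV[R]_n) : (dotv x x == 0) = (x == 0).
Proof.
apply/eqP/eqP => [|->]; last by rewrite dotv0l.
rewrite dotvE => /psumr_eq0P => h; apply/rowP => i; rewrite mxE.
apply/eqP; rewrite -sqrf_eq0 expr2; apply/eqP; apply: h => // j _.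
by rewrite -expr2 sqr_ge0.
Qed.

Lemma dotvv_gt0 n (x : 'rV[R]_n) : (0 < dotv x x) = (x != 0).
Proof. by rewrite lt_def dotvv_eq0 dotvv_ge0 andbT. Qed.

Lemma dotv_delta n (x : 'rV[R]_n) i : dotv x (delta_mx 0 i) = x 0 i.
Proof.
rewrite dotvE (bigD1 i)//= !mxE !eqxx mulr1 big1 ?addr0// => j ji.
by rewrite mxE eqxx (negbTE ji) mulr0.
Qed.

Lemma dotv_delta_mx n (A : 'M[R]_n) i j :
  dotv (delta_mx 0 i *m A) (delta_mx 0 j) = A i j.
Proof. by rewrite dotv_delta -rowE mxE. Qed.

Lemma l2norm_ge0 n (x : 'rV[R]_n) : 0 <= l2norm x.
Proof. exact: sqrtr_ge0. Qed.

Lemma l2norm_sqr n (x : 'rV[R]_n) : l2norm x ^+ 2 = dotv x x.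
Proof. by rewrite sqr_sqrtr// dotvv_ge0. Qed.

Lemma l2normZ n c (x : 'rV[R]_n) : l2norm (c *: x) = `|c| * l2norm x.
Proof.
by rewrite /l2norm dotvZl dotvZr mulrA -expr2 sqrtrM ?sqr_ge0// sqrtr_sqr.
Qed.

Lemma coord_sqr_le_dotvv n (x : 'rV[R]_n) i : x 0 i ^+ 2 <= dotv x x.
Proof.
rewrite dotvE (bigD1 i)//= -expr2 lerDl sumr_ge0// => j _.
by rewrite -expr2 sqr_ge0.
Qed.

End dot_product.

Section positive_forms.
Context {R : realType}.

Definition psdmx n (A : 'M[R]_n) :=
  A^T = A /\ forall x, 0 <= dotv (x *m A) x.

Definition pdmx n (A : 'M[R]_n) :=
  A^T = A /\ forall x, x != 0 -> 0 < dotv (x *m A) x.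

Lemma pdmx_psd n (A : 'M[R]_n) : pdmx A -> psdmx A.
Proof.
case=> sA pA; split=> // x; have [->|/pA/ltW//] := eqVneq x 0.
by rewrite mul0mx dotv0l.
Qed.

Lemma sym_dotvC n (A : 'M[R]_n) x y : A^T = A ->
  dotv (x *m A) y = dotv (y *m A) x.
Proof. by move=> sA; rewrite dotv_mulmx sA dotvC. Qed.

Lemma loewner_leP n (A B : 'M[R]_n) : loewner_le A B <->
  [/\ A^T = A, B^T = B & forall x, dotv (x *m A) x <= dotv (x *m B) x].
Proof.
split=> -[sA sB h]; split=> // x; have := h x;
  by rewrite mulmxBr dotvBl subr_ge0.
Qed.

Lemma loewner_le_scalar n c (A : 'M[R]_n) : 0 < c ->
  loewner_le c%:M A -> pdmx A.
Proof.
move=> c0 /loewner_leP[_ sA h]; split=> // x x0; apply: lt_le_trans (h x).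
by rewrite mul_mx_scalar dotvZl mulr_gt0// dotvv_gt0.
Qed.

Lemma psd_cauchy_schwarz n (A : 'M[R]_n) x y : psdmx A ->
  dotv (x *m A) y ^+ 2 <= dotv (x *m A) x * dotv (y *m A) y.
Proof.
move=> [sA pA].
set a := dotv _ x; set b := dotv _ y; set c := dotv _ y.
have q s t : 0 <= s ^+ 2 * a + 2 * s * t * b + t ^+ 2 * c.
  have := pA (s *: x + t *: y).
  rewrite !(mulmxDl, dotvDl, dotvDr, =^~ scalemxAl, dotvZl, dotvZr).
  rewrite (sym_dotvC y x)// -/a -/b -/c; move: (a) (b) (c) => a' b' c' h.
  by lra.
have a0 : 0 <= a by exact: pA.
have c0 : 0 <= c by exact: pA.
have [ha|ha] := eqVneq a 0.
  have [-> |b0] := eqVneq b 0; first by rewrite expr0n/= mulr_ge0.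
  (* With [a = 0] and [b] nonzero the quadratic is affine in [s]; this [s] makes it equal to
     [-1]. *)
  have := q (- (c + 1) / (2 * b)) 1; rewrite ha.
  have -> : (- (c + 1) / (2 * b)) ^+ 2 * 0 + 2 * (- (c + 1) / (2 * b)) * 1 * b +
    1 ^+ 2 * c = -1 by field.
  by rewrite oppr_ge0 ler10.
have {}ha : 0 < a by rewrite lt_def ha.
have := q (- b) a.
have -> : (- b) ^+ 2 * a + 2 * - b * a * b + a ^+ 2 * c = a * (a * c - b ^+ 2).
  by ring.
by rewrite pmulr_rge0// subr_ge0.
Qed.

(** Cauchy-Schwarz against [y = x *m A] forces the square of [dotv y y] to be at most zero. *)
Lemma psd_form0 n (A : 'M[R]_n) x : psdmx A -> dotv (x *m A) x = 0 -> x *m A = 0.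
Proof.
move=> pA q0; have := psd_cauchy_schwarz x (x *m A) pA.
rewrite q0 mul0r => h; apply/eqP; rewrite -dotvv_eq0 -sqrf_eq0.
by rewrite eq_le h sqr_ge0.
Qed.

Lemma pdmx_unit n (A : 'M[R]_n) : pdmx A -> A \in unitmx.
Proof.
move=> [sA pA]; rewrite -row_free_unit; apply/inj_row_free => x xA.
apply/eqP/negPn/negP => /pA; by rewrite xA dotv0l ltxx.
Qed.

Lemma formM_scale n c (A : 'M[R]_n) x y : dotv (x *m (c *: A)) y = c * dotv (x *m A) y.
Proof. by rewrite -scalemxAr dotvZl. Qed.

Lemma psdmxZ n c (A : 'M[R]_n) : 0 <= c -> psdmx A -> psdmx (c *: A).
Proof.
move=> c0 [sA pA]; split; first by rewrite linearZ /= sA.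
by move=> x; rewrite formM_scale mulr_ge0.
Qed.

Lemma pdmxZ n c (A : 'M[R]_n) : 0 < c -> pdmx A -> pdmx (c *: A).
Proof.
move=> c0 [sA pA]; split; first by rewrite linearZ /= sA.
by move=> x /pA h; rewrite formM_scale mulr_gt0.
Qed.

Lemma pdmx_congr n (P A : 'M[R]_n) : P \in unitmx -> pdmx A ->
  pdmx (P *m A *m P^T).
Proof.
move=> uP [sA pA]; split.
  by rewrite !trmx_mul trmxK sA mulmxA.
move=> x x0; rewrite !mulmxA dotv_mulmx trmxK; apply: pA.
by apply: contra x0 => /eqP h; rewrite -(mulmxK uP x) h mul0mx.
Qed.

Lemma psd_diag_ge0 n (A : 'M[R]_n) i : psdmx A -> 0 <= A i i.
Proof. by case=> _ /(_ (delta_mx 0 i)); rewrite dotv_delta_mx. Qed.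

Lemma psd_diag_le_tr n (A : 'M[R]_n) i : psdmx A -> A i i <= \tr A.
Proof.
move=> pA; rewrite /mxtrace (bigD1 i)//= lerDl sumr_ge0// => j _.
exact: psd_diag_ge0.
Qed.

Lemma psd_tr_ge0 n (A : 'M[R]_n) : psdmx A -> 0 <= \tr A.
Proof. by move=> pA; rewrite sumr_ge0// => j _; exact: psd_diag_ge0. Qed.

(** Each entry is at most the trace, by Cauchy-Schwarz on unit vectors; the factor [n] is the price
    of bounding the entries one by one. *)
Lemma psd_form_le_tr n (A : 'M[R]_n) x : psdmx A ->
  dotv (x *m A) x <= n%:R * \tr A * dotv x x.
Proof.
move=> pA.
have tA := psd_tr_ge0 pA.
have bA i j : `|A i j| <= \tr A.
  rewrite -(@ler_pXn2r _ 2)// ?nnegrE//.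
  rewrite real_normK ?num_real//.
  have := psd_cauchy_schwarz (delta_mx 0 i) (delta_mx 0 j) pA.
  rewrite !dotv_delta_mx => /le_trans; apply; rewrite expr2.
  by rewrite ler_pM ?psd_diag_ge0 ?psd_diag_le_tr.
have -> : dotv (x *m A) x = \sum_i \sum_j x 0 i * A i j * x 0 j.
  rewrite exchange_big dotvE; apply: eq_bigr => j _.
  by rewrite mxE mulr_suml.
apply: (@le_trans _ _ (\sum_i \sum_j \tr A * ((x 0 i ^+ 2 + x 0 j ^+ 2) / 2))).
  apply: ler_sum => i _; apply: ler_sum => j _.
  apply: le_trans (ler_norm _) _.
  rewrite (_ : _ * _ = A i j * (x 0 i * x 0 j)) ?normrM; last by ring.
  apply: ler_pM => //.
  rewrite -?normrM ler_norml; have := sqr_ge0 (x 0 i - x 0 j).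
  by have := sqr_ge0 (x 0 i + x 0 j); move: (x 0 i) (x 0 j) => a b; nra.
under eq_bigr do rewrite -mulr_sumr -mulr_suml big_split /= sumr_const card_ord.
rewrite -mulr_sumr -mulr_suml big_split /= sumr_const card_ord.
under eq_bigr do rewrite -mulr_natl.
rewrite -mulr_sumr -mulr_natl.
have -> : \sum_i x 0 i ^+ 2 = dotv x x by rewrite dotvE; apply: eq_bigr.
by rewrite le_eqVlt; apply/orP; left; apply/eqP; field.
Qed.

End positive_forms.

Section schur_complement.
Context {R : realType} {n : nat}.
Implicit Type A : 'M[R]_(1 + n).

Definition schur A : 'M[R]_n :=
  drsubmx A - dlsubmx A *m ((A 0 0)^-1 *: ursubmx A).

Lemma ulsubmx11 A : ulsubmx A = (A 0 0)%:M.
Proof.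
rewrite [LHS]mx11_scalar !mxE; congr (_ _ _)%:M; exact: val_inj.
Qed.

(** Block LU factorization with a unipotent left factor. *)
Lemma det_schur A : A 0 0 != 0 -> \det A = A 0 0 * \det (schur A).
Proof.
move=> a0.
have -> : \det A = \det (block_mx 1%:M 0 ((A 0 0)^-1 *: dlsubmx A) 1%:M *m
    block_mx (ulsubmx A) (ursubmx A) 0 (schur A)).
  congr determinant; rewrite mulmx_block -[LHS]submxK.
  rewrite !mul1mx !mul0mx ?(addr0, mulmx0); congr block_mx.
    by rewrite ulsubmx11 -scalemxAl mul_mx_scalar scalerA mulVf// scale1r.
  by rewrite /schur -scalemxAr -scalemxAl addrC subrK.
rewrite det_mulmx det_lblock !det1 !mul1r det_ublock ulsubmx11.
by rewrite det_scalar1.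
Qed.

Lemma dotv_row_mx m1 m2 (x1 y1 : 'rV[R]_m1) (x2 y2 : 'rV[R]_m2) :
  dotv (row_mx x1 x2) (row_mx y1 y2) = dotv x1 y1 + dotv x2 y2.
Proof. by rewrite /dotv tr_row_mx mul_row_col mxE. Qed.

Lemma sym_dlsubmx A : A^T = A -> dlsubmx A = (ursubmx A)^T.
Proof. by move=> sA; rewrite -[LHS]trmxK trmx_dlsub sA. Qed.

Lemma sym_schur A : A^T = A -> (schur A)^T = schur A.
Proof.
move=> sA; rewrite /schur linearB /= trmx_drsub sA (sym_dlsubmx sA).
by rewrite trmx_mul trmxK linearZ /= -scalemxAl -scalemxAr.
Qed.

(* Completion of the square in the first coordinate. *)
Lemma form_schur A s (v : 'rV[R]_n) : A^T = A -> A 0 0 != 0 ->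
  dotv (row_mx s%:M v *m A) (row_mx s%:M v) =
  A 0 0 * (s + dotv v (ursubmx A) / A 0 0) ^+ 2 + dotv (v *m schur A) v.
Proof.
move=> sA a0; rewrite -{1}(submxK A) mul_row_block dotv_row_mx ulsubmx11.
rewrite /schur (sym_dlsubmx sA) mulmxBr dotvBl !dotvDl.
set b := ursubmx A.
have e1 (t : R) : dotv (t%:M : 'rV[R]_1) (s%:M) = t * s.
  by rewrite dotvE big_ord1 !mxE eqxx !mulr1n.
have e2 : v *m b^T = (dotv v b)%:M by rewrite [LHS]mx11_scalar.
rewrite -scalar_mxM e1 e2 e1 mul_scalar_mx dotvZl mulmxA e2.
rewrite mul_scalar_mx !dotvZl (dotvC b); field; exact: a0.
Qed.

Lemma row_scalar_neq0 s (v : 'rV[R]_n) : v != 0 -> row_mx (s%:M : 'M[R]_1) v != 0.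
Proof.
apply: contra => /eqP; rewrite -row_mx0 => /eq_row_mx[_ ->]; exact: eqxx.
Qed.

Lemma pd_corner_gt0 A : pdmx A -> 0 < A 0 0.
Proof.
move=> [_ pA]; rewrite -dotv_delta_mx; apply: pA.
by apply/eqP => /matrixP/(_ 0 0)/eqP; rewrite !mxE eqxx oner_eq0.
Qed.

Lemma pd_schur A : pdmx A -> pdmx (schur A).
Proof.
move=> pA; have a0 := pd_corner_gt0 pA; case: (pA) => sA qA.
split; first exact: sym_schur.
move=> v v0.
have := qA _ (row_scalar_neq0 (- (dotv v (ursubmx A) / A 0 0)) v0).
by rewrite form_schur ?gt_eqF// addNr expr0n/= mulr0 add0r.
Qed.

(** By [form_schur] the form of the Schur complement at [v] is the minimum over [s] of the full form
    at [row_mx s%:M v]; the inequality is tested at the minimizer for [B]. *)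
Lemma schur_le A B v : pdmx A -> pdmx B ->
  (forall x, dotv (x *m A) x <= dotv (x *m B) x) ->
  dotv (v *m schur A) v <= dotv (v *m schur B) v.
Proof.
move=> pA pB AB; have a0 := pd_corner_gt0 pA; have b0 := pd_corner_gt0 pB.
have := AB (row_mx (- (dotv v (ursubmx B) / B 0 0))%:M v).
rewrite !form_schur ?gt_eqF//; [|by case: pB|by case: pA].
rewrite addNr expr0n/= mulr0 add0r; apply: le_trans.
by rewrite lerDr mulr_ge0 ?sqr_ge0// ltW.
Qed.

Lemma tr_schur_le A : pdmx A -> \tr (schur A) <= \tr A.
Proof.
move=> pA; have a0 := pd_corner_gt0 pA.
rewrite -{2}(submxK A) mxtrace_block ulsubmx11 mxtrace_scalar mulr1n.
rewrite /schur (sym_dlsubmx _); last by case: pA.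
rewrite raddfB /= -scalemxAr mxtraceZ mxtrace_mulC.
have : 0 <= \tr (ursubmx A *m (ursubmx A)^T).
  by rewrite /mxtrace big_ord1; exact: dotvv_ge0.
move: (\tr (_ *m _)) (\tr (drsubmx A)) => t r t0.
have : 0 <= (A 0 0)^-1 * t by rewrite mulr_ge0 ?invr_ge0// ltW.
by lra.
Qed.

End schur_complement.

Section determinant_bounds.
Context {R : realType}.

Lemma pd_det_gt0 n (A : 'M[R]_n) : pdmx A -> 0 < \det A.
Proof.
elim: n A => [|n IH] A pA; first by rewrite det_mx00.
have a0 := pd_corner_gt0 pA.
by rewrite (det_schur (n := n)) ?gt_eqF// mulr_gt0//; exact/IH/(pd_schur (n := n)).
Qed.

(** Induction through [det_schur]: the pivot and the Schur complement are both monotone, so no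
    spectral theorem enters. *)
Lemma pd_det_le n (A B : 'M[R]_n) : pdmx A -> pdmx B ->
  (forall x, dotv (x *m A) x <= dotv (x *m B) x) -> \det A <= \det B.
Proof.
elim: n A B => [|n IH] A B pA pB AB; first by rewrite !det_mx00.
have a0 := pd_corner_gt0 pA; have b0 := pd_corner_gt0 pB.
rewrite !(det_schur (n := n)) ?gt_eqF//; apply: ler_pM; first exact: ltW.
- exact/ltW/pd_det_gt0/(pd_schur (n := n)).
- by have := AB (delta_mx 0 0); rewrite !dotv_delta_mx.
- apply: IH; [exact: (pd_schur (n := n))..|move=> x].
  exact: (schur_le (n := n)).
Qed.

(** A substitute for the arithmetic-geometric mean inequality on eigenvalues, weaker by [n ^+ n]:
    each pivot is at most the trace, and passing to the Schur complement does not increase the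
    trace. *)
Lemma pd_det_le_tr n (A : 'M[R]_n) : pdmx A -> \det A <= (\tr A) ^+ n.
Proof.
elim: n A => [|n IH] A pA; first by rewrite det_mx00.
have a0 := pd_corner_gt0 pA.
have pS := pd_schur (n := n) pA.
rewrite (det_schur (n := n)) ?gt_eqF// exprS; apply: ler_pM; first exact: ltW.
- exact/ltW/pd_det_gt0.
- exact/psd_diag_le_tr/pdmx_psd.
- apply: le_trans (IH _ pS) _; rewrite lerXn2r ?nnegrE.
  + by [].
  + exact/psd_tr_ge0/pdmx_psd.
  + exact/psd_tr_ge0/pdmx_psd.
  + exact: (tr_schur_le (n := n)).
Qed.

Lemma pd_minor n (A : 'M[R]_n) i : pdmx A -> pdmx (row' i (col' i A)).
Proof.
move=> [sA pA]; split.
  by apply/matrixP => j k; rewrite !mxE -{1}sA mxE.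
move=> x x0.
pose y : 'rV[R]_n := \row_j oapp (x 0) 0 (unlift i j).
have yi : y 0 i = 0 by rewrite mxE unlift_none.
have yl j : y 0 (lift i j) = x 0 j by rewrite mxE liftK.
have y0 : y != 0.
  apply: contra x0 => /eqP y0; apply/eqP/rowP => j.
  by rewrite -yl y0 !mxE.
have := pA _ y0; congr (_ < _); rewrite !dotvE.
case: n i A sA pA x x0 y yi yl y0 => [[]//|n] i A sA pA x x0 y yi yl y0.
rewrite (bigD1_ord i)//= yi mulr0 add0r; apply: eq_bigr => j _.
rewrite yl !mxE; congr (_ * _).
rewrite (bigD1_ord i)//= yi mul0r add0r; apply: eq_bigr => k _.
by rewrite yl !mxE.
Qed.

Lemma tr_minor_le n (A : 'M[R]_n) i : psdmx A -> \tr (row' i (col' i A)) <= \tr A.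
Proof.
case: n i A => [[]//|n] i A pA.
rewrite /mxtrace (bigD1_ord i)//= (eq_bigr (fun j => A (lift i j) (lift i j))).
  by rewrite lerDr psd_diag_ge0.
by move=> j _; rewrite !mxE.
Qed.

Lemma tr_adj_le n (A : 'M[R]_n) : pdmx A -> \tr (\adj A) <= n%:R * (\tr A) ^+ n.-1.
Proof.
move=> pA; rewrite /mxtrace.
apply: (@le_trans _ _ (\sum_(i < n) (\tr A) ^+ n.-1)); last first.
  by rewrite sumr_const card_ord mulr_natl.
apply: ler_sum => i _; rewrite mxE /cofactor addnn -signr_odd odd_double mul1r.
apply: le_trans (pd_det_le_tr (pd_minor i pA)) _.
rewrite lerXn2r ?nnegrE//; first exact/psd_tr_ge0/pdmx_psd/pd_minor.
- exact/psd_tr_ge0/pdmx_psd.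
- exact/tr_minor_le/pdmx_psd.
Qed.

(* The trace of the adjugate is a sum of principal minors, hence at most
   [n (\tr S)^(n-1)]; this bounds the form of the inverse [\adj S / \det S]. *)
Lemma pd_inverse_form_le n (S : 'M[R]_n) z : pdmx S ->
  \det S * dotv (z *m S) z <=
  n%:R ^+ 2 * (\tr S) ^+ n.-1 * dotv (z *m S) (z *m S).
Proof.
move=> pS; have d0 := pd_det_gt0 pS.
have sS : S^T = S by case: pS.
have adjE y : dotv (y *m S *m \adj S) (y *m S) = \det S * dotv (y *m S) y.
  by rewrite -mulmxA mul_mx_adj mul_mx_scalar dotvZl dotvC.
have pT : psdmx (\adj S).
  split; first by rewrite trmx_adj sS.
  move=> x; have uS := pdmx_unit pS.
  rewrite -(mulmxKV uS x) adjE mulr_ge0 ?(ltW d0)//.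
  by case: (pdmx_psd pS).
rewrite -adjE; apply: le_trans (psd_form_le_tr _ pT) _.
rewrite ler_wpM2r ?dotvv_ge0// expr2 -mulrA ler_wpM2l//.
exact: tr_adj_le.
Qed.

End determinant_bounds.

Section spectral_norm.
Context {R : realType} {n : nat}.
Implicit Types (A B : 'M[R]_n) (x y : 'rV[R]_n).

Lemma psdmx1 : psdmx (1%:M : 'M[R]_n).
Proof. by split; rewrite ?trmx1// => x; rewrite mulmx1 dotvv_ge0. Qed.

Lemma dotv_le_l2norm x y : dotv x y <= l2norm x * l2norm y.
Proof.
apply: le_trans (ler_norm _) _.
rewrite -(@ler_pXn2r _ 2)// ?nnegrE ?mulr_ge0 ?l2norm_ge0//.
rewrite exprMn !l2norm_sqr real_normK ?num_real//.
by have := psd_cauchy_schwarz x y psdmx1; rewrite !mulmx1.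
Qed.

Lemma spectral_norm_has_ubound A :
  has_ubound [set l2norm (x *m A^T) | x in [set x | l2norm x <= 1]].
Proof.
exists (Num.sqrt (n%:R * \tr (A^T *m A))) => _ [x /= x1 <-].
have pA : psdmx (A^T *m A).
  split; first by rewrite trmx_mul trmxK.
  by move=> y; rewrite mulmxA dotv_mulmx dotvv_ge0.
rewrite /l2norm ler_wsqrtr//.
rewrite -{1}[A]trmxK -dotv_mulmx trmxK -mulmxA.
apply: le_trans (psd_form_le_tr _ pA) _.
rewrite ler_piMr ?mulr_ge0 ?psd_tr_ge0//.
by rewrite -l2norm_sqr expr_le1// l2norm_ge0.
Qed.

Lemma l2norm_spectral_unit A x : l2norm x <= 1 -> l2norm (x *m A^T) <= spectral_norm A.
Proof.
by move=> x1; apply: ub_le_sup; [exact: spectral_norm_has_ubound|exists x].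
Qed.

Lemma spectral_norm_ge0 A : 0 <= spectral_norm A.
Proof.
have : l2norm (0 : 'rV[R]_n) <= 1 by rewrite /l2norm dotv0l sqrtr0.
by move/(l2norm_spectral_unit A); apply: le_trans; exact: l2norm_ge0.
Qed.

Lemma spectral_norm_le A c :
  (forall x, l2norm x <= 1 -> l2norm (x *m A^T) <= c) -> spectral_norm A <= c.
Proof.
move=> h; apply: ge_sup => [|_ [x /= x1 <-]]; last exact: h.
by exists (l2norm (0 *m A^T)), 0 => //=; rewrite /l2norm dotv0l sqrtr0.
Qed.

Lemma l2norm_spectral A x : l2norm (x *m A^T) <= spectral_norm A * l2norm x.
Proof.
have [->|x0] := eqVneq x 0.
  by rewrite mul0mx /l2norm dotv0l sqrtr0 mulr0.
have lx : 0 < l2norm x by rewrite sqrtr_gt0 dotvv_gt0.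
have := @l2norm_spectral_unit A ((l2norm x)^-1 *: x).
rewrite -scalemxAl !l2normZ gtr0_norm ?invr_gt0// mulVf ?gt_eqF// => /(_ (lexx _)).
by rewrite mulrC ler_pdivrMr.
Qed.

Lemma form_le_spectral A x : A^T = A -> dotv (x *m A) x <= spectral_norm A * dotv x x.
Proof.
move=> sA; apply: le_trans (dotv_le_l2norm _ _) _.
rewrite -l2norm_sqr expr2 mulrA ler_wpM2r ?l2norm_ge0//.
by have := l2norm_spectral A x; rewrite sA.
Qed.

(** This is A^2 <= ||A|| A. Cauchy-Schwarz for the form of [A] between [x] and [y = x *m A] replaces
    the square root of [A]. *)
Lemma psd_image_le_spectral A x : psdmx A ->
  dotv (x *m A) (x *m A) <= spectral_norm A * dotv (x *m A) x.
Proof.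
move=> pA; set y := x *m A.
have [->|y0] := eqVneq y 0; first by rewrite !dotv0l mulr0.
have yy : 0 < dotv y y by rewrite dotvv_gt0.
rewrite -(ler_pM2r yy) -expr2.
apply: le_trans (psd_cauchy_schwarz x y pA) _.
rewrite -/y [leRHS]mulrAC mulrC.
apply: ler_wpM2r; first by case: pA => _; exact.
by apply: form_le_spectral; case: pA.
Qed.

(** The norm is a supremum of lengths, not of forms. For a unit vector, [psd_image_le_spectral]
    bounds the squared length by ||A|| ||B|| / c; so ||A||^2 has this bound, and one factor ||A||
    cancels. *)
Lemma psd_spectral_le (c : R) A B : 0 <= c -> psdmx A -> psdmx B ->
  (forall x, c * dotv (x *m A) x <= dotv (x *m B) x) ->
  c * spectral_norm A <= spectral_norm B.
Proof.
move=> c0 pA pB AB.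
have a0 := spectral_norm_ge0 A; have b0 := spectral_norm_ge0 B.
have [->|cN0] := eqVneq c 0; first by rewrite mul0r.
have {cN0} cp : 0 < c by rewrite lt_def cN0.
have [->|aN0] := eqVneq (spectral_norm A) 0; first by rewrite mulr0.
have {aN0} ap : 0 < spectral_norm A by rewrite lt_def aN0.
rewrite -(ler_pM2r ap).
have h : spectral_norm A <= Num.sqrt (spectral_norm A * spectral_norm B / c).
  apply: spectral_norm_le => x x1; rewrite ler_wsqrtr//.
  have -> : A^T = A by case: pA.
  apply: le_trans (psd_image_le_spectral x pA) _.
  rewrite -mulrA ler_wpM2l// ler_pdivlMr// mulrC.
  apply: le_trans (AB x) _; apply: le_trans (form_le_spectral _ _) _.
    by case: pB.
  by rewrite ler_piMr// -l2norm_sqr expr_le1// l2norm_ge0.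
have {h} : spectral_norm A ^+ 2 <= spectral_norm A * spectral_norm B / c.
  rewrite -[leRHS]sqr_sqrtr ?mulr_ge0 ?invr_ge0//.
  by rewrite lerXn2r ?nnegrE ?sqrtr_ge0.
by rewrite ler_pdivlMr// (mulrC (spectral_norm B)) expr2 (mulrC _ c) mulrA.
Qed.

Lemma pd_spectral_gt0 A : (0 < n)%N -> pdmx A -> 0 < spectral_norm A.
Proof.
move=> n0 [sA pA]; pose e : 'rV[R]_n := delta_mx 0 (Ordinal n0).
have ee : dotv e e = 1 by rewrite dotv_delta mxE !eqxx.
have := form_le_spectral e sA; rewrite ee mulr1; apply: lt_le_trans; apply: pA.
by rewrite -dotvv_gt0 ee ltr01.
Qed.

End spectral_norm.

Lemma cvg_sumr {R : realType} {T : Type} (F : set_system T) {FF : Filter F}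
    (I : Type) (r : seq I) (f : I -> T -> R) (l : I -> R) :
  (forall i, f i x @[x --> F] --> l i) ->
  \sum_(i <- r) f i x @[x --> F] --> \sum_(i <- r) l i.
Proof.
move=> fl; elim: r => [|i r IH].
  by rewrite big_nil; under eq_fun do rewrite big_nil; exact: cvg_cst.
by rewrite big_cons; under eq_fun do rewrite big_cons; apply: cvgD.
Qed.

Section generalized_eigenvalues.
Context {R : realType} {n : nat}.
Implicit Types (A B : 'M[R]_n).

Lemma continuous_dotv (a : 'rV[R]_n) : continuous (dotv^~ a).
Proof.
have -> : dotv^~ a = (fun x => \sum_i x 0 i * a 0 i).
  by apply/funext => x; rewrite dotvE.
move=> x; apply: (@cvg_sumr _ _ (nbhs x)) => i.
apply: (@cvgM _ _ (nbhs x)); [exact: coord_continuous|exact: cvg_cst].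
Qed.

Lemma continuous_form A : continuous (fun x : 'rV[R]_n => dotv (x *m A) x).
Proof.
have -> : (fun x : 'rV[R]_n => dotv (x *m A) x) = (fun x => \sum_i dotv x (col i A)^T * x 0 i).
  apply/funext => x; rewrite dotvE; apply: eq_bigr => i _; congr (_ * _).
  by rewrite mxE dotvE; apply: eq_bigr => j _; rewrite !mxE.
move=> x; apply: (@cvg_sumr _ _ (nbhs x)) => i.
apply: (@cvgM _ _ (nbhs x)); [exact: continuous_dotv|exact: coord_continuous].
Qed.

Lemma sphere_compact : compact [set x : 'rV[R]_n | dotv x x = 1].
Proof.
apply: (@subclosed_compact _ _ [set v : 'rV[R]_n | forall i, v ord0 i \in `[(-1), 1]]).
- have -> : [set x : 'rV[R]_n | dotv x x = 1] =
      (fun x : 'rV[R]_n => dotv (x *m 1%:M) x) @^-1` [set 1].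
    by apply/seteqP; split => x /=; rewrite mulmx1.
  apply: (closed_comp (f := fun x : 'rV[R]_n => dotv (x *m 1%:M) x)) => [x _|].
    exact: continuous_form.
  exact: closed_eq.
- apply: (@rV_compact _ _ (fun=> `[(-1 : R), 1]%classic)) => _; exact: segment_compact.
- move=> x /= x1 i; rewrite in_itv/= -ler_norml -(@expr_le1 _ 2)//.
  by rewrite real_normK ?num_real// -x1 coord_sqr_le_dotvv.
Qed.

(* The maximizer of the Rayleigh quotient on the unit sphere is a generalized
   eigenvector. *)
Lemma rayleigh_max A B : (0 < n)%N -> pdmx A -> B^T = B ->
  exists2 a, (exists2 x : 'rV[R]_n, x != 0 & x *m B = a *: (x *m A)) &
  forall y, dotv (y *m B) y <= a * dotv (y *m A) y.
Proof.
move=> n0 [sA pA] sB.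
pose f x := dotv (x *m B) x / dotv (x *m A) x.
pose S := [set x : 'rV[R]_n | dotv x x = 1].
have S0 : S !=set0.
  by exists (delta_mx 0 (Ordinal n0)); rewrite /S/= dotv_delta mxE !eqxx.
have SN0 x : S x -> x != 0 by move=> Sx; rewrite -dotvv_gt0 Sx.
have cf : {within S, continuous f}.
  apply: continuous_in_subspaceT => x /set_mem /SN0/pA qx.
  apply: (@cvgM _ _ (nbhs x)); first exact: (@continuous_form B x).
  by apply: cvgV; [rewrite gt_eqF|exact: (@continuous_form A x)].
have [x /set_mem Sx xmax] := EVT_max_rV S0 sphere_compact cf.
have x0 := SN0 _ Sx.
have fmax y : dotv (y *m B) y <= f x * dotv (y *m A) y.
  have [->|y0] := eqVneq y 0; first by rewrite !mul0mx !dotv0l mulr0.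
  have yy : 0 < dotv y y by rewrite dotvv_gt0.
  have := xmax ((l2norm y)^-1 *: y).
  rewrite inE /S/= dotvZl dotvZr mulrA -expr2 exprVn l2norm_sqr mulVf ?gt_eqF//.
  move=> /(_ erefl); rewrite {1}/f -!scalemxAl !dotvZl !dotvZr !mulrA -expr2.
  rewrite exprVn l2norm_sqr -mulf_div divff ?mul1r ?gt_eqF ?invr_gt0//.
  by rewrite ler_pdivrMr// pA.
exists (f x) => //; exists x => //.
have pC : psdmx (f x *: A - B).
  split; first by rewrite linearB linearZ /= sA sB.
  by move=> y; rewrite mulmxBr dotvBl subr_ge0 -scalemxAr dotvZl.
have : dotv (x *m (f x *: A - B)) x = 0.
  rewrite mulmxBr dotvBl -scalemxAr dotvZl /f divfK ?subrr//.
  by rewrite gt_eqF// pA.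
move/(psd_form0 pC); rewrite mulmxBr -scalemxAr => /eqP.
by rewrite subr_eq0 => /eqP.
Qed.

Lemma generalized_eigenvalue A B (x : 'rV[R]_n) a : A \in unitmx -> x != 0 ->
  x *m B = a *: (x *m A) -> eigenvalue (invmx A *m B) a.
Proof.
move=> uA x0 xB; apply/eigenvalueP; exists (x *m A).
  by rewrite mulmxA mulmxK.
by apply: contra x0 => /eqP h; rewrite -(mulmxK uA x) h mul0mx.
Qed.

(** Only the two extreme Rayleigh quotients are needed, and both are eigenvalues; the minimum is the
    maximum for [- B]. *)
Lemma form_bounds_of_eigenvalues A B l r : (0 < n)%N -> pdmx A -> B^T = B ->
  (forall a, eigenvalue (invmx A *m B) a -> l <= a <= r) ->
  forall x, l * dotv (x *m A) x <= dotv (x *m B) x <= r * dotv (x *m A) x.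
Proof.
move=> n0 pA sB h x; have uA := pdmx_unit pA.
have q0 : 0 <= dotv (x *m A) x by case: (pdmx_psd pA).
apply/andP; split.
  have [|a [y y0 yB] hB] := @rayleigh_max A (- B) n0 pA; first by rewrite linearN /= sB.
  have /h/andP[la _] : eigenvalue (invmx A *m B) (- a).
    by apply: (generalized_eigenvalue uA y0); rewrite scaleNr -yB mulmxN opprK.
  have := hB x; rewrite mulmxN dotvNl lerNl; apply: le_trans.
  by rewrite -mulNr ler_wpM2r.
have [a [y y0 yB] hB] := rayleigh_max n0 pA sB.
have /h/andP[_ ar] := generalized_eigenvalue uA y0 yB.
by apply: le_trans (hB x) _; rewrite ler_wpM2r.
Qed.

End generalized_eigenvalues.

(** * Lebesgue measure on row vectors *)

Section borel_rV.
Context {R : realType}.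

Lemma measurable_rV_preimage n d (T : measurableType d) (f : T -> 'rV[R]_n) B :
  measurable_fun setT f -> measurable B -> measurable (f @^-1` B).
Proof. by move=> mf mB; rewrite -[_ @^-1` _]setTI; exact: mf. Qed.

Lemma measurable_affine m n (A : 'M[R]_(m, n)) t :
  measurable_fun setT (fun x => x *m A + t).
Proof.
apply: measurable_rVP => j; rewrite /rV_coord.
rewrite (_ : (fun _ => _) = fun x => \sum_i (rV_coord i x * A i j) + t 0 j); last first.
  by apply/funext => x; rewrite !mxE.
apply: measurable_funD => //; apply: measurable_sum => i.
by apply: measurable_funM => //; exact: measurable_rV_coord.
Qed.

Lemma measurable_dotv n (a : 'rV[R]_n) (b : R) :
  measurable_fun setT (fun x => dotv a x + b : measurableTypeR R).
Proof.
rewrite (_ : (fun _ => _) = fun x => \sum_i (a 0 i * rV_coord i x) + b); last first.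
  by apply/funext => x; rewrite dotvE.
apply: measurable_funD => //; apply: measurable_sum => i.
by apply: measurable_funM => //; exact: measurable_rV_coord.
Qed.

Lemma rV_ballE n (x y : 'rV[R]_n) e : 0 < e ->
  ball x e y <-> forall i, `|x 0 i - y 0 i| < e.
Proof.
move=> e0; split; first by case=> _ h i; exact: h.
by move=> h; split => // i j; rewrite ord1; exact: h.
Qed.

Lemma measurable_rV_ball n (x : 'rV[R]_n) e : 0 < e -> measurable (ball x e).
Proof.
move=> e0.
rewrite (_ : ball x e = \bigcap_(i in [set` 'I_n]) (rV_coord i @^-1` ball (x 0 i) e)).
  apply: fin_bigcap_measurable => // i _; rewrite -[X in measurable X]setTI.
  by apply: measurable_rV_coord => //; exact: measurable_ball.
apply/seteqP; split => y /=.
  by move/(rV_ballE _ _ e0) => h i _; exact: h.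
by move=> h; apply/(rV_ballE _ _ e0) => i; exact: h.
Qed.

(** The sigma-algebra is generated by the coordinates and the norm is the maximum norm, so balls are
    measurable cubes; [U] is the countable union of the rational ones that it contains. *)
Lemma open_rV_measurable n (U : set 'rV[R]_n) : open U -> measurable U.
Proof.
move=> oU.
pose F (p : 'rV[rat]_n * nat) : set 'rV[R]_n :=
  let b := ball (map_mx ratr p.1 : 'rV[R]_n) (p.2.+1%:R^-1) in
  if `[< b `<=` U >] then b else set0.
have -> : U = \bigcup_p F p.
  apply/seteqP; split => [x Ux|x [p _]]; last first.
    by rewrite /F; case: asboolP => // h; exact: h.
  have := oU; rewrite openE => /(_ _ Ux)/nbhs_ballP[e /= e0 eU].
  have [k ke] := @ltr_add_invr R 0 (e / 2) (divr_gt0 e0 (ltr0n _ 2)).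
  rewrite add0r in ke; set r := k.+1%:R^-1 in ke.
  have r0 : 0 < r by rewrite invr_gt0.
  have /choice[q hq] i : exists q : rat, ratr q \in `](x 0 i - r), (x 0 i + r)[.
    by apply: rat_in_itvoo; lra.
  exists (\row_i q i, k) => //; rewrite /F /=.
  have near i : `|ratr (q i) - x 0 i| < r.
    by have := hq i; rewrite in_itv/= ltr_distl.
  have xb : ball (map_mx ratr (\row_i q i) : 'rV[R]_n) r x.
    by apply/(rV_ballE _ _ r0) => i; rewrite !mxE.
  rewrite asboolT// => y /(rV_ballE _ _ r0) hy; apply: eU.
  apply/(rV_ballE _ _ e0) => i; have := hy i; rewrite !mxE => h.
  have := near i; rewrite distrC => h'.
  apply: le_lt_trans (ler_distD (ratr (q i)) _ _) _.
  by apply: lt_le_trans (ltrD h' h) _; move: ke; move: (r) => r' ?; lra.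
apply: countable_bigcupT_measurable; first exact: countableP.
move=> p; rewrite /F; case: asboolP => // _.
by apply: measurable_rV_ball; rewrite invr_gt0.
Qed.

Lemma closed_rV_measurable n (A : set 'rV[R]_n) : closed A -> measurable A.
Proof.
move=> /closed_openC/open_rV_measurable mA.
by rewrite -(setCK A); exact: measurableC.
Qed.

Lemma continuous_rV_measurable n (f : 'rV[R]_n -> R) : continuous f ->
  measurable_fun setT (f : 'rV[R]_n -> measurableTypeR R).
Proof.
move=> cf; apply: (measurability _ (RGenOpens.measurableE R)).
move=> _ [B [a [b ->]] <-]; rewrite setTI.
apply: open_rV_measurable; apply: open_comp => [x _|]; first exact: cf.
exact: interval_open.
Qed.

End borel_rV.

Section fubini_maps.
Context {R : realType} {n : nat}.
Local Notation mu := (@lebesgue_rV R n).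
Local Notation mu1 := (@lebesgue_rV R n.+1).

Lemma lebesgue_rVS_xsection (X : set 'rV[R]_n.+1) : measurable X ->
  mu1 X = (\int[lebesgue_measure]_a mu [set v | X (rV_cons (a, v))])%E.
Proof.
move=> mX; rewrite /= /lebesgue_rV_step /pushforward.
apply: eq_integral => a _ /=; congr (mu _).
by apply/seteqP; split => v /=; rewrite /xsection/= ?inE.
Qed.

(** Tonelli, by uniqueness of the product measure. This order of integration lets the first
    coordinate move while the others are frozen. *)
Lemma lebesgue_rVS_ysection (X : set 'rV[R]_n.+1) : measurable X ->
  mu1 X = (\int[mu]_v (@lebesgue_measure R) [set a | X (rV_cons (a, v))])%E.
Proof.
move=> mX; rewrite /= /lebesgue_rV_step /pushforward.
have mX' : measurable (rV_cons @^-1` X).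
  exact: (measurable_rV_preimage measurable_rV_cons).
transitivity ((lebesgue_measure \x^ mu)%E (rV_cons @^-1` X)).
  by apply: product_measure_unique => //= A B mA mB; rewrite product_measure2E.
apply: eq_integral => v _ /=; congr (lebesgue_measure _).
by apply/seteqP; split => a /=; rewrite /ysection/= ?inE.
Qed.

Lemma rV_cons_surj (x : 'rV[R]_n.+1) : exists p, x = rV_cons p.
Proof.
exists (rV_uncons x); apply/rowP => i; rewrite /rV_cons !mxE.
case: (@splitP 1 n i) => j ij; rewrite mxE; congr (x _ _); apply/val_inj => //=.
by rewrite ij; case: j {ij} => -[].
Qed.

End fubini_maps.

(** * Change of variables for invertible affine maps *)

Section affine_change_of_variables.
Context {R : realType}.

(** Stated on preimages so that it composes without inverse maps; for an affine map [c] is the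
    absolute value of the determinant. *)
Definition scales n (f : 'rV[R]_n -> 'rV[R]_n) (c : R) :=
  [/\ measurable_fun setT f, 0 < c &
      forall B, measurable B ->
        (c%:E * lebesgue_rV n (f @^-1` B) = lebesgue_rV n B)%E].

Lemma scales_comp n (f g : 'rV[R]_n -> 'rV[R]_n) c c' :
  scales f c -> scales g c' -> scales (f \o g) (c' * c).
Proof.
move=> [mf c0 sf] [mg c'0 sg]; split.
- exact: measurableT_comp.
- exact: mulr_gt0.
- move=> B mB; rewrite comp_preimage mulrC EFinM -muleA sg ?sf//.
  exact: measurable_rV_preimage.
Qed.

Lemma scales_tail n (f : 'rV[R]_n.+1 -> 'rV[R]_n.+1) (g : R -> 'rV[R]_n -> 'rV[R]_n) c :
  measurable_fun setT f -> 0 < c ->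
  (forall a v, f (rV_cons (a, v)) = rV_cons (a, g a v)) ->
  (forall a, scales (g a) c) -> scales f c.
Proof.
move=> mf c0 fE sg; split => // B mB.
have mfB : measurable (f @^-1` B) by exact: measurable_rV_preimage.
rewrite (lebesgue_rVS_xsection mfB) (lebesgue_rVS_xsection mB).
have msec (X : set 'rV[R]_n.+1) : measurable X ->
    measurable_fun setT (fun a : measurableTypeR R =>
      lebesgue_rV n [set v | X (rV_cons (a, v))] : \bar R).
  move=> mX.
  rewrite (_ : (fun _ => _) = lebesgue_rV n \o xsection (rV_cons @^-1` X)).
    apply: measurable_fun_xsection.
    exact: (measurable_rV_preimage measurable_rV_cons).
  apply/funext => a /=; congr (lebesgue_rV n _).
  by apply/seteqP; split => v /=; rewrite /xsection/= ?inE.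
rewrite -ge0_integralZl ?lee_fin ?ltW//; last exact: msec.
apply: eq_integral => a _.
have [_ _ /(_ [set v | B (rV_cons (a, v))]) <-] := sg a.
  congr (_ * lebesgue_rV n _)%E; apply/seteqP; split => v /=; by rewrite fE.
have -> : [set v | B (rV_cons (a, v))] = xsection (rV_cons @^-1` B) a.
  by apply/seteqP; split => v /=; rewrite /xsection/= ?inE.
by apply: measurable_xsection; exact: (measurable_rV_preimage measurable_rV_cons).
Qed.

Lemma scales_head n (f : 'rV[R]_n.+1 -> 'rV[R]_n.+1) (g : 'rV[R]_n -> R -> R) c :
  measurable_fun setT f -> 0 < c ->
  (forall a v, f (rV_cons (a, v)) = rV_cons (g v a, v)) ->
  (forall v (B : set (measurableTypeR R)), measurable B ->
    (c%:E * lebesgue_measure (g v @^-1` B : set (measurableTypeR R)) =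
     lebesgue_measure B)%E) -> scales f c.
Proof.
move=> mf c0 fE sg; split => // B mB.
have mfB : measurable (f @^-1` B) by exact: measurable_rV_preimage.
rewrite (lebesgue_rVS_ysection mfB) (lebesgue_rVS_ysection mB).
have secE (X : set 'rV[R]_n.+1) (v : 'rV[R]_n) : [set a | X (rV_cons (a, v))] =
    ysection (rV_cons @^-1` X) v.
  by apply/seteqP; split => a /=; rewrite /ysection/= ?inE.
have msec (X : set 'rV[R]_n.+1) : measurable X ->
    measurable_fun setT (fun v : 'rV[R]_n =>
      (@lebesgue_measure R) [set a | X (rV_cons (a, v))] : \bar R).
  move=> mX.
  rewrite (_ : (fun _ => _) = (@lebesgue_measure R) \o ysection (rV_cons @^-1` X)).
    apply: measurable_fun_ysection.
    exact: (measurable_rV_preimage measurable_rV_cons).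
  by apply/funext => v /=; rewrite secE.
rewrite -ge0_integralZl ?lee_fin ?ltW//; last exact: msec.
apply: eq_integral => v _; rewrite -(sg v [set a | B (rV_cons (a, v))]).
  congr (_ * lebesgue_measure _)%E; apply/seteqP; split => a /=; by rewrite fE.
rewrite secE.
by apply: measurable_ysection; exact: (measurable_rV_preimage measurable_rV_cons).
Qed.

(** Uniqueness of Lebesgue measure, tested on half-open intervals. A negative [a] exchanges the
    closed and the open end, hence the two cases. *)
Lemma lebesgue_measure_affine (a b : R) (B : set (measurableTypeR R)) : a != 0 ->
  measurable B ->
  (`|a|%:E * lebesgue_measure ((fun x : R => x * a + b)%R @^-1` B : set (measurableTypeR R)) =
   lebesgue_measure B)%E.
Proof.
move=> a0 mB.
pose f : measurableTypeR R -> measurableTypeR R := fun x => x * a + b.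
have mf : measurable_fun setT f by apply: measurable_funD => //; apply: measurable_funM.
have na : 0 <= `|a| by [].
pose m : {measure set (measurableTypeR R) -> \bar R} :=
  mscale (NngNum na) (pushforward lebesgue_measure f).
rewrite -[LHS]/(m mf B); apply/esym; apply: (@lebesgue_measure_unique R (m mf)) => //.
move=> _ /ocitvP[->|[[x y] /= xy ->]]; first by rewrite !measure0.
rewrite /m /= /mscale /= /pushforward lebesgue_measure_itv/= lte_fin xy.
have [ap|an|/eqP] := ltgtP a 0; last by rewrite (negbTE a0).
  have -> : f @^-1` `]x, y] = `[(y - b) / a, (x - b) / a[%classic.
    apply/seteqP; split => t /=; rewrite /f !in_itv/= ler_ndivrMr// ltr_ndivlMr//;
      move=> /andP[? ?]; apply/andP; split; lra.
  rewrite lebesgue_measure_itv/= lte_fin ltr_ndivrMr// divfK ?lt_eqF//.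
  rewrite ltrD2r xy -EFinB -EFinM ltr0_norm//; congr (_%:E); field; exact: a0.
have -> : f @^-1` `]x, y] = `](x - b) / a, (y - b) / a]%classic.
  apply/seteqP; split => t /=; rewrite /f !in_itv/= ler_pdivlMr// ltr_pdivrMr//;
    move=> /andP[? ?]; apply/andP; split; lra.
rewrite lebesgue_measure_itv/= lte_fin ltr_pdivrMr// divfK ?gt_eqF//.
rewrite ltrD2r xy -EFinB -EFinM gtr0_norm//.
by congr (_%:E); field; exact: a0.
Qed.

Lemma rV_cons_block n (a : R) (v : 'rV[R]_n) (b11 : R)
    (b12 : 'rV[R]_n) (b21 : 'cV[R]_n) (B22 : 'M[R]_n) (t0 : R) (t' : 'rV[R]_n) :
  rV_cons (a, v) *m (block_mx (b11%:M : 'M[R]_1) b12 b21 B22 : 'M[R]_(1 + n)) + rV_cons (t0, t') =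
  rV_cons (a * b11 + (v *m b21) 0 0 + t0, a *: b12 + v *m B22 + t').
Proof.
have E (s : R) : (\row_(_ < 1) s : 'rV[R]_1) = s%:M.
  by apply/rowP => i; rewrite ord1 !mxE eqxx.
rewrite /rV_cons /= !E (@mul_row_block _ 1 1 n 1 n) -scalar_mxM mul_scalar_mx.
rewrite [v *m b21]mx11_scalar -raddfD /= add_row_mx -raddfD /=.
by congr (row_mx (_ + _ + _)%:M _); rewrite [RHS]mxE eqxx.
Qed.

(** Induction on the dimension. With a nonzero corner, block LU factors the map into one that
    changes only the first coordinate and one that fixes it and acts on the rest by the Schur
    complement; Tonelli handles each. A zero corner is first made nonzero by a row operation. *)
Theorem scales_affine n (A : 'M[R]_n) t : A \in unitmx ->
  scales (fun x => x *m A + t) `|\det A|.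
Proof.
elim: n A t => [|n IH] A t uA.
  rewrite det_mx00 normr1; split => //; first exact: measurable_affine.
  move=> B mB; rewrite mul1e; congr (lebesgue_rV 0 _).
  by apply/seteqP; split => x /=; rewrite (thinmx0 (_ + t)) (thinmx0 x).
have tail (r : 'rV[R]_n) (S : 'M[R]_n) (t' : 'rV[R]_n) : S \in unitmx ->
    scales (fun x : 'rV[R]_n.+1 =>
      x *m (block_mx (1%:M : 'M[R]_1) r 0 S : 'M[R]_(1 + n)) + rV_cons (0, t')) `|\det S|.
  move=> uS; apply: (@scales_tail n _ (fun a v => v *m S + (a *: r + t'))).
  - exact: measurable_affine.
  - by rewrite normr_gt0 -unitfE -unitmxE.
  - move=> a v; rewrite rV_cons_block mulr1 mulmx0 mxE !addr0; congr (rV_cons (_, _)).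
    by rewrite addrA (addrC (_ *m _)).
  - by move=> a; exact: IH.
have head (a : R) (c : 'cV[R]_n) t0 : a != 0 ->
    scales (fun x : 'rV[R]_n.+1 =>
      x *m (block_mx (a%:M : 'M[R]_1) 0 c 1%:M : 'M[R]_(1 + n)) + rV_cons (t0, 0)) `|a|.
  move=> a0; apply: (@scales_head n _ (fun v s => s * a + ((v *m c) 0 0 + t0))).
  - exact: measurable_affine.
  - by rewrite normr_gt0.
  - move=> s v; rewrite rV_cons_block mulmx1 scaler0 add0r addr0.
    by congr (rV_cons (_, _)); rewrite addrA.
  - by move=> v B mB; exact: lebesgue_measure_affine.
have pivot (A' : 'M[R]_(1 + n)) (t' : 'rV[R]_n.+1) : A' \in unitmx -> A' 0 0 != 0 ->
    scales (fun x : 'rV[R]_n.+1 => x *m (A' : 'M[R]_n.+1) + t') `|\det A'|.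
  move=> uA' a0; pose a := A' 0 0.
  have uS : schur A' \in unitmx.
    move: uA'; rewrite !unitmxE (det_schur a0) !unitfE.
    by apply: contra => /eqP ->; rewrite mulr0.
  have [[t0 tl] t'E] := rV_cons_surj t'.
  (* The head map acts first; its translation [t0] passes through the shear of the tail map, and the
     term with [t0 / a] takes it out again. *)
  have := scales_comp (tail (a^-1 *: ursubmx A') (schur A')
    (tl - (t0 / a) *: ursubmx A') uS) (head a (dlsubmx A') t0 a0).
  rewrite -normrM -(det_schur a0); congr scales; apply/funext => x /=.
  have [[s v] ->] := rV_cons_surj x.
  have -> : rV_cons (s, v) *m (A' : 'M[R]_n.+1) + t' =
      rV_cons (s * a + (v *m dlsubmx A') 0 0 + t0, s *: ursubmx A' + v *m drsubmx A' + tl).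
    by rewrite t'E -rV_cons_block -ulsubmx11 submxK.
  have z00 : (0 : 'M[R]_1) 0 0 = 0 by rewrite mxE.
  rewrite !rV_cons_block mulr1 mulmx0 z00 !addr0 mulmx1 scaler0 add0r.
  congr (rV_cons (_, _)).
  rewrite /schur -/a mulmxBr !mulmxA -scalemxAr.
  rewrite [v *m dlsubmx A']mx11_scalar mul_scalar_mx !scalerA.
  set d := (v *m dlsubmx A') 0 0; move: (v *m drsubmx A') (ursubmx A') => w b.
  apply/rowP => i; rewrite !mxE eqxx mulr1n; field; exact: a0.
have [a0|a0] := eqVneq (A 0 0) 0; last exact: pivot.
have [k Ak] : exists k : 'I_n, A (lift 0 k) 0 != 0.
  apply: contrapT => /forallNP h.
  have : row 0 A^T = 0.
    apply/rowP => j; rewrite !mxE.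
    case: (unliftP 0 j) => [k ->|-> //]; by apply: contrapT => /eqP/h.
  rewrite rowE => /(congr1 (mulmx^~ (invmx A^T))).
  rewrite mulmxK ?unitmx_tr// mul0mx => /rowP/(_ 0)/eqP.
  by rewrite !mxE eqxx oner_eq0.
(* [E 1] adds to the first row of [A] a row with nonzero first entry; [E (-1)] undoes it and is
   itself a tail map of determinant one. *)
pose E c : 'M[R]_n.+1 := block_mx (1%:M : 'M[R]_1) (c *: delta_mx 0 k) 0 (1%:M : 'M[R]_n).
have EE : E (-1) *m E 1 = 1%:M.
  rewrite /E (@mulmx_block _ 1 n 1 n 1 n) !mul1mx !mulmx1 !mul0mx ?mulmx0 !addr0 add0r.
  by rewrite scaleN1r scale1r subrr -scalar_mx_block.
have dE c : \det (E c) = 1 by rewrite /E (@det_ublock _ 1 n) !det1 mulr1.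
have u1 : (1%:M : 'M[R]_n) \in unitmx by exact: unitmx1.
have E00 : (E 1 *m A) 0 0 = A (lift 0 k) 0.
  rewrite mxE (bigD1 0)//= a0 mulr0 add0r (bigD1 (lift 0 k))//=.
  have El (j : 'I_n) : E 1 0 (lift 0 j) = (j == k)%:R.
    rewrite /E mxE; case: (@splitP 1 n 0) => //= i _; rewrite mxE.
    case: (@splitP 1 n (lift 0 j)) => l /= jl.
      by have := ltn_ord l; rewrite -jl.
    rewrite !mxE mul1r (_ : l = j) ?ord1 ?eqxx//.
    by apply/val_inj => /=; move: jl; rewrite /bump/= => -[].
  rewrite El eqxx mul1r big1 ?addr0// => j /andP[j0 jk].
  case: (unliftP 0 j) j0 jk => [l ->|->]; last by rewrite eqxx.
  by move=> _; rewrite (inj_eq (@lift_inj _ 0)) El => /negbTE ->; rewrite mul0r.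
have uEA : E 1 *m A \in unitmx.
  by rewrite unitmx_mul uA andbT unitmxE dE unitr1.
have := scales_comp (pivot (E 1 *m A) t uEA _) (tail (-1 *: delta_mx 0 k) 1%:M 0 u1).
rewrite E00 => /(_ Ak); rewrite det1 normr1 mul1r det_mulmx dE mul1r.
have z : rV_cons (0, 0) = 0 :> 'rV[R]_n.+1.
  by apply/rowP => i; rewrite /rV_cons !mxE; case: (@splitP 1 n i) => j _; rewrite mxE.
congr scales; apply/funext => x /=; rewrite z addr0 -/(E (-1)).
by rewrite mulmxA -(mulmxA x) EE mulmx1.
Qed.

End affine_change_of_variables.

Section lebesgue_rV_properties.
Context {R : realType} {n : nat}.
Local Notation V := 'rV[R]_n.
Local Notation mu := (@lebesgue_rV R n).

Lemma lebesgue_rV_translate (t : V) B : measurable B ->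
  mu ((fun x => x + t) @^-1` B) = mu B.
Proof.
move=> mB; have [_ _ /(_ _ mB) <-] := @scales_affine R n 1%:M t (unitmx1 _ _).
rewrite det1 normr1 mul1e; congr (mu _).
by apply/seteqP; split => x /=; rewrite mulmx1.
Qed.

Lemma measurable_translate (t : V) : measurable_fun setT (fun x : V => x + t).
Proof.
rewrite (_ : (fun _ => _) = (fun x => x *m 1%:M + t)); first exact: measurable_affine.
by apply/funext => x; rewrite mulmx1.
Qed.

Lemma integral_translate (f : V -> \bar R) (t : V) :
  mu.-integrable setT f ->
  (\int[mu]_x f (x + t)%R = \int[mu]_x f x)%E.
Proof.
move=> If; have mf := measurable_int _ If.
have mt := measurable_translate t.
have E A : measurable A -> A `<=` setT -> pushforward mu (fun x => x + t) A = mu A.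
  by move=> mA _; exact: lebesgue_rV_translate.
have It : mu.-integrable setT (f \o (fun x => x + t)).
  apply/integrableP; split; first exact: measurableT_comp.
  have /integrableP[_] := If; apply: le_lt_trans.
  have := @ge0_integral_pushforward _ _ _ _ R _ mt mu setT (fun x => `|f x|)%E.
  rewrite preimage_setT => <- //; last exact: measurableT_comp.
  by rewrite le_eqVlt; apply/orP; left; apply/eqP; exact: eq_measure_integral.
transitivity (\int[pushforward mu (fun x => x + t)%R]_x f x)%E.
  by rewrite integral_pushforward// preimage_setT.
exact: eq_measure_integral.
Qed.

Lemma integrable_translate (f : V -> \bar R) (t : V) :
  mu.-integrable setT f -> mu.-integrable setT (fun x => f (x + t)%R).
Proof.
move=> If; have mf := measurable_int _ If.
have mt := measurable_translate t.
apply/integrableP; split; first exact: measurableT_comp.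
have /integrableP[_] := If; rewrite -(integral_translate t) //.
by apply: integrable_abse.
Qed.

Lemma Rintegral_translate (f : V -> R) (t : V) :
  mu.-integrable setT (EFin \o f) ->
  \int[mu]_x f (x + t) = \int[mu]_x f x.
Proof.
move=> If; rewrite /Rintegral; congr fine.
exact: (integral_translate t If).
Qed.

Lemma hyperplane_null (a : V) b : a != 0 -> mu [set x | dotv a x + b = 0] = 0%E.
Proof.
move=> a0.
have [j aj] : exists j, a 0 j != 0.
  apply: contrapT => /forallNP h; move/eqP : a0; apply; apply/rowP => j.
  by rewrite mxE; apply: contrapT => /eqP /h.
(* [x *m A] replaces coordinate [j] of [x] by [dotv a x], so up to a translation the hyperplane is
   the preimage of a box whose side [j] is a single point. *)
pose A : 'M[R]_n := \matrix_(k, i) if i == j then a 0 k else (k == i)%:R.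
have AE (x : V) i : (x *m A) 0 i = if i == j then dotv a x else x 0 i.
  rewrite mxE; case: eqP => [->|ij].
    by rewrite dotvE; apply: eq_bigr => k _; rewrite mxE eqxx mulrC.
  rewrite (bigD1 i)//= big1 ?addr0 => [|k ki].
    by rewrite mxE (introF eqP ij) eqxx mulr1.
  by rewrite mxE (introF eqP ij) (negbTE ki) mulr0.
have uA : A \in unitmx.
  rewrite -row_free_unit; apply/inj_row_free => x xA.
  have x0 i : i != j -> x 0 i = 0.
    by move=> ij; have := AE x i; rewrite xA mxE (negbTE ij).
  have := AE x j; rewrite xA mxE eqxx dotvE (bigD1 j)//= big1 ?addr0 => [|k kj].
    move/esym/eqP; rewrite mulf_eq0 (negbTE aj)/= => /eqP xj.
    by apply/rowP => i; rewrite mxE; have [->//|/x0] := eqVneq i j.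
  by rewrite x0// mulr0.
pose B i : set (measurableTypeR R) := if i == j then [set 0] else setT.
have mB i : measurable (B i) by rewrite /B; case: ifP => // _; exact: measurable_set1.
have mbox : measurable [set x : V | forall i, B i (x 0 i)].
  rewrite (_ : [set _ | _] = \bigcap_(i in [set` 'I_n]) (rV_coord i @^-1` B i)).
    apply: fin_bigcap_measurable => // i _; rewrite -[X in measurable X]setTI.
    exact: measurable_rV_coord.
  by apply/seteqP; split => x /= h i; [move=> _|]; exact: h.
have [_ d0 /(_ _ mbox)] := scales_affine (b *: delta_mx 0 j) uA.
rewrite lebesgue_rV_box// (bigD1 j)//= {2}/B eqxx lebesgue_measure_set1 mul0e.
move=> /eqP; rewrite mule_eq0 eqe gt_eqF//= => /eqP h; rewrite -[RHS]h.
congr (mu _); apply/seteqP; split => x /=.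
  move=> xb i; rewrite mxE AE /B !mxE eqxx/=.
  by case: eqP => //= _; rewrite mulr1 xb.
by move/(_ j); rewrite mxE AE /B !mxE !eqxx mulr1.
Qed.

Lemma lebesgue_rV_ball (x : V) e : 0 < e -> mu (ball x e) = ((e *+ 2) ^+ n)%:E.
Proof.
move=> e0; pose B i : set (measurableTypeR R) := ball (x 0 i) e.
rewrite (_ : ball x e = [set y : V | forall i, B i (y 0 i)]).
  rewrite lebesgue_rV_box; last by move=> i; exact: measurable_ball.
  rewrite (eq_bigr (fun=> (e *+ 2)%:E)) => [|i _].
    by rewrite prodEFin prodr_const card_ord.
  by rewrite lebesgue_measure_ball// ltW.
apply/seteqP; split => y /=; first by move/(rV_ballE _ _ e0).
by move=> h; apply/(rV_ballE _ _ e0).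
Qed.

Lemma lebesgue_parallelepiped (E : 'M[R]_n) c : E \in unitmx ->
  mu [set x : V | forall i, 0 <= ((x - c) *m invmx E) 0 i <= 1] = `|\det E|%:E.
Proof.
move=> uE; pose B (i : 'I_n) : set (measurableTypeR R) := `[0, 1]%classic.
have mB i : measurable (B i) by exact: measurable_itv.
have mbox : measurable [set x : V | forall i, B i (x 0 i)].
  rewrite (_ : [set _ | _] = \bigcap_(i in [set` 'I_n]) (rV_coord i @^-1` B i)).
    apply: fin_bigcap_measurable => // i _; rewrite -[X in measurable X]setTI.
    exact: measurable_rV_coord.
  by apply/seteqP; split => x /= h i; [move=> _|]; exact: h.
have uE' : invmx E \in unitmx by rewrite unitmx_inv.
have [_ d0 /(_ _ mbox)] := scales_affine (- (c *m invmx E)) uE'.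
rewrite lebesgue_rV_box// big1 => [|i _]; last first.
  by rewrite lebesgue_measure_itv/= lte_fin ltr01 sube0.
rewrite (_ : _ @^-1` _ = [set x : V | forall i, 0 <= ((x - c) *m invmx E) 0 i <= 1]).
  rewrite det_inv normfV => h; rewrite -[LHS]mul1e -[X in X%:E](@divff _ `|\det E|).
    by rewrite EFinM -muleA h mule1.
  by rewrite normr_eq0 -unitfE -unitmxE.
by apply/seteqP; split => x /= h i; have := h i; rewrite /B/= in_itv/= mulmxBl.
Qed.

End lebesgue_rV_properties.

(** * Smooth bump functions *)

Section flat_exponential.
Context {R : realType}.
Implicit Type P : {poly R}.

(* [flatexp 1] is the smooth function [exp (- 1/x)] on the positive half-line;
   the polynomial factor makes the family stable under differentiation. *)
Definition flatexp P (x : R) : R := if 0 < x then P.[x^-1] * expR (- x^-1) else 0.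

(** Chain rule: the derivative of P(1/x) exp(-1/x) is (1/x)^2 (P - P')(1/x) exp(-1/x). *)
Definition flatexp_deriv P : {poly R} := 'X^2 * (P - P^`()).

Lemma poly_expRN_le P : exists2 C : R, 0 <= C &
  forall y : R, 0 < y -> `|P.[y]| * expR (- y) <= C / y.
Proof.
elim/poly_ind: P => [|P c _]; first by exists 0 => // y y0; rewrite horner0 normr0 !mul0r.
set Q := P * 'X + c%:P; clearbody Q.
pose C := \sum_(i < size Q) `|Q`_i| * i.+1%:R ^+ i.+1.
exists C => [|y y0]; first by rewrite sumr_ge0// => i _; rewrite mulr_ge0// exprn_ge0.
rewrite ler_pdivlMr// horner_coef.
(* The power [k.+1] of the inequality y / (k+1) <= exp(y / (k+1)). *)
have pw k : y ^+ k.+1 * expR (- y) <= k.+1%:R ^+ k.+1.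
  rewrite expRN ler_pdivrMr ?expR_gt0// -[X in expR X](mulVKf (x := k.+1%:R))//.
  rewrite expRM_natl -exprMn lerXn2r ?nnegrE ?mulr_ge0 ?expR_ge0 ?(ltW y0)//.
  rewrite -ler_pdivrMl// (le_trans _ (expR_ge1Dx _))//.
  by rewrite lerDr.
apply: (@le_trans _ _ ((\sum_(i < size Q) `|Q`_i| * y ^+ i) * expR (- y) * y)).
  rewrite !ler_wpM2r ?expR_ge0 ?(ltW y0)//.
  apply: le_trans (ler_norm_sum _ _ _) _; apply: ler_sum => i _.
  by rewrite normrM normrX (gtr0_norm y0).
rewrite !mulr_suml; apply: ler_sum => i _.
rewrite -!mulrA ler_wpM2l//; apply: le_trans (pw i).
by rewrite exprSr -!mulrA (mulrC y).
Qed.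

Lemma is_derive_flatexp P (x : R) :
  is_derive x 1 (flatexp P) (flatexp (flatexp_deriv P) x).
Proof.
have [x0|x0|->] := ltgtP x 0.
- have -> : flatexp (flatexp_deriv P) x = 0 by rewrite /flatexp ltNge (ltW x0).
  apply: (@near_eq_is_derive _ _ _ (cst 0)).
  near=> y; rewrite /flatexp ltNge ifN// negbK ltW//.
  by near: y; exact: lt_nbhsl.
- have xN0 : x != 0 by rewrite gt_eqF.
  have dV : is_derive x 1 (fun y : R => y^-1) (- x ^- 2).
    have := @is_deriveV _ id x 1 1 xN0 _.
    by rewrite /GRing.scale /= mulr1; apply; exact: is_derive_id.
  have dP := @is_derive1_comp _ (horner P) _ _ _ _ (is_derive_poly P x^-1) dV.
  have dE := @is_derive1_comp _ expR _ _ _ _ (is_derive_expR _) (is_deriveN dV).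
  apply: (@near_eq_is_derive _ _ _ ((horner P \o (fun y => y^-1)) *
      (expR \o (- (fun y : R => y^-1)))) _ _ _ _ _ (is_derive_eq (is_deriveM dP dE) _)).
    near=> y; rewrite /flatexp ifT//; near: y; exact: lt_nbhsr.
  rewrite /flatexp x0 /flatexp_deriv hornerM hornerXn hornerD hornerN /= /GRing.scale /=.
  by rewrite -[(- (fun y : R => y^-1)) x]/(- x^-1); field.
- rewrite {2}/flatexp ltxx.
  (* The difference quotient at zero brings in a factor [h^-1], which the extra ['X] absorbs; at
     [y = h^-1] the bound [C / y] is then [C * h]. *)
  have [C C0 hC] := poly_expRN_le (P * 'X).
  have lim0 : (fun h : R => h^-1 *: ((flatexp P \o shift 0) (h *: 1) - flatexp P 0)) @ 0^' --> 0.
    apply/cvgrPdist_le => /= e e0.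
    near=> h; rewrite sub0r normrN /= addr0 {2}/flatexp ltxx subr0.
    rewrite [h *: 1]mulr1 /flatexp; case: ifP => h0; last by rewrite scaler0 normr0 ltW.
    have iv : 0 < h^-1 by rewrite invr_gt0.
    have := hC _ iv; rewrite hornerMX invrK normrM (gtr0_norm iv) => hb.
    rewrite normrZ normrM (gtr0_norm iv) (gtr0_norm (expR_gt0 _)).
    rewrite mulrA (mulrC h^-1); apply: le_trans hb _.
    have : `|h| <= e / (C + 1).
      by near: h; apply: dnbhs0_le; rewrite divr_gt0// ltr_wpDl.
    rewrite (gtr0_norm h0) ler_pdivlMr ?ltr_wpDl// => hh.
    by move: hh h0; nra.
  apply: DeriveDef; first by apply/cvg_ex; exists 0.
  exact: cvg_lim lim0.
Unshelve. all: by end_near. Qed.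

Lemma flatexp1_ge0 (x : R) : 0 <= flatexp 1 x.
Proof. by rewrite /flatexp; case: ifP => // _; rewrite hornerC mul1r expR_ge0. Qed.

Lemma flatexp1_gt0 (x : R) : 0 < x -> 0 < flatexp 1 x.
Proof. by move=> x0; rewrite /flatexp x0 hornerC mul1r expR_gt0. Qed.

Lemma flatexp_le0 P (x : R) : x <= 0 -> flatexp P x = 0.
Proof. by rewrite /flatexp leNgt => /negbTE ->. Qed.

End flat_exponential.

Section smooth_functions.
Context {R : realType} {n : nat}.
Local Notation V := 'rV[R]_n.

(** [smooth] concerns all iterated partial derivatives. A class of differentiable functions that is
    stable under partial derivatives gives them by a single induction. *)
Inductive elementary : (V -> R) -> Prop :=
| elementary_coord i P c s of true : elementary (fun x => flatexp P (c + s * x 0 i))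
| elementary_cst a : elementary (cst a)
| elementary_add f g : elementary f -> elementary g -> elementary (f + g)
| elementary_mul f g : elementary f -> elementary g -> elementary (f * g).

Lemma derive_coord (g : R -> R) dg c s i (x v : V) :
  is_derive (c + s * x 0 i) 1 g dg ->
  is_derive x v (fun x => g (c + s * x 0 i)) (s * v 0 i * dg) /\
  differentiable (fun x : V => g (c + s * x 0 i)) x.
Proof.
move=> dg'; pose l : V -> R := cst c + cst s * (fun y : V => y 0 i).
have dl : differentiable l x.
  apply: differentiableD => //; apply: differentiableM => //.
  exact: differentiable_coord.
have dgl : differentiable g (l x) by apply/derivable1_diffP; exact: ex_derive.
have dc : differentiable (g \o l) x by exact: differentiable_comp.
split; last exact: dc.
apply: DeriveDef; first exact: diff_derivable.
rewrite -[LHS]/('D_v (g \o l) x) deriveE// diff_comp//= diff1E// derive1E derive_val.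
have -> : 'd l x v = s * v 0 i.
  rewrite -deriveE// /l deriveD//; last first.
    by apply: derivableM => //; apply/diff_derivable/differentiable_coord.
  rewrite derive_cst add0r deriveM//; last exact/diff_derivable/differentiable_coord.
  rewrite derive_cst scaler0 addr0 /GRing.scale /=; congr (_ * _).
  apply/cvg_lim => //; apply: cvg_near_cst; near=> h => /=.
  rewrite !mxE addrK /GRing.scale /= mulrA mulVf ?mul1r//.
  near: h; exact: nbhs_dnbhs_neq.
by [].
Unshelve. all: by end_near. Qed.

Lemma elementary_differentiable f x : elementary f -> differentiable f x.
Proof.
elim => [i P c s _|a|{}f g _ df _ dg|{}f g _ df _ dg].
- by have [] := derive_coord 0 (is_derive_flatexp P (c + s * x 0 i)).
- exact: differentiable_cst.
- exact: differentiableD.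
- exact: differentiableM.
Qed.

Lemma elementary_partial f j : elementary f -> elementary (partial_derivative j f).
Proof.
elim => [i P c s _|a|{}f g ef IHf eg IHg|{}f g ef IHf eg IHg].
- have -> : partial_derivative j (fun x => flatexp P (c + s * x 0 i)) =
      cst (s * (j == i)%:R) * (fun x => flatexp (flatexp_deriv P) (c + s * x 0 i)).
    apply/funext => x; rewrite /partial_derivative.
    have [h _] := derive_coord (delta_mx 0 j) (is_derive_flatexp P (c + s * x 0 i)).
    by rewrite derive_val mxE eqxx eq_sym.
  by apply: elementary_mul; [exact: elementary_cst|exact: elementary_coord].
- have -> : partial_derivative j (cst a) = cst (0 : R).
    by apply/funext => x; rewrite /partial_derivative derive_cst.
  exact: elementary_cst.
- have -> : partial_derivative j (f + g) =
      partial_derivative j f + partial_derivative j g.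
    apply/funext => x; rewrite /partial_derivative deriveD//;
      exact/diff_derivable/elementary_differentiable.
  exact: elementary_add.
- have -> : partial_derivative j (f * g) =
      f * partial_derivative j g + g * partial_derivative j f.
    apply/funext => x; rewrite /partial_derivative deriveM//;
      exact/diff_derivable/elementary_differentiable.
  by apply: elementary_add; exact: elementary_mul.
Qed.

Lemma elementary_smooth f : elementary f -> smooth f.
Proof.
move=> ef s; elim: s f ef => [|i s IH] f ef x; first exact: elementary_differentiable.
have : elementary (foldr partial_derivative f (i :: s)).
  by elim: (i :: s) => //= j t IHt; exact: elementary_partial.
exact: elementary_differentiable.
Qed.

(** A product over coordinates, which stays in [elementary] and vanishes off the cube of half-side
    [r], the ball of the maximum norm. *)
Definition bumpf (c : V) (r : R) : V -> R :=
  \prod_i ((fun x : V => flatexp 1 (r - c 0 i + 1 * x 0 i)) *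
           (fun x : V => flatexp 1 (r + c 0 i + (-1) * x 0 i))).

Lemma bumpE c r x : bumpf c r x =
  \prod_i (flatexp 1 (r + (x 0 i - c 0 i)) * flatexp 1 (r - (x 0 i - c 0 i))).
Proof.
rewrite /bumpf; elim/big_ind2: _ => // [f a g b <- <- //|i _].
by congr (flatexp 1 _ * flatexp 1 _); ring.
Qed.

Lemma bump_smooth c r : smooth (bumpf c r).
Proof.
apply: elementary_smooth; rewrite /bumpf.
elim/big_ind: _ => [|f g|i _]; first exact: elementary_cst.
- exact: elementary_mul.
- by apply: elementary_mul; exact: elementary_coord.
Qed.

Lemma bump_ge0 c r x : 0 <= bumpf c r x.
Proof.
by rewrite bumpE prodr_ge0// => i _; rewrite mulr_ge0// flatexp1_ge0.
Qed.

Lemma bump_gt0 c r x : ball c r x -> 0 < bumpf c r x.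
Proof.
move=> [r0 h]; rewrite bumpE prodr_gt0// => i _.
have := h 0 i; rewrite /ball/= ltr_distl => /andP[h1 h2].
by rewrite mulr_gt0// flatexp1_gt0//; lra.
Qed.

Lemma bump_eq0 (c : V) (r : R) (x : V) i : r <= `|x 0 i - c 0 i| -> bumpf c r x = 0.
Proof.
move=> h; rewrite bumpE (bigD1 i)//= (_ : _ * _ = 0) ?mul0r//.
move: h; rewrite ler_normr => /orP[h|h].
  by rewrite [flatexp 1 (r - _)]flatexp_le0 ?mulr0 ?mul0r//; lra.
by rewrite flatexp_le0 ?mul0r//; lra.
Qed.

Lemma bump_shift (c : V) (r : R) (x t : V) : bumpf (c + t) r x = bumpf c r (x - t).
Proof.
rewrite !bumpE; apply: eq_bigr => i _.
by rewrite !mxE; congr (flatexp 1 _ * flatexp 1 _); ring.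
Qed.

Lemma smooth_partial (w : V -> R) i : smooth w -> smooth (partial_derivative i w).
Proof. by move=> sw s x; have := sw (rcons s i) x; rewrite foldr_rcons. Qed.

Lemma smooth_differentiable (w : V -> R) x : smooth w -> differentiable w x.
Proof. by move/(_ [::] x). Qed.

Lemma smooth_continuous (w : V -> R) : smooth w -> continuous w.
Proof. by move=> sw x; exact/differentiable_continuous/smooth_differentiable. Qed.

Lemma derive_partial (w : V -> R) (v x : V) : differentiable w x ->
  'D_v w x = \sum_i v 0 i * partial_derivative i w x.
Proof.
move=> dw; rewrite deriveE// {1}(row_sum_delta v) linear_sum /=.
by apply: eq_bigr => i _; rewrite linearZ /= /partial_derivative deriveE.
Qed.

Lemma partial_vanish (K : set V) (w : V -> R) i : closed K -> (forall x, ~ K x -> w x = 0) ->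
  forall x, ~ K x -> partial_derivative i w x = 0.
Proof.
move=> cK wK x nKx; rewrite /partial_derivative.
rewrite (@near_eq_derive _ _ _ w (cst 0)) ?derive_cst//.
have := closed_openC cK; rewrite openE => /(_ _ nKx) h.
by near=> y; apply: wK; near: y.
Unshelve. all: by end_near. Qed.

Lemma test_function_partial (Omega : set V) w i : test_function Omega w ->
  test_function Omega (partial_derivative i w).
Proof.
case=> sw [K [cK KO wK]]; split; first exact: smooth_partial.
exists K; split => //; apply: partial_vanish => //.
by apply: compact_closed cK; exact: norm_hausdorff.
Qed.

Lemma compact_support_bounded (K : set V) (w : V -> R) : continuous w -> compact K ->
  (forall x, ~ K x -> w x = 0) -> exists2 M : R, 0 <= M & forall x, `|w x| <= M.
Proof.
move=> cw cK wK; have [K0|/set0P K0] := eqVneq K set0.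
  by exists 0 => // x; rewrite wK ?normr0// K0.
have [|c _ h] := EVT_max_rV (f := fun x => `|w x|) K0 cK.
  apply: continuous_subspaceT => x; apply: (@continuous_comp _ _ _ w Num.norm).
    exact: cw.
  exact: norm_continuous.
exists `|w c| => // x; have [Kx|nKx] := pselect (K x); first exact/h/mem_set.
by rewrite wK// normr0.
Qed.

Lemma test_function_bounded (Omega : set V) w : test_function Omega w ->
  exists2 M : R, 0 <= M & forall x, `|w x| <= M.
Proof.
case=> sw [K [cK _ wK]].
exact: compact_support_bounded (smooth_continuous sw) cK wK.
Qed.

Definition box (c : V) (r : R) : set V := [set x | forall i, `|x 0 i - c 0 i| <= r].

Lemma box_compact c r : compact (box c r).
Proof.
rewrite (_ : box c r = [set v : V | forall i, `[c 0 i - r, c 0 i + r]%classic (v ord0 i)]).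
  apply: (@rV_compact _ _ (fun i => `[c 0 i - r, c 0 i + r]%classic)) => i.
  exact: segment_compact.
apply/seteqP; split => x /= h i; have := h i; rewrite /= in_itv/= ler_distl;
  by move=> /andP[h1 h2]; apply/andP; split.
Qed.

Lemma bump_test (Omega : set V) c r : box c r `<=` Omega -> test_function Omega (bumpf c r).
Proof.
move=> bO; split; first exact: bump_smooth.
exists (box c r); split => //; first exact: box_compact.
move=> x /existsNP[i /negP]; rewrite -ltNge => /ltW; exact: bump_eq0.
Qed.

End smooth_functions.

(** * Weak Hessian bounds along segments *)

Section integration_lemmas.
Context d (T : measurableType d) (R : realType) (mu : {measure set T -> \bar R}).
Implicit Types (D : set T) (f g : T -> R).

Lemma integrableM_bounded D f g M : measurable D ->
  mu.-integrable D (EFin \o f) -> measurable_fun D g ->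
  (forall x, D x -> `|g x| <= M) -> mu.-integrable D (EFin \o (f \* g)).
Proof.
move=> mD If mg gM.
have := @integrableMl _ _ _ mu D mD _ g If mg; apply.
exists M; split; first exact: num_real.
by move=> N MN x Dx; apply: le_trans (gM x Dx) (ltW MN).
Qed.

Lemma Rintegral_ae_ge0 D f : measurable D -> mu.-integrable D (EFin \o f) ->
  {ae mu, forall x, D x -> 0 <= f x} -> 0 <= \int[mu]_(x in D) f x.
Proof.
move=> mD If f0; have mf := measurable_int _ If.
have -> : \int[mu]_(x in D) f x = \int[mu]_(x in D) `|f x|.
  rewrite /Rintegral; congr fine; apply: ae_eq_integral => //.
    by apply/measurable_EFinP/measurableT_comp => //; exact/measurable_EFinP.
  by apply: filterS f0 => x h /h fx /=; rewrite ger0_norm.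
by apply: Rintegral_ge0 => x _.
Qed.

Lemma le_Rintegral_ae D f g : measurable D -> mu.-integrable D (EFin \o f) ->
  mu.-integrable D (EFin \o g) -> {ae mu, forall x, D x -> f x <= g x} ->
  \int[mu]_(x in D) f x <= \int[mu]_(x in D) g x.
Proof.
move=> mD If Ig fg; rewrite -subr_ge0 -RintegralB//; apply: Rintegral_ae_ge0 => //.
  rewrite (_ : _ \o _ = (EFin \o g) \- (EFin \o f))%E; first exact: integrableB.
  exact/funext.
by apply: filterS fg => x h /h; rewrite subr_ge0.
Qed.

Lemma integrable_sumr D n (F : 'I_n -> T -> R) : measurable D ->
  (forall i, mu.-integrable D (EFin \o F i)) ->
  mu.-integrable D (EFin \o (fun x => \sum_i F i x)).
Proof.
move=> mD IF; rewrite (_ : _ \o _ = (fun x => \sum_i (F i x)%:E)%E).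
  by apply: integrable_sum => // i _; exact: IF.
by apply/funext => x /=; rewrite sumEFin.
Qed.

Lemma Rintegral_sum D n (F : 'I_n -> T -> R) : measurable D ->
  (forall i, mu.-integrable D (EFin \o F i)) ->
  \int[mu]_(x in D) (\sum_i F i x) = \sum_i \int[mu]_(x in D) F i x.
Proof.
move=> mD; elim: n F => [|n IH] F IF.
  by under eq_Rintegral do rewrite big_ord0; rewrite Rintegral_cst// mul0r big_ord0.
under eq_Rintegral do rewrite big_ord_recr /=.
rewrite RintegralD//; last exact: integrable_sumr.
by rewrite IH// big_ord_recr.
Qed.

Lemma integrableZlr D f c : measurable D -> mu.-integrable D (EFin \o f) ->
  mu.-integrable D (EFin \o (fun x => c * f x)).
Proof.
move=> mD If; rewrite (_ : _ \o _ = (fun x => c%:E * (f x)%:E)%E).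
  exact: integrableZl.
exact/funext.
Qed.

Lemma L2_integrable D f : measurable D -> (mu D < +oo)%E -> measurable_fun D f ->
  mu.-integrable D (EFin \o (fun x => f x ^+ 2)) -> mu.-integrable D (EFin \o f).
Proof.
move=> mD fD mf If2.
have I1 : mu.-integrable D (EFin \o (fun x => 1 + f x ^+ 2)).
  have -> : EFin \o (fun x => 1 + f x ^+ 2) =
      ((EFin \o cst 1%R) \+ (EFin \o (fun x => (f x ^+ 2)%R)))%E by exact/funext.
  by apply: integrableD => //; apply: measurable_bounded_integrable => //; exact: bounded_cst.
apply: le_integrable I1 => //; first exact/measurable_EFinP.
move=> x Dx /=; rewrite lee_fin [leRHS]ger0_norm ?addr_ge0 ?sqr_ge0//.
rewrite ler_norml.
by have := sqr_ge0 (f x - 1); have := sqr_ge0 (f x + 1); move: (f x) => y ? ?;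
   apply/andP; split; nra.
Qed.

End integration_lemmas.

Lemma MVT_between (R : realType) (f df : R -> R) (a b : R) : a < b ->
  (forall x : R, a < x < b -> is_derive x 1 f (df x)) ->
  {within `[a, b], continuous f} ->
  exists c : R, a < c < b /\ f b - f a = df c * (b - a).
Proof.
move=> ab dfab cf.
have dfab' (x : R) : x \in `]a, b[ -> is_derive x 1 f (df x).
  by rewrite in_itv/=; exact: dfab.
by have [c cab e] := MVT ab dfab' cf; exists c; split; first by rewrite in_itv/= in cab.
Qed.

(* Mean value theorem, applied to [g] on both sides of a point where it would be
   negative and then to [g']. *)
Lemma concave_ge0 (R : realType) (g g' g'' : R -> R) :
  (forall t : R, t \in `]0, 1[ -> is_derive t 1 g (g' t)) ->
  (forall t : R, t \in `]0, 1[ -> is_derive t 1 g' (g'' t)) ->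
  (forall t : R, t \in `]0, 1[ -> g'' t <= 0) ->
  {within `[0, 1], continuous g} -> g 0 = 0 -> g 1 = 0 ->
  forall t : R, 0 <= t <= 1 -> 0 <= g t.
Proof.
move=> dg dg' g2 cg g0 g1 t /andP[t0 t1].
have [<-|tN0] := eqVneq 0 t; first by rewrite g0.
have [->|tN1] := eqVneq t 1; first by rewrite g1.
have {t0 tN0} t0 : 0 < t by rewrite lt_def eq_sym tN0.
have {t1 tN1} t1 : t < 1 by rewrite lt_neqAle tN1.
rewrite leNgt; apply/negP => gt.
have [||a [/andP[a0 a_t] ha]] := @MVT_between R g g' 0 t t0.
- by move=> x /andP[? ?]; apply: dg; rewrite in_itv/=; apply/andP; split; lra.
- apply: continuous_subspaceW cg => x /=; rewrite !in_itv/= => /andP[? ?].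
  by apply/andP; split; lra.
have [||b [/andP[tb b1] hb]] := @MVT_between R g g' t 1 t1.
- by move=> x /andP[? ?]; apply: dg; rewrite in_itv/=; apply/andP; split; lra.
- apply: continuous_subspaceW cg => x /=; rewrite !in_itv/= => /andP[? ?].
  by apply/andP; split; lra.
move: hb ha; rewrite g0 g1 !subr0 sub0r => hb ha.
have ga : g' a < 0 by rewrite -(pmulr_llt0 _ t0) -ha.
have gb : 0 < g' b.
  have t1' : 0 < 1 - t by lra.
  by rewrite -(pmulr_lgt0 _ t1') -hb oppr_gt0.
have ab : a < b by lra.
have dab (x : R) : a <= x <= b -> is_derive x 1 g' (g'' x).
  move=> /andP[? ?]; apply: dg'.
  by rewrite in_itv/=; apply/andP; split; lra.
have [||c [/andP[ac cb] h]] := @MVT_between R g' g'' a b ab.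
- by move=> x /andP[? ?]; apply: dab; apply/andP; split; exact: ltW.
- apply: derivable_within_continuous => x; rewrite in_itv/= => /dab h.
  exact: ex_derive.
have c01 : c \in `]0, 1[ by rewrite in_itv/=; apply/andP; split; lra.
have := g2 _ c01; have : 0 < b - a by lra.
have : 0 < g' b - g' a by lra.
by rewrite h => h1 h2 h3; nra.
Qed.

Section mollification.
Context {R : realType} {n : nat}.
Local Notation V := 'rV[R]_n.
Local Notation mu := (@lebesgue_rV R n).
Variables (Omega : set V) (mO : measurable Omega).

Lemma measurable_smooth (D : set V) (phi : V -> R) : smooth phi ->
  measurable_fun D (phi : V -> measurableTypeR R).
Proof.
by move=> sp; apply: measurable_funTS; apply: continuous_rV_measurable; exact: smooth_continuous.
Qed.

Lemma measurable_shifted (D : set V) (phi : V -> R) a : smooth phi ->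
  measurable_fun D (fun x => phi (x - a) : measurableTypeR R).
Proof.
move=> sp; apply: measurable_funTS.
by apply: measurableT_comp; [exact: measurable_smooth|exact: measurable_translate].
Qed.

Lemma partial_shift (phi : V -> R) i a x :
  partial_derivative i (fun y => phi (y - a)) x = partial_derivative i phi (x - a).
Proof.
rewrite /partial_derivative /derive.
suff -> : (fun h : R => h^-1 *: (((fun y => phi (y - a)) \o shift x) (h *: delta_mx 0 i) -
    phi (x - a))) = (fun h => h^-1 *: ((phi \o shift (x - a)) (h *: delta_mx 0 i) -
    phi (x - a))) by [].
by apply/funext => h /=; rewrite addrA.
Qed.

Lemma is_derive_line (phi : V -> R) (p z : V) (t : R) :
  differentiable phi (p - t *: z) ->
  is_derive t 1 (fun s => phi (p - s *: z))
    (- \sum_i z 0 i * partial_derivative i phi (p - t *: z)).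
Proof.
move=> dphi.
have e : (fun h : R => h^-1 *: (((fun s => phi (p - s *: z)) \o shift t) (h *: (1 : R)) -
    phi (p - t *: z))) = (fun h => h^-1 *: ((phi \o shift (p - t *: z)) (h *: (- z)) -
    phi (p - t *: z))).
  apply/funext => h /=; congr (_ *: (phi _ - _)).
  by rewrite [h *: 1]mulr1 scalerDl scalerN opprD addrCA.
apply: DeriveDef.
  by have := @diff_derivable _ _ _ phi _ (- z) dphi; rewrite /derivable -e.
transitivity ('D_(- z) phi (p - t *: z)); first by rewrite /derive -e.
rewrite derive_partial// -sumrN.
by apply: eq_bigr => i _; rewrite mxE mulNr.
Qed.

(** Differentiation under the integral: only the test function moves with [s], so [f] need only be
    integrable, and a multiple of [|f|] dominates. *)
Lemma is_derive_mollified (f phi : V -> R) (z : V) (t : R) :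
  mu.-integrable Omega (EFin \o f) -> test_function setT phi ->
  is_derive t 1 (fun s => \int[mu]_(x in Omega) (f x * phi (x - s *: z)))
    (- \sum_i z 0 i * \int[mu]_(x in Omega) (f x * partial_derivative i phi (x - t *: z))).
Proof.
move=> If tp; have [sp _] := tp.
have [M M0 hM] := test_function_bounded tp.
have /choice[D hD] i : exists D : R, 0 <= D /\ forall x, `|partial_derivative i phi x| <= D.
  by have [D D0 hD] := test_function_bounded (test_function_partial i tp); exists D.
pose F (s : R) x := f x * phi (x - s *: z).
have dF (s : R) x : is_derive s 1 (F^~ x) (f x * - \sum_i z 0 i * partial_derivative i phi (x - s *: z)).
  have dl := is_derive_line (smooth_differentiable (x - s *: z) sp).
  have := @is_deriveZ _ _ _ _ (f x) _ _ _ dl.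
  exact.
have IF s : mu.-integrable Omega (EFin \o F s).
  apply: (integrableM_bounded mO If (M := M)) => [|x _]; last exact: hM.
  exact: measurable_shifted.
pose C := \sum_i `|z 0 i| * D i.
have C0 : 0 <= C by rewrite sumr_ge0// => i _; rewrite mulr_ge0//; case: (hD i).
have bnd (y : V) : `|- \sum_i z 0 i * partial_derivative i phi y| <= C.
  rewrite normrN; apply: le_trans (ler_norm_sum _ _ _) _; apply: ler_sum => i _.
  by rewrite normrM ler_wpM2l//; case: (hD i).
have IG : mu.-integrable Omega (EFin \o (fun x => `|f x| * C)).
  apply: (@integrableM_bounded _ _ _ mu Omega (fun x => `|f x|) (cst C) C mO) => //.
  - exact: integrable_norm.
  - by move=> x _; rewrite /= ger0_norm.
have I1 s : partial1of2 F s = fun x => f x * - \sum_i z 0 i * partial_derivative i phi (x - s *: z).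
  by apply/funext => x; rewrite partial1of2E derive_val.
have ta : t \in `](t - 1), (t + 1)[ by rewrite in_itv/=; apply/andP; split; lra.
have H := @cvg_differentiation_under_integral R _ _ mu F Omega mO t (t - 1) (t + 1) ta
  (fun s _ => IF s) (fun s x _ _ => @ex_derive _ _ _ _ _ _ _ (dF s x))
  (fun x => `|f x| * C) (fun x => mulr_ge0 (normr_ge0 _) C0) IG _.
have -> : - \sum_i z 0 i * \int[mu]_(x in Omega) (f x * partial_derivative i phi (x - t *: z)) =
    \int[mu]_(x in Omega) partial1of2 F t x.
  rewrite I1.
  have Ii i : mu.-integrable Omega (EFin \o (fun x => f x * partial_derivative i phi (x - t *: z))).
    apply: (integrableM_bounded mO If (M := D i)) => [|x _]; last by case: (hD i).
    by apply: measurable_shifted; exact: smooth_partial.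
  under [RHS]eq_Rintegral => x _.
    rewrite mulrN mulr_sumr -sumrN.
    under eq_bigr do rewrite mulrCA -mulNr.
    over.
  rewrite Rintegral_sum//; last by move=> i; exact: integrableZlr.
  rewrite -sumrN; apply: eq_bigr => i _.
  by rewrite RintegralZl// mulNr.
have {}H : (fun h : R => h^-1 *: ((fun s => \int[mu]_(y in Omega) F s y) (h + t) -
    \int[mu]_(y in Omega) F t y)) @ 0^' --> \int[mu]_(y in Omega) partial1of2 F t y.
  apply: H => s x; rewrite I1 normrM ler_wpM2l//; exact: bnd.
have e : (fun h : R => h^-1 *: (((fun s => \int[mu]_(x in Omega) (f x * phi (x - s *: z))) \o
    shift t) (h *: (1 : R)) - \int[mu]_(x in Omega) (f x * phi (x - t *: z)))) =
  (fun h : R => h^-1 *: ((fun s => \int[mu]_(y in Omega) F s y) (h + t) -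
    \int[mu]_(y in Omega) F t y)).
  by apply/funext => h /=; rewrite [h *: 1]mulr1.
apply: DeriveDef.
  by apply/cvg_ex; eexists; rewrite e; exact: H.
by rewrite /derive e; apply/cvg_lim.
Qed.

End mollification.

(** Comparison of the chord error of [f] with that of the parabola whose second derivative is
    [K]. *)
Lemma second_derivative_bounds (R : realType) (f f1 f2 : R -> R) (K : R) :
  (forall t : R, t \in `]0, 1[ -> is_derive t 1 f (f1 t)) ->
  (forall t : R, t \in `]0, 1[ -> is_derive t 1 f1 (f2 t)) ->
  (forall t : R, t \in `]0, 1[ -> 0 <= f2 t <= K) ->
  {within `[0, 1], continuous f} ->
  forall t : R, 0 <= t <= 1 ->
  0 <= (1 - t) * f 0 + t * f 1 - f t <= K / 2 * (t * (1 - t)).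
Proof.
move=> df df1 f2K cf t t01.
(* [a = -1], [k = 0] yields the lower bound and [a = 1], [k = - K] the upper one; [g] is built to
   vanish at both ends with second derivative [a * f2 + k]. *)
have gen (a k : R) : (forall s : R, s \in `]0, 1[ -> a * f2 s + k <= 0) ->
    0 <= a * (f t - ((1 - t) * f 0 + t * f 1)) - k / 2 * (t * (1 - t)).
  move=> hk.
  pose g s := a * f s + (k / 2 * s ^+ 2 - (a * (f 1 - f 0) + k / 2) * s - a * f 0).
  pose g' s := a * f1 s + (k * s - (a * (f 1 - f 0) + k / 2)).
  pose g'' s := a * f2 s + k.
  have gt : g t = a * (f t - ((1 - t) * f 0 + t * f 1)) - k / 2 * (t * (1 - t)).
    by rewrite /g; field.
  rewrite -gt; apply: (@concave_ge0 _ g g' g'') => //.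
  - move=> s s01; have h := df s s01.
    have h1 := @is_deriveZ _ _ _ _ a _ _ _ h.
    pose P : {poly R} := (k / 2)%:P * 'X^2 - (a * (f 1 - f 0) + k / 2)%:P * 'X - (a * f 0)%:P.
    have := is_deriveD h1 (is_derive_poly P s).
    have -> : (a \*: f) + horner P = g.
      by apply/funext => v; rewrite /g /P !fctE !hornerE.
    move/is_derive_eq; apply; rewrite /g' /P !poly.derivE !hornerE /GRing.scale /=.
    by field.
  - move=> s s01; have h := df1 s s01.
    have h1 := @is_deriveZ _ _ _ _ a _ _ _ h.
    pose P : {poly R} := k%:P * 'X - (a * (f 1 - f 0) + k / 2)%:P.
    have := is_deriveD h1 (is_derive_poly P s).
    have -> : (a \*: f1) + horner P = g'.
      by apply/funext => v; rewrite /g' /P !fctE !hornerE.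
    move/is_derive_eq; apply; rewrite /g'' /P !poly.derivE !hornerE /GRing.scale /=; ring.
  - pose P : {poly R} := (k / 2)%:P * 'X^2 - (a * (f 1 - f 0) + k / 2)%:P * 'X - (a * f 0)%:P.
    have -> : g = (fun s => a * f s + P.[s]).
      by apply/funext => w; rewrite /g /P !hornerE.
    move=> v; apply: cvgD; first by apply: cvgMr; exact: cf.
    exact: (@continuous_subspaceT _ _ `[0 : R, 1]%classic _ (@continuous_horner R P)).
  - by rewrite /g; field.
  - by rewrite /g; field.
have h2 := gen (-1) 0; have h1 := gen 1 (- K).
apply/andP; split.
  have /h2 : forall s : R, s \in `]0, 1[ -> -1 * f2 s + 0 <= 0.
    by move=> s /f2K/andP[? _]; lra.
  by lra.
have /h1 : forall s : R, s \in `]0, 1[ -> 1 * f2 s + - K <= 0.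
  by move=> s /f2K/andP[_ ?]; lra.
by rewrite mulNr mulNr; lra.
Qed.

(** [J] is the mass of a bump, [p0], [p1], [pt] are integrals against translated bumps, and [a0],
    [a1], [at'] the point values that their averages approximate within [e]. *)
Lemma average_bounds (R : realType) (J t e b p0 p1 pt a0 a1 at' : R) : 0 < J ->
  0 <= t <= 1 -> (a0 - e) * J <= p0 <= (a0 + e) * J ->
  (a1 - e) * J <= p1 <= (a1 + e) * J -> (at' - e) * J <= pt <= (at' + e) * J ->
  0 <= (1 - t) * p0 + t * p1 - pt <= b * J / 2 * (t * (1 - t)) ->
  - (e *+ 2) <= (1 - t) * a0 + t * a1 - at' <= b / 2 * (t * (1 - t)) + e *+ 2.
Proof.
move=> J0 /andP[t0 t1] /andP[b1 b2] /andP[a1' a2] /andP[c1 c2] /andP[d1 d2].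
have t1' : 0 <= 1 - t by rewrite subr_ge0.
have A1 := ler_wpM2l t1' b1; have A2 := ler_wpM2l t1' b2.
have A3 := ler_wpM2l t0 a1'; have A4 := ler_wpM2l t0 a2.
apply/andP; split; rewrite -(ler_pM2r J0).
  by rewrite mulr2n; nra.
have -> : (b / 2 * (t * (1 - t)) + e *+ 2) * J =
    b * J / 2 * (t * (1 - t)) + (e * J + e * J) by ring.
have -> : ((1 - t) * a0 + t * a1 - at') * J =
    (1 - t) * ((a0 - e) * J) + t * ((a1 - e) * J) - (at' + e) * J + (e * J + e * J) by ring.
move: A1 A3 c2 d2; set K := b * J / 2 * _.
move: ((1 - t) * _) ((1 - t) * p0) (t * (_ * J)) (t * p1) ((at' + e) * J) (e * J) K.
by move=> *; lra.
Qed.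

Section bump_integral.
Context {R : realType} {n : nat}.
Local Notation V := 'rV[R]_n.
Local Notation mu := (@lebesgue_rV R n).

Lemma boxW (c : V) (r s : R) x : r <= s -> box c r x -> box c s x.
Proof. by move=> rs h i; apply: le_trans (h i) rs. Qed.

Lemma nbhs_box (c : V) (A : set V) : nbhs c A -> exists2 r : R, 0 < r & box c r `<=` A.
Proof.
move=> /nbhs_ballP[e /= e0 eA]; exists (e / 2); first by rewrite divr_gt0.
move=> x h; apply: eA; apply/(rV_ballE _ _ e0) => i; rewrite distrC.
by apply: le_lt_trans (h i) _; lra.
Qed.

Lemma bump_bounded (c : V) r : exists2 M : R, 0 <= M & forall x, `|bumpf c r x| <= M.
Proof.
have [|M M0 hM] := @test_function_bounded R n setT (bumpf c r); first exact: bump_test.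
by exists M.
Qed.

Lemma measurable_bump D (c : V) r :
  measurable_fun D (bumpf c r : V -> measurableTypeR R).
Proof. by apply: measurable_smooth; exact: bump_smooth. Qed.

Lemma box_measure_fin (c : V) r : (mu (box c r) < +oo)%E.
Proof.
have r0 : 0 < `|r| + 1 by rewrite ltr_wpDl.
apply: (@le_lt_trans _ _ (mu (ball c (`|r| + 1)))).
  apply: le_measure; rewrite ?inE.
  - by apply: closed_rV_measurable; apply: compact_closed; [exact: norm_hausdorff|exact: box_compact].
  - exact: measurable_rV_ball.
  - move=> x h; apply/(rV_ballE _ _ r0) => i; rewrite distrC.
    apply: le_lt_trans (h i) _; apply: le_lt_trans (ler_norm _) _; lra.
by rewrite lebesgue_rV_ball// ltry.
Qed.

Lemma box_measurable (c : V) r : measurable (box c r).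
Proof.
by apply: closed_rV_measurable; apply: compact_closed; [exact: norm_hausdorff|exact: box_compact].
Qed.

Lemma bump_outside_box (c : V) r x : ~ box c r x -> bumpf c r x = 0.
Proof.
by move=> /existsNP[i /negP]; rewrite -ltNge => /ltW; exact: bump_eq0.
Qed.

Lemma integrable_bump D (c : V) r : measurable D -> mu.-integrable D (EFin \o bumpf c r).
Proof.
move=> mD; apply: (@integrableS _ _ _ mu setT) => //.
have mb := box_measurable c r; have [M M0 hM] := bump_bounded c r.
rewrite (_ : EFin \o bumpf c r = (EFin \o bumpf c r) \_ (box c r)); last first.
  apply/funext => x; rewrite patchE; case: ifPn => //; rewrite notin_setE => /bump_outside_box.
  by move=> /= ->.
apply: (iffLR (integrable_mkcond _ mb)).
apply: (@measurable_bounded_integrable _ _ _ mu (bumpf c r) _ mb).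
- exact: box_measure_fin.
- exact: measurable_bump.
- exists M; split; first exact: num_real.
  by move=> N MN x Dx; apply: le_trans (hM x) (ltW MN).
Qed.

Lemma Rintegral_bump_sub D (c : V) r : measurable D -> box c r `<=` D ->
  \int[mu]_(x in D) bumpf c r x = \int[mu]_x bumpf 0 r x.
Proof.
move=> mD bD; rewrite Rintegral_mkcond.
transitivity (\int[mu]_x bumpf c r x).
  apply: eq_Rintegral => x _; rewrite patchE; case: ifPn => //; rewrite notin_setE => nDx.
  by rewrite bump_outside_box//; apply: contra_not nDx; exact: bD.
rewrite -(@Rintegral_translate _ _ (bumpf c r) c); last exact: integrable_bump.
apply: eq_Rintegral => x _; rewrite -[in LHS](add0r c) bump_shift.
by rewrite add0r addrK.
Qed.

(** The bump is at least its minimum over the concentric half-size cube, which is positive by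
    compactness. *)
Lemma Rintegral_bump_gt0 (r : R) : 0 < r -> 0 < \int[mu]_x bumpf (0 : V) r x.
Proof.
move=> r0; have r20 : 0 < r / 2 by rewrite divr_gt0.
have B0 : box (0 : V) (r / 2) !=set0 by exists 0 => i; rewrite subrr normr0 ltW.
have [|c /set_mem cB hc] := EVT_min_rV (f := bumpf 0 r) B0 (@box_compact _ _ _ _).
  by apply: continuous_subspaceT; apply: smooth_continuous; exact: bump_smooth.
have bc : 0 < bumpf 0 r c.
  apply: bump_gt0; apply/(rV_ballE _ _ r0) => i; rewrite distrC.
  by apply: le_lt_trans (cB i) _; lra.
pose B : set V := ball (0 : V) (r / 2).
have mB : measurable B by exact: measurable_rV_ball.
have BE : mu B = ((r / 2 *+ 2) ^+ n)%:E by exact: lebesgue_rV_ball.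
have IB : mu.-integrable setT (EFin \o (cst (bumpf 0 r c) \_ B)).
  rewrite (_ : _ \o _ = (EFin \o cst (bumpf 0 r c)) \_ B); last first.
    by apply/funext => x /=; rewrite !patchE; case: ifP.
  apply: (iffLR (integrable_mkcond _ mB)).
  apply: (@measurable_bounded_integrable _ _ _ mu (cst (bumpf 0 r c)) _ mB) => //.
    by rewrite [ltLHS]BE ltry.
  exact: bounded_cst.
apply: (@lt_le_trans _ _ (\int[mu]_x (cst (bumpf 0 r c) \_ B) x)); last first.
  apply: le_Rintegral => //; first exact: integrable_bump.
  move=> x _; rewrite patchE; case: ifPn => [/set_mem xB|_]; last exact: bump_ge0.
  apply: hc; rewrite inE => i.
  by move/(rV_ballE _ _ r20) : xB => /(_ i); rewrite distrC; exact: ltW.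
rewrite -Rintegral_mkcond Rintegral_cst// [X in fine X]BE /= mulr_gt0// exprn_gt0//.
by rewrite mulrn_wgt0.
Qed.

End bump_integral.

Section weak_hessian_convexity.
Context {R : realType} {n : nat}.
Local Notation V := 'rV[R]_n.
Local Notation mu := (@lebesgue_rV R n).
Variables (Omega : set V) (mO : measurable Omega) (fO : (mu Omega < +oo)%E).

Lemma L2_integrable_rV f : L2 Omega f -> mu.-integrable Omega (EFin \o f).
Proof. by case=> mf If; apply: L2_integrable. Qed.

Lemma integrable_mul_bump f (c : V) r : mu.-integrable Omega (EFin \o f) ->
  mu.-integrable Omega (EFin \o (fun x => f x * bumpf c r x)).
Proof.
move=> If; have [M M0 hM] := bump_bounded c r.
by apply: (@integrableM_bounded _ _ _ mu _ f (bumpf c r) M) => //; exact: measurable_bump.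
Qed.

Lemma weak_partial_sum (z : V) (f g : 'I_n -> V -> R) j :
  (forall i, mu.-integrable Omega (EFin \o f i)) ->
  (forall i, mu.-integrable Omega (EFin \o g i)) ->
  (forall i, weak_partial Omega j (f i) (g i)) ->
  weak_partial Omega j (fun x => \sum_i z 0 i * f i x) (fun x => \sum_i z 0 i * g i x).
Proof.
move=> If Ig wfg phi tphi.
have Ih (h : 'I_n -> V -> R) (p : V -> R) : (forall i, mu.-integrable Omega (EFin \o h i)) ->
    test_function Omega p ->
    \int[mu]_(x in Omega) ((\sum_i z 0 i * h i x) * p x) =
    \sum_i z 0 i * \int[mu]_(x in Omega) (h i x * p x).
  move=> Ih tp; have [sp _] := tp; have [M M0 hM] := test_function_bounded tp.
  have Ihp i : mu.-integrable Omega (EFin \o (fun x => h i x * p x)).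
    by apply: (@integrableM_bounded _ _ _ mu _ (h i) p M) => //; exact: measurable_smooth.
  under eq_Rintegral => x _.
    rewrite mulr_suml; under eq_bigr do rewrite -mulrA.
    over.
  rewrite Rintegral_sum//; last by move=> i; exact: integrableZlr.
  by apply: eq_bigr => i _; rewrite RintegralZl.
rewrite !Ih//; last exact: test_function_partial.
by rewrite -sumrN; apply: eq_bigr => i _; rewrite wfg// mulrN.
Qed.

(** Moving the bump differentiates it with the opposite sign, and the weak derivative carries this
    over to [f] with a second change of sign. The support condition concerns the position at [t]
    only, so it can be checked point by point along a segment. *)
Lemma is_derive_mollified_weak (f : V -> R) (g : 'I_n -> V -> R) (c z : V) (r t : R) :
  mu.-integrable Omega (EFin \o f) ->
  (forall i, mu.-integrable Omega (EFin \o g i)) ->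
  (forall i, weak_partial Omega i f (g i)) ->
  test_function Omega (bumpf (c + t *: z) r) ->
  is_derive t 1 (fun s => \int[mu]_(x in Omega) (f x * bumpf (c + s *: z) r x))
    (\int[mu]_(x in Omega) ((\sum_i z 0 i * g i x) * bumpf (c + t *: z) r x)).
Proof.
move=> If Ig wfg tb.
have -> : (fun s => \int[mu]_(x in Omega) (f x * bumpf (c + s *: z) r x)) =
    (fun s => \int[mu]_(x in Omega) (f x * bumpf c r (x - s *: z))).
  by apply/funext => s; apply: eq_Rintegral => x _; rewrite bump_shift.
have tc : test_function setT (bumpf c r) by exact: bump_test.
apply: (is_derive_eq (is_derive_mollified mO z t If tc)).
under [RHS]eq_Rintegral => x _.
  rewrite mulr_suml; under eq_bigr do rewrite -mulrA.
  over.
rewrite Rintegral_sum//; last by move=> i; apply: integrableZlr => //; exact: integrable_mul_bump.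
rewrite -sumrN; apply: eq_bigr => i _; rewrite RintegralZl//; last exact: integrable_mul_bump.
rewrite -mulrN; congr (_ * _).
have := wfg i _ tb.
have -> : partial_derivative i (bumpf (c + t *: z) r) =
    (fun x => partial_derivative i (bumpf c r) (x - t *: z)).
  apply/funext => x; rewrite -partial_shift; congr (partial_derivative i _ x).
  by apply/funext => y; rewrite bump_shift.
by move=> ->; rewrite opprK.
Qed.

Variables (u : V -> R) (G : V -> V) (H : V -> 'M[R]_n).
Hypotheses (wu : weak_gradient Omega u G)
  (wG : forall i, weak_gradient Omega (fun x => G x 0 i) (fun x => row i (H x))).

(** Integrating [u] against a bump of fixed radius that slides along the segment gives a function of
    one variable whose second derivative integrates the form of [H] at [y - x] against the bump, so
    it lies between 0 and [b * J]. Continuity of [u] at three points removes the mollification. *)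
Lemma weak_hessian_interpolation_open (S : set V) (x y : V) (b t : R) :
  open S -> S `<=` Omega ->
  (forall p q (s : R), S p -> S q -> 0 <= s <= 1 -> S ((1 - s) *: p + s *: q)) ->
  (forall p, S p -> u q @[q --> p] --> u p) ->
  {ae mu, forall p, S p -> 0 <= dotv ((y - x) *m H p) (y - x) <= b} ->
  S x -> S y -> 0 <= t <= 1 ->
  0 <= (1 - t) * u x + t * u y - u ((1 - t) *: x + t *: y) <= b / 2 * (t * (1 - t)).
Proof.
move=> oS SO convS cu Hb Sx Sy t01.
pose z := y - x; pose p s := x + s *: z.
have pE s : p s = (1 - s) *: x + s *: y.
  by rewrite /p /z scalerBr scalerBl scale1r addrA addrAC.
rewrite -pE; have Sp s : 0 <= s <= 1 -> S (p s) by rewrite pE; exact: convS.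
suff close (e : R) : 0 < e -> - (e *+ 2) <= (1 - t) * u x + t * u y - u (p t) <=
    b / 2 * (t * (1 - t)) + e *+ 2.
  apply/andP; split; apply/ler_addgt0Pl => e e0.
    by have /andP[] := close (e / 2) (divr_gt0 e0 (ltr0n _ 2)); lra.
  by have /andP[] := close (e / 2) (divr_gt0 e0 (ltr0n _ 2)); lra.
move=> e0.
have rad q : S q -> exists2 r : R, 0 < r & forall v, box q r v -> S v /\ `|u v - u q| <= e.
  move=> Sq; have : nbhs q (S `&` [set v | `|u q - u v| <= e]).
    apply: filterI; first by move: oS; rewrite openE => /(_ _ Sq).
    by move/cvgrPdist_le : (cu q Sq) => /(_ e e0).
  move=> /nbhs_box[r r0 h]; exists r => // v /h[Sv uv]; split => //.
  by rewrite distrC.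
have [r1 r10 h1] := rad x Sx; have [r2 r20 h2] := rad y Sy.
have [r3 r30 h3] := rad _ (Sp t t01).
pose r := Num.min r1 (Num.min r2 r3).
have r0 : 0 < r by rewrite !lt_min r10 r20.
have rr1 : r <= r1 by rewrite /r ge_min lexx.
have rr2 : r <= r2 by rewrite /r !ge_min lexx orbT.
have rr3 : r <= r3 by rewrite /r !ge_min lexx !orbT.
(* A point [p s + w] is the convex combination of [x + w] and [y + w], so radii valid at the
   endpoints serve all along the segment. *)
have boxS (s : R) : 0 <= s <= 1 -> box (p s) r `<=` S.
  move=> s01 v hv; have [w vE] : exists w, v = p s + w.
    by exists (v - p s); rewrite addrC subrK.
  have wr i : `|w 0 i| <= r.
    by have := hv i; rewrite vE mxE addrAC subrr add0r.
  have -> : v = (1 - s) *: (x + w) + s *: (y + w).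
    by rewrite !scalerDr addrACA -pE -scalerDl subrK scale1r.
  apply: convS => //.
    apply: (proj1 (h1 _ _)) => i; rewrite mxE addrAC subrr add0r.
    exact: le_trans rr1.
  apply: (proj1 (h2 _ _)) => i; rewrite mxE addrAC subrr add0r.
  exact: le_trans rr2.
have boxO (s : R) : 0 <= s <= 1 -> box (p s) r `<=` Omega.
  by move=> s01; exact: subset_trans (boxS s s01) SO.
have Iu : mu.-integrable Omega (EFin \o u) by apply: L2_integrable_rV; case: wu.
have IG i : mu.-integrable Omega (EFin \o (fun x => G x 0 i)).
  by apply: L2_integrable_rV; case: wu => _ /(_ i)[].
have IH i j : mu.-integrable Omega (EFin \o (fun x => H x i j)).
  have := wG i; case=> _ /(_ j)[].
  have -> : (fun x => row i (H x) 0 j) = (fun x => H x i j).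
    by apply/funext => q; rewrite mxE.
  by move=> h _; exact: L2_integrable_rV.
pose psi s := \int[mu]_(q in Omega) (u q * bumpf (p s) r q).
pose psi1 s := \int[mu]_(q in Omega) ((\sum_i z 0 i * G q 0 i) * bumpf (p s) r q).
pose psi2 s := \int[mu]_(q in Omega)
  ((\sum_j z 0 j * (\sum_i z 0 i * H q i j)) * bumpf (p s) r q).
have dpsi (s : R) : 0 <= s <= 1 -> is_derive s 1 psi (psi1 s).
  move=> s01; apply: is_derive_mollified_weak => // [i|].
    by case: wu => _ /(_ i)[].
  by apply: bump_test; exact: boxO.
have IzH j : mu.-integrable Omega (EFin \o (fun q => \sum_i z 0 i * H q i j)).
  by apply: integrable_sumr => // i; exact: integrableZlr.
have dpsi1 (s : R) : 0 <= s <= 1 -> is_derive s 1 psi1 (psi2 s).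
  move=> s01; apply: (@is_derive_mollified_weak _ (fun j q => \sum_i z 0 i * H q i j)) => //.
  - by apply: integrable_sumr => // i; exact: integrableZlr.
  - move=> j; apply: weak_partial_sum => // i.
    have := wG i; case=> _ /(_ j)[_].
    have -> : (fun x => row i (H x) 0 j) = (fun x => H x i j).
      by apply/funext => q; rewrite mxE.
    by [].
  - by apply: bump_test; exact: boxO.
pose J := \int[mu]_q bumpf (0 : V) r q.
have J0 : 0 < J by exact: Rintegral_bump_gt0.
have JE (s : R) : 0 <= s <= 1 -> \int[mu]_(q in Omega) bumpf (p s) r q = J.
  by move=> s01; rewrite Rintegral_bump_sub//; exact: boxO.
have Jc (s a : R) : 0 <= s <= 1 -> \int[mu]_(q in Omega) (a * bumpf (p s) r q) = a * J.
  by move=> s01; rewrite RintegralZl ?JE//; exact: integrable_bump.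
have Ib (s a : R) : mu.-integrable Omega (EFin \o (fun q => a * bumpf (p s) r q)).
  by apply: integrableZlr => //; exact: integrable_bump.
have formE q : \sum_j z 0 j * (\sum_i z 0 i * H q i j) = dotv (z *m H q) z.
  by rewrite dotvE; apply: eq_bigr => j _; rewrite mulrC; congr (_ * _); rewrite mxE.
have IzHz : mu.-integrable Omega (EFin \o (fun q => \sum_j z 0 j * (\sum_i z 0 i * H q i j))).
  by apply: integrable_sumr => // j; exact: integrableZlr.
have psi2b (s : R) : 0 <= s <= 1 -> 0 <= psi2 s <= b * J.
  move=> s01; apply/andP; split.
    apply: Rintegral_ae_ge0 => //; first exact: integrable_mul_bump.
    apply: filterS Hb => q hq _; rewrite formE.
    have [/(boxS s s01) Sq|nb] := pselect (box (p s) r q); last by rewrite bump_outside_box ?mulr0.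
    by rewrite mulr_ge0 ?bump_ge0//; have /andP[] := hq Sq.
  rewrite -(Jc s b s01); apply: le_Rintegral_ae => //; first exact: integrable_mul_bump.
  apply: filterS Hb => q hq _; rewrite formE.
  have [/(boxS s s01) Sq|nb] := pselect (box (p s) r q); last by rewrite bump_outside_box ?mulr0.
  by rewrite ler_wpM2r ?bump_ge0//; have /andP[] := hq Sq.
have approx (s c : R) : 0 <= s <= 1 -> r <= c ->
    (forall v, box (p s) c v -> S v /\ `|u v - u (p s)| <= e) ->
    (u (p s) - e) * J <= psi s <= (u (p s) + e) * J.
  move=> s01 rc h; rewrite -!(Jc s _ s01); apply/andP; split;
    (apply: le_Rintegral => //; first exact: integrable_mul_bump);
    move=> q _; have [/(boxW rc)/h[_]|nb] := pselect (box (p s) r q);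
      try (by rewrite bump_outside_box ?mulr0);
    by rewrite ler_distl => /andP[? ?]; rewrite ler_wpM2r ?bump_ge0.
have p0 : p 0 = x by rewrite /p scale0r addr0.
have p1 : p 1 = y by rewrite /p scale1r /z addrC subrK.
have oo01 (s : R) : s \in `]0, 1[ -> 0 <= s <= 1.
  by rewrite in_itv/= => /andP[? ?]; apply/andP; split; exact: ltW.
have cpsi : {within `[0, 1], continuous psi}.
  apply: derivable_within_continuous => s; rewrite in_itv/= => s01.
  by have h := dpsi s s01; exact: ex_derive.
have := @second_derivative_bounds R psi psi1 psi2 (b * J)
  (fun s h => dpsi s (oo01 s h)) (fun s h => dpsi1 s (oo01 s h))
  (fun s h => psi2b s (oo01 s h)) cpsi t t01.
have h01 : 0 <= (0 : R) <= 1 by rewrite lexx ler01.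
have h11 : 0 <= (1 : R) <= 1 by rewrite lexx ler01.
have ht := approx t r3 t01 rr3 h3.
have := approx 0 r1 h01 rr1; rewrite p0 => /(_ h1) h0'.
have := approx 1 r2 h11 rr2; rewrite p1 => /(_ h2) h1'.
exact: (average_bounds J0 t01 h0' h1' ht).
Qed.

End weak_hessian_convexity.

(** * Simplices and linear interpolation *)

Section barycentric.
Context {R : realType} {n : nat}.
Local Notation V := 'rV[R]_n.
Local Notation mu := (@lebesgue_rV R n).
Implicit Types (K : 'I_n.+1 -> V) (x y : V).

(** Gradient of the barycentric coordinate [i]: the columns of the inverse edge matrix are dual to
    the edges at the first vertex, and all the gradients sum to zero. *)
Definition bary_grad K (i : 'I_n.+1) : V :=
  if unlift ord0 i is Some j then (col j (invmx (edge_mx K)))^T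
  else - \sum_j (col j (invmx (edge_mx K)))^T.

Definition bary K i x : R := (i == ord0)%:R + dotv (bary_grad K i) (x - K ord0).

Lemma bary_lift K j x : bary K (lift ord0 j) x = ((x - K ord0) *m invmx (edge_mx K)) 0 j.
Proof.
rewrite /bary /bary_grad liftK eq_sym (negbTE (neq_lift _ _)) add0r dotvC /dotv trmxK.
by rewrite !mxE; apply: eq_bigr => k _; rewrite !mxE.
Qed.

Lemma bary_ord0 K x : bary K ord0 x = 1 - \sum_j bary K (lift ord0 j) x.
Proof.
rewrite {1}/bary /bary_grad unlift_none eqxx dotvNl dotv_suml; congr (1 - _).
by apply: eq_bigr => j _; rewrite /bary /bary_grad liftK eq_sym (negbTE (neq_lift _ _)) add0r.
Qed.

Lemma bary_sum K x : \sum_i bary K i x = 1.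
Proof. by rewrite big_ord_recl bary_ord0 subrK. Qed.

Lemma bary_combine K x : nondegenerate_simplex K -> \sum_i bary K i x *: K i = x.
Proof.
move=> uK; rewrite big_ord_recl bary_ord0 scalerBl scale1r scaler_suml addrAC -addrA.
rewrite -sumrB (eq_bigr (fun j => ((x - K ord0) *m invmx (edge_mx K)) 0 j *:
  row j (edge_mx K))).
  by rewrite -mulmx_sum_row mulmxKV// addrC subrK.
by move=> j _; rewrite bary_lift -scalerBr rowK.
Qed.

Lemma bary_diff K i x y : bary K i x - bary K i y = dotv (bary_grad K i) (x - y).
Proof.
rewrite /bary opprD addrACA subrr add0r -dotvBr; congr (dotv _ _).
by rewrite opprB addrA subrK.
Qed.

Lemma bary_conv K i x y (t : R) :
  bary K i ((1 - t) *: x + t *: y) = (1 - t) * bary K i x + t * bary K i y.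
Proof.
apply/eqP; rewrite -subr_eq0; apply/eqP.
have -> : bary K i ((1 - t) *: x + t *: y) - ((1 - t) * bary K i x + t * bary K i y) =
  (bary K i ((1 - t) *: x + t *: y) - bary K i x) - t * (bary K i y - bary K i x) by ring.
rewrite !bary_diff -dotvZr -dotvBr (_ : _ - _ - _ = 0) ?dotv0r//.
by apply/rowP => k; rewrite !mxE; ring.
Qed.

Lemma bary_unique K (l : 'I_n.+1 -> R) i : nondegenerate_simplex K -> \sum_j l j = 1 ->
  bary K i (\sum_j l j *: K j) = l i.
Proof.
move=> uK l1.
have xK : \sum_j l j *: K j - K ord0 = (\row_j l (lift ord0 j)) *m edge_mx K.
  rewrite mulmx_sum_row big_ord_recl; move: l1; rewrite big_ord_recl => /(canRL (addrK _)) ->.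
  rewrite scalerBl scale1r addrAC (addrAC (K ord0)) subrr add0r scaler_suml -sumrN -big_split /=.
  by apply: eq_bigr => j _; rewrite mxE rowK scalerBr addrC.
have hl j : bary K (lift ord0 j) (\sum_j l j *: K j) = l (lift ord0 j).
  by rewrite bary_lift xK mulmxK// mxE.
case: (unliftP ord0 i) => [j ->|->]; first exact: hl.
rewrite bary_ord0 (eq_bigr _ (fun j _ => hl j)); move: l1; rewrite big_ord_recl => <-.
by rewrite addrK.
Qed.

Lemma bary_vertex K i j : nondegenerate_simplex K -> bary K i (K j) = (i == j)%:R.
Proof.
move=> uK; rewrite -(@bary_unique K (fun k => (k == j)%:R) i uK).
  congr bary; rewrite (bigD1 j)//= eqxx scale1r big1 ?addr0// => k /negbTE ->.
  by rewrite scale0r.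
by rewrite (bigD1 j)//= eqxx big1 ?addr0// => k /negbTE ->.
Qed.

(** Replaces the existential coefficients by conditions on affine functions, from which closedness,
    convexity and null boundaries are read off. *)
Lemma faceP K A x : nondegenerate_simplex K ->
  face K A x <-> (forall i, 0 <= bary K i x) /\ (forall i, i \notin A -> bary K i x = 0).
Proof.
move=> uK; split => [[l [l0 lA l1 ->]]|[h0 hA]].
  by split => i; rewrite bary_unique//; exact: lA.
by exists (bary K ^~ x); split => //; [exact: bary_sum|rewrite bary_combine].
Qed.

Lemma simplexP K x : nondegenerate_simplex K ->
  simplex K x <-> (forall i, 0 <= bary K i x).
Proof.
by move=> uK; split => [/(faceP _ _ uK)[]//|h]; apply/(faceP _ _ uK); split => // i; rewrite inE.
Qed.

Lemma vertex_simplex K i : nondegenerate_simplex K -> simplex K (K i).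
Proof. by move=> uK; apply/simplexP => // j; rewrite bary_vertex. Qed.

Definition open_simplex K : set V := [set x | forall i, 0 < bary K i x].

Lemma open_simplexW K x : nondegenerate_simplex K -> open_simplex K x -> simplex K x.
Proof. by move=> uK h; apply/simplexP => // i; exact: ltW. Qed.

Lemma continuous_bary K i : continuous (bary K i).
Proof.
have -> : bary K i = (fun x => dotv x (bary_grad K i) +
    ((i == ord0)%:R - dotv (bary_grad K i) (K ord0))).
  by apply/funext => x; rewrite /bary dotvBr (dotvC x) addrCA.
by move=> x; apply: (@cvgD _ _ _ (nbhs x)); [exact: continuous_dotv|exact: cvg_cst].
Qed.

Lemma open_open_simplex K : open (open_simplex K).
Proof.
rewrite openE => x Kx.
have : \forall y \near x, forall i, 0 < bary K i y.
  apply: (@filter_forall _ _ (fun i y => 0 < bary K i y) (nbhs x)) => i.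
  have := @continuous_bary K i x; move/cvgrPdist_lt => /(_ _ (Kx i)).
  by apply: filterS => y; rewrite ltr_distl => /andP[? ?]; lra.
by [].
Qed.

Lemma closed_simplex K : nondegenerate_simplex K -> closed (simplex K).
Proof.
move=> uK.
have -> : simplex K = \bigcap_(i in [set: 'I_n.+1]) (bary K i @^-1` [set r | 0 <= r]).
  by apply/seteqP; split => x; [move/(simplexP _ uK) => h i _|move=> h; apply/(simplexP _ uK) => i];
    exact: h.
apply: closed_bigI => i _; apply: (closed_comp (f := bary K i)) => [x _|].
  exact: continuous_bary.
exact: closed_ge.
Qed.

Lemma open_simplex_conv K x y (t : R) : open_simplex K x -> open_simplex K y -> 0 <= t <= 1 ->
  open_simplex K ((1 - t) *: x + t *: y).
Proof.
move=> Kx Ky /andP[t0 t1] i; rewrite bary_conv.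
have [->|tN0] := eqVneq t 0; first by rewrite subr0 mul1r mul0r addr0.
rewrite ltr_wpDl//; first by rewrite mulr_ge0 ?subr_ge0// ltW.
by rewrite mulr_gt0// lt_def tN0.
Qed.

Lemma simplex_conv K x y (t : R) : nondegenerate_simplex K ->
  simplex K x -> simplex K y -> 0 <= t <= 1 -> simplex K ((1 - t) *: x + t *: y).
Proof.
move=> uK /(simplexP _ uK) Kx /(simplexP _ uK) Ky /andP[t0 t1]; apply/simplexP => // i.
by rewrite bary_conv addr_ge0// mulr_ge0// subr_ge0.
Qed.

Definition barycenter K : V := \sum_i n.+1%:R^-1 *: K i.

Lemma open_simplex_towards_center K x (t : R) : nondegenerate_simplex K -> simplex K x ->
  0 < t <= 1 -> open_simplex K ((1 - t) *: x + t *: barycenter K).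
Proof.
move=> uK /(simplexP _ uK) Kx /andP[t0 t1] i; rewrite bary_conv ltr_wpDl//.
  by rewrite mulr_ge0// subr_ge0.
rewrite /barycenter bary_unique ?mulr_gt0 ?invr_gt0//.
by rewrite sumr_const card_ord -[LHS]mulr_natl mulfV// pnatr_eq0.
Qed.

Lemma bary_le1 K i x : nondegenerate_simplex K -> simplex K x -> bary K i x <= 1.
Proof.
move=> uK /(simplexP _ uK) Kx; rewrite -(bary_sum K x) (bigD1 i)//= lerDl.
by rewrite sumr_ge0.
Qed.

Lemma measurable_simplex K : nondegenerate_simplex K -> measurable (simplex K).
Proof. by move=> uK; apply: closed_rV_measurable; exact: closed_simplex. Qed.

Lemma measurable_open_simplex K : measurable (open_simplex K).
Proof. by apply: open_rV_measurable; exact: open_open_simplex. Qed.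

Lemma bary_grad_neq0 K i : (0 < n)%N -> nondegenerate_simplex K -> bary_grad K i != 0.
Proof.
move=> n0 uK; apply/eqP => g0.
have [j ji] : exists j : 'I_n.+1, j != i.
  have [->|iN0] := eqVneq i ord0; last by exists ord0; rewrite eq_sym.
  by exists ord_max; rewrite -val_eqE /= -lt0n.
have := bary_diff K i (K i) (K j); rewrite g0 dotv0l !bary_vertex// eqxx eq_sym (negbTE ji).
by move/eqP; rewrite subr0 oner_eq0.
Qed.

(** On the boundary some barycentric coordinate vanishes, which confines it to finitely many
    hyperplanes. *)
Lemma ae_open_simplex K : (0 < n)%N -> nondegenerate_simplex K ->
  {ae mu, forall x, simplex K x -> open_simplex K x}.
Proof.
move=> n0 uK.
have : {ae mu, forall x, forall i : 'I_n.+1, bary K i x != 0}.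
  apply: (@filter_forall _ _ (fun i x => bary K i x != 0) (almost_everywhere mu)) => i.
  pose c := (i == ord0)%:R - dotv (bary_grad K i) (K ord0).
  exists [set x | dotv (bary_grad K i) x + c = 0]; split.
  - have := @measurable_dotv R n (bary_grad K i) c.
    by move=> /(_ measurableT _ (measurable_set1 0)); rewrite setTI.
  - by apply: hyperplane_null; exact: bary_grad_neq0.
  - move=> x /= /negP; rewrite negbK => /eqP.
    by rewrite /bary dotvBr addrCA.
by apply: filterS => x h /(simplexP _ uK) Kx i; rewrite lt_def h Kx.
Qed.

Lemma simplex_boundary_null K : (0 < n)%N -> nondegenerate_simplex K ->
  mu (simplex K `\` open_simplex K) = 0%E.
Proof.
move=> n0 uK; apply: measure_negligible.
  by apply: measurableD; [exact: measurable_simplex|exact: measurable_open_simplex].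
have [Z [mZ Z0 hZ]] := ae_open_simplex n0 uK; exists Z; split => // x [Kx nKx].
by apply: hZ => /=; apply: contra_not nKx => h; exact: h.
Qed.

(** The simplex lies in the parallelepiped spanned by its edges; this loses only the factor n!,
    which the constant absorbs. *)
Lemma simplex_volume_le K : nondegenerate_simplex K ->
  (mu (simplex K) <= `|\det (edge_mx K)|%:E)%E.
Proof.
move=> uK; rewrite -(lebesgue_parallelepiped (K ord0) uK); apply: le_measure; rewrite ?inE.
- exact: measurable_simplex.
- rewrite (_ : [set _ | _] = (fun x : V => x *m invmx (edge_mx K) + - (K ord0 *m invmx (edge_mx K))) @^-1`
    (\bigcap_(i in [set` 'I_n]) (rV_coord i @^-1` `[0, 1]%classic))).
    apply: measurable_rV_preimage; first exact: measurable_affine.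
    apply: fin_bigcap_measurable => // i _; rewrite -[X in measurable X]setTI.
    by apply: measurable_rV_coord => //; exact: measurable_itv.
  apply/seteqP; split => x /= h i; [move=> _|];
    have := h i; rewrite /= ?in_itv /rV_coord/= -mulmxBl//; exact.
- move=> x Kx i; rewrite -bary_lift; apply/andP; split; last exact: bary_le1.
  by move/(simplexP _ uK) : Kx; exact.
Qed.

Lemma simplex_measure_fin K : nondegenerate_simplex K -> (mu (simplex K) < +oo)%E.
Proof. by move=> /simplex_volume_le h; apply: le_lt_trans h _; rewrite ltry. Qed.

Lemma simplex_volumeE K : nondegenerate_simplex K -> (simplex_volume K)%:E = mu (simplex K).
Proof.
by move=> uK; rewrite /simplex_volume fineK// ge0_fin_numE// simplex_measure_fin.
Qed.

Lemma open_simplex_measure K : (0 < n)%N -> nondegenerate_simplex K ->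
  mu (open_simplex K) = (simplex_volume K)%:E.
Proof.
move=> n0 uK; rewrite simplex_volumeE//.
have -> : simplex K = open_simplex K `|` (simplex K `\` open_simplex K).
  by rewrite setDE setUIr setUv setIT; apply/esym/setUidPr => x; exact: open_simplexW.
rewrite measureU//; last by rewrite setDE setICA setICr setI0.
- by rewrite [X in (_ + X)%E](simplex_boundary_null n0 uK) adde0.
- exact: measurable_open_simplex.
- by apply: measurableD; [exact: measurable_simplex|exact: measurable_open_simplex].
Qed.

End barycentric.

Section linear_interpolation.
Context {R : realType} {n : nat}.
Local Notation V := 'rV[R]_n.
Implicit Types (K : 'I_n.+1 -> V) (v : V -> R).

Definition interp K v x : R := \sum_i v (K i) * bary K i x.

Definition interp_grad K v : V := \sum_i v (K i) *: bary_grad K i.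

Lemma interp_diff K v x y : interp K v x - interp K v y = dotv (interp_grad K v) (x - y).
Proof.
rewrite /interp -sumrB /interp_grad dotv_suml; apply: eq_bigr => i _.
by rewrite -mulrBr bary_diff dotvZl.
Qed.

Lemma interp_affine K v x :
  interp K v x = dotv (interp_grad K v) x + interp K v 0.
Proof. by rewrite -[in RHS](subr0 x) -interp_diff subrK. Qed.

Lemma interp_vertex K v i : nondegenerate_simplex K -> interp K v (K i) = v (K i).
Proof.
move=> uK; rewrite /interp (bigD1 i)//= bary_vertex// eqxx mulr1 big1 ?addr0// => j ji.
by rewrite bary_vertex// (negbTE ji) mulr0.
Qed.

Lemma interp_grad_edge K v i j : nondegenerate_simplex K ->
  dotv (interp_grad K v) (K i - K j) = v (K i) - v (K j).
Proof. by move=> uK; rewrite -interp_diff !interp_vertex. Qed.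

Lemma continuous_interp K v : continuous (interp K v).
Proof.
move=> x; apply: (@cvg_sumr _ _ (nbhs x)) => i.
by apply: (@cvgM _ _ (nbhs x)); [exact: cvg_cst|exact: continuous_bary].
Qed.

Lemma affine_combination (a p0 : V) (b : R) (m : 'I_n.+1 -> R) (p : 'I_n.+1 -> V) :
  \sum_j m j = 1 ->
  b + dotv a (\sum_j m j *: p j - p0) = \sum_j m j * (b + dotv a (p j - p0)).
Proof.
move=> m1; under [RHS]eq_bigr do rewrite mulrDr dotvBr mulrBr -dotvZr.
rewrite big_split /= sumrB -!mulr_suml m1 !mul1r dotvBr dotv_sumr.
by rewrite addrA.
Qed.

Lemma bary_combination K k (m : 'I_n.+1 -> R) (p : 'I_n.+1 -> V) : \sum_j m j = 1 ->
  bary K k (\sum_j m j *: p j) = \sum_j m j * bary K k (p j).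
Proof. exact: affine_combination. Qed.

Lemma interp_combination K v (m : 'I_n.+1 -> R) (p : 'I_n.+1 -> V) : \sum_j m j = 1 ->
  interp K v (\sum_j m j *: p j) = \sum_j m j * interp K v (p j).
Proof.
move=> m1; rewrite /interp; under eq_bigr do rewrite bary_combination// mulr_sumr.
rewrite exchange_big; apply: eq_bigr => j _; rewrite mulr_sumr.
by apply: eq_bigr => i _; rewrite mulrCA.
Qed.

(* A vertex of the common face is an extreme point of both simplices. *)
Lemma common_face_vertex K K' A B i : nondegenerate_simplex K -> nondegenerate_simplex K' ->
  simplex K `&` simplex K' = face K A -> simplex K `&` simplex K' = face K' B ->
  i \in A -> exists j, K i = K' j.
Proof.
move=> uK uK' EA EB iA.
have Ki : face K A (K i).
  apply/faceP => //; split => j; rewrite bary_vertex//; case: eqP => // -> /negP.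
  by [].
have /(faceP _ _ uK')[m0 mB] : face K' B (K i) by rewrite -EB EA.
have inK j : 0 < bary K' j (K i) -> simplex K (K' j).
  move=> mj; have jB : j \in B by apply: contraT => /mB e; rewrite e ltxx in mj.
  have : face K' B (K' j).
    apply/faceP => //; split => k; rewrite bary_vertex//; case: eqP => // -> /negP.
    by [].
  by rewrite -EB => -[].
have [j mj] : exists j, 0 < bary K' j (K i).
  apply: contrapT => /forallNP h; have := bary_sum K' (K i).
  rewrite big1 => [/esym/eqP|k _]; first by rewrite oner_eq0.
  by apply/eqP; rewrite eq_le m0 andbT leNgt; apply/negP/h.
exists j; rewrite -[RHS](bary_combine (K' j) uK).
have bj k : k != i -> bary K k (K' j) = 0.
  move=> ki; have := bary_vertex k i uK; rewrite (negbTE ki).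
  rewrite -{1}(bary_combine (K i) uK') bary_combination ?bary_sum//.
  move/psumr_eq0P => h.
  have /h/(_ j isT)/eqP : forall l, true -> 0 <= bary K' l (K i) * bary K k (K' l).
    move=> l _; have := m0 l; rewrite le_eqVlt => /predU1P[<-|ml]; first by rewrite mul0r.
    by rewrite mulr_ge0 ?(ltW ml)//; have /(simplexP _ uK) := inK l ml; exact.
  by rewrite mulf_eq0 gt_eqF//= => /eqP.
have b1 : bary K i (K' j) = 1.
  by have := bary_sum K (K' j); rewrite (bigD1 i)//= big1 ?addr0// => k /bj.
rewrite (bigD1 i)//= b1 scale1r big1 ?addr0// => k ki.
by rewrite bj// scale0r.
Qed.

(** A point of the common face is a combination of vertices shared by both simplices, and there both
    affine interpolants take the value of [v]. *)
Lemma interp_agree K K' A B v x : nondegenerate_simplex K -> nondegenerate_simplex K' ->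
  simplex K `&` simplex K' = face K A -> simplex K `&` simplex K' = face K' B ->
  simplex K x -> simplex K' x -> interp K v x = interp K' v x.
Proof.
move=> uK uK' EA EB Kx K'x.
have /(faceP _ _ uK)[_ xA] : face K A x by rewrite -EA.
rewrite -(bary_combine x uK) !interp_combination ?bary_sum//; apply: eq_bigr => k _.
have [kA|/xA ->] := boolP (k \in A); last by rewrite !mul0r.
have [j Kkj] := common_face_vertex uK uK' EA EB kA.
by rewrite interp_vertex// Kkj interp_vertex.
Qed.

End linear_interpolation.

Section mesh_properties.
Context {R : realType} {n : nat}.
Local Notation V := 'rV[R]_n.
Local Notation mu := (@lebesgue_rV R n).
Variables (Omega : set V) (N : nat) (T : 'I_N -> 'I_n.+1 -> V).
Hypotheses (n0 : (0 < n)%N) (pO : polyhedral_domain Omega) (mT : simplicial_mesh Omega T).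

Lemma mesh_nondegenerate e : nondegenerate_simplex (T e).
Proof. by case: mT. Qed.

Lemma mesh_cover x : closure Omega x -> exists e, simplex (T e) x.
Proof. by case: mT => _ <- _ [e _ h]; exists e. Qed.

Lemma mesh_sub_closure e x : simplex (T e) x -> closure Omega x.
Proof. by case: mT => _ <- _ h; exists e. Qed.

(** The mesh fills only the closure of [Omega], whose interior could be larger for a general open
    set. Here [Omega] is the interior of a closed polyhedron, which contains that closure. *)
Lemma open_simplex_sub e : open_simplex (T e) `<=` Omega.
Proof.
case: pO => oO _ _ [m [S [uS OE]]] x Kx.
have cS : closed (\bigcup_(k in [set: 'I_m]) simplex (S k)).
  by apply: closed_bigcup => [|k _]; [exact: finite_finset|exact: closed_simplex].
have sub : closure Omega `<=` \bigcup_(k in [set: 'I_m]) simplex (S k).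
  rewrite closureE => y; apply; split => //; rewrite {1}OE; exact: interior_subset.
rewrite OE; apply: (@interiorS _ (open_simplex (T e))).
  move=> y Ky; apply: sub; apply: (@mesh_sub_closure e); apply: open_simplexW => //.
  exact: mesh_nondegenerate.
by have := @open_open_simplex R n (T e); rewrite openE; exact.
Qed.

(** The intersection of two distinct elements is a proper face, on which some barycentric coordinate
    vanishes. *)
Lemma open_simplex_disjoint e e' x : open_simplex (T e) x -> simplex (T e') x -> e = e'.
Proof.
move=> Kx K'x; apply: contrapT => /eqP ee'; case: mT => uT _ /(_ _ _ ee')[A [B [AT EA _]]].
have : face (T e) A x by rewrite -EA; split => //; exact: open_simplexW.
move/(faceP _ _ (uT e)) => [_ hA].
have : ~~ ([set: 'I_n.+1]%SET \subset A) by rewrite finset.subTset.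
move/subsetPn => [i _ /hA] xi; have := Kx i; by rewrite xi ltxx.
Qed.

Lemma measurable_domain : measurable Omega.
Proof. by apply: open_rV_measurable; case: pO. Qed.

Lemma domain_sub_mesh : Omega `<=` \big[setU/set0]_(e < N) simplex (T e).
Proof.
move=> x Ox; have [e Kx] := mesh_cover (subset_closure Ox).
by rewrite -bigcup_seq /=; exists e => //=; rewrite mem_index_enum.
Qed.

Lemma domain_measure_fin : (mu Omega < +oo)%E.
Proof.
have mE e : measurable (simplex (T e)).
  by apply: measurable_simplex; exact: mesh_nondegenerate.
apply: (@le_lt_trans _ _ (mu (\big[setU/set0]_(e < N) simplex (T e)))).
  apply: le_measure; rewrite ?inE; [exact: measurable_domain| |exact: domain_sub_mesh].
  by apply: bigsetU_measurable.
have : forall s : seq 'I_N, measurable (\big[setU/set0]_(e <- s) simplex (T e)) /\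
    (mu (\big[setU/set0]_(e <- s) simplex (T e)) < +oo)%E.
  elim=> [|e s [ms fs]]; first by rewrite big_nil measure0; split.
  rewrite big_cons; split; first exact: measurableU.
  apply: le_lt_trans (measureU2 _ _ _) _ => //.
  by rewrite lte_add_pinfty// simplex_measure_fin//; exact: mesh_nondegenerate.
by move=> /(_ (index_enum _))[].
Qed.

Lemma ae_mesh_interior :
  {ae mu, forall x, forall e, simplex (T e) x -> open_simplex (T e) x}.
Proof.
apply: (@filter_forall _ _ (fun e x => simplex (T e) x -> open_simplex (T e) x)
  (almost_everywhere mu)) => e.
by apply: ae_open_simplex => //; exact: mesh_nondegenerate.
Qed.

(** The finitely many closed simplices that miss [x] stay away from it. A nearby mesh point thus
    shares an element with [x], which reduces local questions to one element. *)
Lemma mesh_near x : \forall y \near x, forall e, simplex (T e) y -> simplex (T e) x.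
Proof.
apply: (@filter_forall _ _ (fun e y => simplex (T e) y -> simplex (T e) x) (nbhs x)) => e.
have [Kx|nKx] := pselect (simplex (T e) x); first exact: nearW.
have := closed_openC (closed_simplex (mesh_nondegenerate e)); rewrite openE => /(_ _ nKx).
by apply: filterS => y /= nKy Ky.
Qed.

(** On shared faces the element picked is immaterial by [interp_agree]; off the mesh the value [0]
    is a default. *)
Definition mesh_interp (v : V -> R) (x : V) : R :=
  if [pick e | `[< simplex (T e) x >]] is Some e then interp (T e) v x else 0.

Lemma mesh_interpE v e x : simplex (T e) x -> mesh_interp v x = interp (T e) v x.
Proof.
rewrite /mesh_interp; case: pickP => [e' /asboolP K'x|h] Kx; last first.
  by have := h e; rewrite asboolT.
have [->//|e'e] := eqVneq e' e.
case: mT => uT _ /(_ _ _ e'e)[A [B [_ EA EB]]].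
exact: interp_agree (uT e') (uT e) EA EB K'x Kx.
Qed.

Lemma mesh_interp_nodal v : nodal_interpolant Omega T v (mesh_interp v).
Proof.
have vT e i : simplex (T e) (T e i).
  by apply: vertex_simplex; exact: mesh_nondegenerate.
split; last first.
  by move=> e i; rewrite (mesh_interpE _ (vT e i)) interp_vertex//; exact: mesh_nondegenerate.
split; last first.
  move=> e; exists (interp_grad (T e) v), (interp (T e) v 0) => x Kx.
  by rewrite (mesh_interpE _ Kx) interp_affine.
apply/subspace_continuousP => x Ox.
apply/cvgrPdist_lt => /= eps eps0.
have hc : \forall y \near x, forall e, `|interp (T e) v x - interp (T e) v y| < eps.
  apply: (@filter_forall _ _ (fun e y => `|interp (T e) v x - interp (T e) v y| < eps) (nbhs x)) => e.
  by have := @continuous_interp R n (T e) v x; move/cvgrPdist_lt; exact.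
rewrite near_withinE.
have := mesh_near x; apply: filterS2 hc => y hy hK Oy.
have [e Ky] := mesh_cover Oy; have Kx := hK e Ky.
by rewrite /from_subspace (mesh_interpE _ Kx) (mesh_interpE _ Ky).
Qed.

End mesh_properties.

(** Divide by [h] and let [h] tend to zero. It makes coefficients of first-order expansions
    unique. *)
Lemma le_square_eq0 (R : realType) (q C d : R) : 0 < d ->
  (forall h, 0 < h <= d -> `|h * q| <= C * h ^+ 2) -> q = 0.
Proof.
move=> d0 hq; apply/eqP; rewrite -normr_le0; apply/ler_addgt0Pl => e e0; rewrite addr0.
have C1 : 0 < `|C| + 1 by rewrite ltr_wpDl.
pose h := Num.min d (e / (`|C| + 1)).
have h0 : 0 < h by rewrite lt_min d0 divr_gt0.
have hd : h <= d by rewrite ge_min lexx.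
have he : h * (`|C| + 1) <= e by rewrite -ler_pdivlMr// ge_min lexx orbT.
have := hq h; rewrite h0 hd => /(_ isT); rewrite normrM (gtr0_norm h0) expr2.
rewrite mulrCA ler_pM2l// => /le_trans; apply; apply: le_trans he.
by rewrite mulrC ler_pM2l// (le_trans (ler_norm _))// lerDl.
Qed.

Lemma le_of_le_add_linear (R : realType) (a b C d : R) : 0 < d ->
  (forall h, 0 < h <= d -> a <= b + C * h) -> a <= b.
Proof.
move=> d0 hq; apply/ler_addgt0Pl => e e0.
have C1 : 0 < `|C| + 1 by rewrite ltr_wpDl.
pose h := Num.min d (e / (`|C| + 1)).
have h0 : 0 < h by rewrite lt_min d0 divr_gt0.
have hd : h <= d by rewrite ge_min lexx.
have he : h * (`|C| + 1) <= e by rewrite -ler_pdivlMr// ge_min lexx orbT.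
have := hq h; rewrite h0 hd => /(_ isT) /le_trans; apply; rewrite addrC lerD2r.
apply: le_trans he; rewrite mulrC ler_pM2l// (le_trans (ler_norm _))// lerDl//.
Qed.

Lemma half_unit_interval (R : realType) : 0 <= (1 / 2 : R) <= 1.
Proof. by apply/andP; split; lra. Qed.

(** * Gradients of functions with a bounded convexity gap *)

Section convexity_gap.
Context {R : realType} {n : nat}.
Local Notation V := 'rV[R]_n.
Implicit Types (K : 'I_n.+1 -> V) (u : V -> R) (B : 'M[R]_n) (S : set V).

(* [u] is convex on [S], and [u - x B x^T / 2] is concave on [S]. *)
Definition convexity_gap S u B := forall x y (t : R), S x -> S y -> 0 <= t <= 1 ->
  0 <= (1 - t) * u x + t * u y - u ((1 - t) *: x + t *: y) <=
  dotv ((y - x) *m B) (y - x) / 2 * (t * (1 - t)).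

Lemma formZ B (c : R) (z : V) : dotv (c *: z *m B) (c *: z) = c ^+ 2 * dotv (z *m B) z.
Proof. by rewrite -scalemxAl dotvZl dotvZr mulrA. Qed.

(** All points are pulled towards the barycenter by the same ratio [s], which multiplies the form by
    [(1 - s) ^+ 2], at most one; then [s] tends to zero and continuity of [u] concludes. *)
Lemma convexity_gap_closed (D : set V) K u B : nondegenerate_simplex K -> psdmx B ->
  simplex K `<=` D -> {within D, continuous u} ->
  convexity_gap (open_simplex K) u B -> convexity_gap (simplex K) u B.
Proof.
move=> uK pB KD cu gap x y t Kx Ky t01.
pose c := barycenter K; pose m := (1 - t) *: x + t *: y.
have Km : simplex K m by exact: simplex_conv.
have move_in q (e : R) : simplex K q -> 0 < e ->
    \forall s \near 0^'+, `|u q - u ((1 - s) *: q + s *: c)| <= e.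
  move=> Kq e0.
  have /subspace_continuousP/(_ q (KD _ Kq))/cvgrPdist_le/(_ e e0) := cu.
  rewrite near_withinE => /= hq.
  have hs : (fun s : R => (1 - s) *: q + s *: c) @ 0^'+ --> q.
    have -> : (fun s : R => (1 - s) *: q + s *: c) = (fun s : R => q + s *: (c - q)).
      by apply/funext => s; rewrite scalerBl scale1r scalerBr -addrA (addrC (- _)).
    rewrite -[X in _ --> X]addr0; apply: cvgD; first exact: cvg_cst.
    rewrite -(scale0r (c - q)); apply: cvgZr_tmp.
    exact: cvg_within.
  have h1 : \forall s \near 0^'+, D ((1 - s) *: q + s *: c) ->
      `|u q - u ((1 - s) *: q + s *: c)| <= e by exact: (hs _ hq).
  near=> s; apply: (near h1 s) => //; apply: KD; apply: open_simplexW => //.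
  apply: open_simplex_towards_center => //; apply/andP; split.
    by near: s; exact: nbhs_right_gt.
  by near: s; exact: nbhs_right_le.
suff close (e : R) : 0 < e -> - (e *+ 2) <= (1 - t) * u x + t * u y - u m <=
    dotv ((y - x) *m B) (y - x) / 2 * (t * (1 - t)) + e *+ 2.
  apply/andP; split; apply/ler_addgt0Pl => e e0.
    by have /andP[] := close (e / 2) (divr_gt0 e0 (ltr0n _ 2)); rewrite /m; lra.
  by have /andP[] := close (e / 2) (divr_gt0 e0 (ltr0n _ 2)); rewrite /m; lra.
move=> e0.
have : \forall s \near 0^'+, [/\ 0 < s <= 1, `|u x - u ((1 - s) *: x + s *: c)| <= e,
    `|u y - u ((1 - s) *: y + s *: c)| <= e & `|u m - u ((1 - s) *: m + s *: c)| <= e].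
  near=> s; split; last 3 first.
  - by near: s; exact: move_in.
  - by near: s; exact: move_in.
  - by near: s; exact: move_in.
  - by apply/andP; split; near: s; [exact: nbhs_right_gt|exact: nbhs_right_le].
move=> /filter_ex[s [s01 ux uy um]].
have := gap _ _ t (open_simplex_towards_center uK Kx s01)
  (open_simplex_towards_center uK Ky s01) t01.
have -> : (1 - t) *: ((1 - s) *: x + s *: barycenter K) +
    t *: ((1 - s) *: y + s *: barycenter K) = (1 - s) *: m + s *: c.
  by rewrite /m /c; apply/rowP => i; rewrite !mxE; ring.
have -> : (1 - s) *: y + s *: barycenter K - ((1 - s) *: x + s *: barycenter K) =
    (1 - s) *: (y - x).
  by apply/rowP => i; rewrite !mxE; ring.
rewrite formZ -/c.
have b0 : 0 <= dotv ((y - x) *m B) (y - x) by case: pB.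
move: ux uy um; move: (u ((1 - s) *: x + s *: c)) (u ((1 - s) *: y + s *: c))
  (u ((1 - s) *: m + s *: c)) => ux' uy' um'.
rewrite !ler_distl => /andP[? ?] /andP[? ?] /andP[? ?] /andP[g1 g2].
move: t01 s01 => /andP[t0 t1] /andP[s0 s1].
have hb : (1 - s) ^+ 2 * dotv ((y - x) *m B) (y - x) / 2 * (t * (1 - t)) <=
    dotv ((y - x) *m B) (y - x) / 2 * (t * (1 - t)).
  set Q := dotv _ _ / 2 * _.
  have -> : (1 - s) ^+ 2 * dotv ((y - x) *m B) (y - x) / 2 * (t * (1 - t)) =
      (1 - s) ^+ 2 * Q by rewrite /Q; ring.
  rewrite ler_piMl//; last by rewrite expr_le1//; lra.
  by rewrite /Q mulr_ge0 ?mulr_ge0 ?invr_ge0//; lra.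
have t1' : 0 <= 1 - t by lra.
have x1 : (1 - t) * u x <= (1 - t) * (ux' + e) by rewrite ler_wpM2l//; lra.
have x2 : (1 - t) * (ux' - e) <= (1 - t) * u x by rewrite ler_wpM2l//; lra.
have y1 : t * u y <= t * (uy' + e) by rewrite ler_wpM2l//; lra.
have y2 : t * (uy' - e) <= t * u y by rewrite ler_wpM2l//; lra.
have := le_trans g2 hb; move: (_ / 2 * (t * (1 - t))) => Q {}g2.
by apply/andP; split; rewrite mulr2n; lra.
Unshelve. all: by end_near. Qed.

Section gap_at_interior_point.
Variables (K : 'I_n.+1 -> V) (u : V -> R) (B : 'M[R]_n) (x : V).
Hypotheses (uK : nondegenerate_simplex K) (pB : psdmx B)
  (gap : convexity_gap (simplex K) u B) (Kx : open_simplex K x).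
Local Notation b z := (dotv (z *m B) z).

Lemma segment_in_simplex (z : V) :
  exists2 d : R, 0 < d & forall h, `|h| <= d -> simplex K (x + h *: z).
Proof.
have hs : (fun h : R => x + h *: z) @ 0 --> x.
  rewrite -[X in _ --> X]addr0; apply: cvgD; first exact: cvg_cst.
  rewrite -(scale0r z); apply: cvgZr_tmp; exact: cvg_id.
have := @open_open_simplex R n K; rewrite openE => /(_ _ Kx) /hs /nbhs_ballP[d /= d0 hd].
exists (d / 2); first by rewrite divr_gt0.
move=> h hh; apply: open_simplexW => //; apply: hd; rewrite /ball/= sub0r normrN.
by apply: le_lt_trans hh _; lra.
Qed.

(* The difference quotients are monotone and their oscillation is [O(h)]. *)
Lemma directional_expansion (z : V) : exists p (d : R), 0 < d /\
  forall h, `|h| <= d -> simplex K (x + h *: z) /\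
    `|u (x + h *: z) - u x - h * p| <= b z * h ^+ 2.
Proof.
have [d d0 hd] := segment_in_simplex z.
have b0 : 0 <= b z by case: pB.
pose dq (h : R) := (u (x + h *: z) - u x) / h.
have Kx' : simplex K x by exact: open_simplexW.
have step h t : 0 < h <= d -> 0 < t <= 1 ->
    dq h - b z * h / 2 <= dq (t * h) <= dq h.
  move=> /andP[h0 hhd] /andP[t0 t1].
  have Kh : simplex K (x + h *: z) by apply: hd; rewrite gtr0_norm.
  have := gap Kx' Kh (t := t); rewrite (ltW t0) t1 => /(_ isT).
  have -> : (1 - t) *: x + t *: (x + h *: z) = x + (t * h) *: z.
    by apply/rowP => i; rewrite !mxE; ring.
  have -> : x + h *: z - x = h *: z by rewrite addrAC subrr add0r.
  rewrite formZ /dq.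
  have th0 : 0 < t * h by rewrite mulr_gt0.
  move: (u (x + (t * h) *: z)) (u (x + h *: z)) (u x) => ut uh ux /andP[g1 g2].
  apply/andP; split.
    rewrite ler_pdivlMr//.
    have -> : ((uh - ux) / h - b z * h / 2) * (t * h) = t * (uh - ux) - b z * h ^+ 2 / 2 * t.
      by field; rewrite gt_eqF.
    have : h ^+ 2 * b z / 2 * (t * (1 - t)) <= b z * h ^+ 2 / 2 * t.
      rewrite (mulrC (h ^+ 2)); apply: ler_wpM2l.
        by rewrite divr_ge0// mulr_ge0// sqr_ge0.
      by rewrite ler_piMr ?(ltW t0)//; lra.
    by lra.
  rewrite ler_pdivrMr//.
  have -> : (uh - ux) / h * (t * h) = t * (uh - ux) by field; rewrite gt_eqF.
  by lra.
(* The quotients decrease with [h], so their infimum [p] is the right derivative along [z]. *)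
pose E := [set dq h | h in [set h | 0 < h <= d]].
have E0 : E !=set0 by exists (dq d), d => //=; rewrite d0 lexx.
have dE h : 0 < h <= d -> dq d - b z * d / 2 <= dq h.
  move=> /andP[h0 hhd]; have := step d (h / d); rewrite d0 lexx => /(_ isT).
  rewrite divr_gt0// ler_pdivrMr// mul1r hhd => /(_ isT).
  by rewrite divfK ?gt_eqF// => /andP[].
have lE : has_lbound E.
  by exists (dq d - b z * d / 2) => _ [h /= hh <-]; exact: dE.
pose p := inf E; exists p, d; split => // h hh; split; first exact: hd.
have pos k : 0 < k <= d -> 0 <= dq k - p <= b z * k / 2.
  move=> hk; apply/andP; split.
    by rewrite subr_ge0; apply: ge_inf => //; exists k.
  suff : dq k - b z * k / 2 <= p by lra.
  apply: lb_le_inf => // _ [l /= /andP[l0 ld] <-].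
  have [lk|kl] := leP l k.
    have /andP[k0 kd] := hk; have := step k (l / k) hk.
    rewrite divr_gt0// ler_pdivrMr// mul1r lk => /(_ isT).
    by rewrite divfK ?gt_eqF// => /andP[].
  have /andP[k0 kd] := hk; have := step l (k / l); rewrite l0 ld => /(_ isT).
  rewrite divr_gt0// ler_pdivrMr// mul1r (ltW kl) => /(_ isT).
  rewrite divfK ?gt_eqF// => /andP[_ h1]; apply: le_trans h1.
  by rewrite lerBlDr lerDl !mulr_ge0// ltW.
have [->|hN0] := eqVneq h 0.
  by rewrite scale0r addr0 subrr mul0r subrr normr0 expr0n mulr0.
have [hp|hn] := ltP 0 h.
  have /pos : 0 < h <= d by rewrite hp -(gtr0_norm hp).
  have -> : u (x + h *: z) - u x - h * p = h * (dq h - p) by rewrite /dq; field.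
  move=> /andP[p1 p2]; rewrite normrM (gtr0_norm hp) (ger0_norm p1) expr2 mulrCA ler_pM2l//.
  by apply: le_trans p2 _; rewrite ler_pdivrMr// ler_peMr// ?mulr_ge0 ?(ltW hp)//; lra.
have {hn hN0} hn : h < 0 by rewrite lt_neqAle hN0.
have [k hk] : exists k, h = - k by exists (- h); rewrite opprK.
move: hh hn; rewrite {}hk => hh; rewrite oppr_lt0 => k0 {h}.
have kd : k <= d by rewrite -(gtr0_norm k0) -normrN.
have Kk : simplex K (x + k *: z) by apply: hd; rewrite gtr0_norm.
have Kmk : simplex K (x + - k *: z) by exact: hd.
(* For negative increments the expansion is transferred from the right by the midpoint inequality at
   [x], which also makes the left derivative equal to [p]. *)
have := gap Kmk Kk (t := 1 / 2).
move=> /(_ (half_unit_interval R)).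
have -> : (1 - 1 / 2) *: (x + - k *: z) + (1 / 2) *: (x + k *: z) = x.
  by apply/rowP => i; rewrite !mxE; field.
have -> : x + k *: z - (x + - k *: z) = (2 * k) *: z.
  by apply/rowP => i; rewrite !mxE; ring.
rewrite formZ.
have := pos k; rewrite k0 kd => /(_ isT).
have -> : dq k - p = (u (x + k *: z) - u x - k * p) / k.
  by rewrite /dq; field; rewrite gt_eqF.
rewrite ler_pdivlMr// ler_pdivrMr// mul0r => /andP[q1 q2] /andP[g1 g2].
rewrite ler_norml sqrrN mulNr opprK.
have e2 : b z * k / 2 * k = b z * k ^+ 2 / 2 by rewrite expr2; field.
have e3 : (2 * k) ^+ 2 * b z / 2 * (1 / 2 * (1 - 1 / 2)) = b z * k ^+ 2 / 2 by field.
move: q1 q2 g1 g2; rewrite e2 e3.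
have : 0 <= b z * k ^+ 2 by rewrite mulr_ge0// sqr_ge0.
move: (u (x + k *: z)) (u (x + - k *: z)) (u x) (k * p) (b z * k ^+ 2) => uk umk ux kp Q.
by move=> *; apply/andP; split; lra.
Qed.

Lemma expansion_derive (z : V) (p C d : R) : 0 < d ->
  (forall h, `|h| <= d -> `|u (x + h *: z) - u x - h * p| <= C * h ^+ 2) ->
  is_derive x z u p.
Proof.
move=> d0 H.
have lim : (fun h : R => h^-1 *: ((u \o shift x) (h *: z) - u x)) @ 0^' --> p.
  apply/cvgrPdist_le => e e0.
  have C1 : 0 < `|C| + 1 by rewrite ltr_wpDl.
  near=> h; have h0 : h != 0 by near: h; exact: nbhs_dnbhs_neq.
  have hd : `|h| <= d by near: h; exact: dnbhs0_le.
  have he : `|h| <= e / (`|C| + 1) by near: h; apply: dnbhs0_le; rewrite divr_gt0.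
  rewrite /= (addrC (h *: z)) distrC.
  have -> : h^-1 *: (u (x + h *: z) - u x) - p = (u (x + h *: z) - u x - h * p) / h.
    by rewrite /GRing.scale /=; field.
  have ah : 0 < `|h| by rewrite normr_gt0.
  rewrite normrM normfV ler_pdivrMr//; apply: le_trans (H h hd) _.
  rewrite -[h ^+ 2]real_normK ?num_real// expr2 mulrA ler_wpM2r//.
  move: he; rewrite ler_pdivlMr//; apply: le_trans.
  by rewrite mulrC ler_wpM2l// (le_trans (ler_norm _))// lerDl.
apply: DeriveDef; first by apply/cvg_ex; exists p.
exact: cvg_lim lim.
Unshelve. all: by end_near. Qed.

Lemma gap_derivable z : derivable u x z.
Proof.
have [p [d [d0 H]]] := directional_expansion z.
have h := @expansion_derive z p _ d d0 (fun h hh => (H h hh).2); exact: ex_derive.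
Qed.

Lemma gap_expansion z : exists2 d : R, 0 < d &
  forall h, `|h| <= d -> simplex K (x + h *: z) /\
    `|u (x + h *: z) - u x - h * 'D_z u x| <= b z * h ^+ 2.
Proof.
have [p [d [d0 H]]] := directional_expansion z.
have h := @expansion_derive z p _ d d0 (fun h hh => (H h hh).2).
by exists d => //; rewrite derive_val.
Qed.

Lemma gap_deriveZ c z : 'D_(c *: z) u x = c * 'D_z u x.
Proof.
have [d d0 H] := gap_expansion z; have [d' d'0 H'] := gap_expansion (c *: z).
have C1 : 0 < `|c| + 1 by rewrite ltr_wpDl.
pose e := Num.min d' (d / (`|c| + 1)).
have e0 : 0 < e by rewrite lt_min d'0 divr_gt0.
apply/eqP; rewrite -subr_eq0; apply/eqP.
apply: (@le_square_eq0 _ _ (b (c *: z) + b z * c ^+ 2) e) => // h /andP[h0 he].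
have h1 : `|h| <= d' by rewrite gtr0_norm// (le_trans he)// ge_min lexx.
have h2 : `|h * c| <= d.
  rewrite normrM (gtr0_norm h0) (@le_trans _ _ (h * (`|c| + 1)))//.
    by rewrite ler_pM2l// lerDl.
  by rewrite -ler_pdivlMr// (le_trans he)// ge_min lexx orbT.
have [_ ] := H' h h1; have [_] := H (h * c) h2; rewrite scalerA exprMn.
move: (u (x + (h * c) *: z)) (u x) => w v.
rewrite !ler_norml => /andP[? ?] /andP[? ?].
have -> : h * ('D_(c *: z) u x - c * 'D_z u x) = h * 'D_(c *: z) u x - h * c * 'D_z u x by ring.
by apply/andP; split; lra.
Qed.

(** Only directional derivatives are known at this stage, so their additivity needs an argument:
    [x + h *: (y + z)] is the midpoint of [x + h *: (2 *: y)] and [x + h *: (2 *: z)], and the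
    convexity gap there is of order [h ^+ 2]. *)
Lemma gap_deriveD y z : 'D_(y + z) u x = 'D_y u x + 'D_z u x.
Proof.
have [d d0 H] := gap_expansion (2 *: y); have [d' d'0 H'] := gap_expansion (2 *: z).
have [d1 d10 H1] := gap_expansion (y + z).
pose e := Num.min d (Num.min d' d1).
have e0 : 0 < e by rewrite !lt_min d0 d'0.
apply/eqP; rewrite -subr_eq0; apply/eqP.
(* The remainders of the three expansions plus the gap at [t = 1 / 2], where [t * (1 - t) / 2] is
   [1 / 8]. *)
pose C := b (2 *: y) / 2 + b (2 *: z) / 2 + b (y + z) + b (2 *: z - 2 *: y) / 8.
apply: (@le_square_eq0 _ _ C e) => // h /andP[h0 he].
have hd : `|h| <= d by rewrite gtr0_norm// (le_trans he)// ge_min lexx.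
have hd' : `|h| <= d' by rewrite gtr0_norm// (le_trans he)// !ge_min lexx orbT.
have hd1 : `|h| <= d1 by rewrite gtr0_norm// (le_trans he)// !ge_min lexx !orbT.
have [Ky Ey] := H h hd; have [Kz Ez] := H' h hd'; have [_ Eyz] := H1 h hd1.
move: Ey Ez Eyz; have := gap Ky Kz (t := 1 / 2).
move=> /(_ (half_unit_interval R)).
have -> : (1 - 1 / 2) *: (x + h *: (2 *: y)) + (1 / 2) *: (x + h *: (2 *: z)) = x + h *: (y + z).
  by apply/rowP => i; rewrite !mxE; field.
have -> : x + h *: (2 *: z) - (x + h *: (2 *: y)) = h *: (2 *: z - 2 *: y).
  by apply/rowP => i; rewrite !mxE; ring.
rewrite (formZ _ h) !gap_deriveZ.
move: (u (x + h *: (2 *: y))) (u (x + h *: (2 *: z))) (u (x + h *: (y + z))) (u x) => uy uz uw ux.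
rewrite !ler_norml => /andP[? ?] /andP[? ?] /andP[? ?] /andP[? ?].
have -> : h * ('D_(y + z) u x - ('D_y u x + 'D_z u x)) =
  h * 'D_(y + z) u x - h * (2 * 'D_y u x) / 2 - h * (2 * 'D_z u x) / 2 by field.
by rewrite /C; apply/andP; split; lra.
Qed.

Lemma gap_derive_gradient z : 'D_z u x = dotv (gradient u x) z.
Proof.
rewrite dotvE {1}(row_sum_delta z).
elim/big_rec2: _ => [|i a v _ <-].
  by have := gap_deriveZ 0 0; rewrite scale0r mul0r.
by rewrite gap_deriveD gap_deriveZ mxE mulrC.
Qed.

(** The gap inequality at parameter [h] is combined with the expansion at [x], divided by [h], and
    [h] tends to zero. *)
Lemma gap_gradient_bounds y : simplex K y ->
  0 <= u y - u x - dotv (gradient u x) (y - x) <= b (y - x) / 2.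
Proof.
move=> Ky; rewrite -gap_derive_gradient; pose z := y - x.
have [d d0 H] := gap_expansion z.
pose e := Num.min d 1; have e0 : 0 < e by rewrite lt_min d0 ltr01.
have Kx' : simplex K x by exact: open_simplexW.
have b0 : 0 <= b z by case: pB.
have key h : 0 < h <= e -> - (b z * h) <= u y - u x - 'D_z u x <= b z / 2 + b z * h.
  move=> /andP[h0 he].
  have hd : `|h| <= d by rewrite gtr0_norm// (le_trans he)// ge_min lexx.
  have h1 : h <= 1 by rewrite (le_trans he)// ge_min lexx orbT.
  have := gap Kx' Ky (t := h); rewrite (ltW h0) h1 => /(_ isT).
  have -> : (1 - h) *: x + h *: y = x + h *: z.
    by rewrite /z; apply/rowP => i; rewrite !mxE; ring.
  have [_] := H h hd; rewrite -/z.
  move: (u (x + h *: z)) (u x) (u y) => uh ux uy.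
  rewrite ler_norml => /andP[c1 c2] /andP[g1 g2].
  have g3 : b z / 2 * (h * (1 - h)) <= b z / 2 * h.
    by rewrite ler_wpM2l ?divr_ge0// ler_piMr ?(ltW h0)//; lra.
  apply/andP; split; rewrite -(ler_pM2l h0).
    have -> : h * - (b z * h) = - (b z * h ^+ 2) by ring.
    by lra.
  have -> : h * (b z / 2 + b z * h) = b z / 2 * h + b z * h ^+ 2 by ring.
  by lra.
apply/andP; split.
  apply: (@le_of_le_add_linear _ _ _ (b z) e) => // h /key/andP[k1 _].
  by rewrite -/z; lra.
apply: (@le_of_le_add_linear _ _ _ (b z) e) => // h /key/andP[_ k2].
by rewrite -/z; lra.
Qed.

End gap_at_interior_point.
End convexity_gap.

(** * Interpolation error and Lipschitz bound on one element *)

Section element_estimates.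
Context {R : realType} {n : nat}.
Local Notation V := 'rV[R]_n.
Implicit Types (K : 'I_n.+1 -> V) (u : V -> R) (A B : 'M[R]_n).

Lemma form_jensen A m (l : 'I_m -> R) (z : 'I_m -> V) : psdmx A ->
  (forall j, 0 <= l j) -> \sum_j l j = 1 ->
  dotv ((\sum_j l j *: z j) *m A) (\sum_j l j *: z j) <=
  \sum_j l j * dotv (z j *m A) (z j).
Proof.
move=> [sA pA] l0 l1; set w := \sum_j l j *: z j.
have : 0 <= \sum_j l j * dotv ((z j - w) *m A) (z j - w).
  by apply: sumr_ge0 => j _; rewrite mulr_ge0.
have E j : l j * dotv ((z j - w) *m A) (z j - w) =
    l j * dotv (z j *m A) (z j) + (l j * dotv (w *m A) w - 2 * dotv (w *m A) (l j *: z j)).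
  by rewrite mulmxBl !(dotvBl, dotvBr) (sym_dotvC (z j) w)// dotvZr; ring.
under eq_bigr do rewrite E.
rewrite big_split sumrB /= -mulr_suml l1 mul1r -mulr_sumr -dotv_sumr -/w.
by lra.
Qed.

Lemma form_subr_le A x y : psdmx A ->
  dotv ((x - y) *m A) (x - y) <= 2 * (dotv (x *m A) x + dotv (y *m A) y).
Proof.
move=> [sA pA]; have := pA (x + y).
rewrite !(mulmxBl, mulmxDl, dotvBl, dotvBr, dotvDl, dotvDr) (sym_dotvC y x)//.
by lra.
Qed.

Lemma edge_form_le K A i : psdmx A ->
  dotv ((K i - K ord0) *m A) (K i - K ord0) <= \tr (edge_mx K *m A *m (edge_mx K)^T).
Proof.
move=> pA; have pS : psdmx (edge_mx K *m A *m (edge_mx K)^T).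
  case: pA => sA pA; split; first by rewrite !trmx_mul trmxK sA mulmxA.
  by move=> x; rewrite !mulmxA dotv_mulmx trmxK.
case: (unliftP ord0 i) => [j ->|->]; last by rewrite subrr mul0mx dotv0l psd_tr_ge0.
apply: le_trans (psd_diag_le_tr j pS).
rewrite le_eqVlt; apply/orP; left; apply/eqP; rewrite -[RHS]dotv_delta_mx.
by rewrite !mulmxA [RHS]dotv_mulmx trmxK -rowE rowK.
Qed.

(** [K i - x] is a convex combination of the [K i - K k]. Each of these is a difference of two edges
    at the first vertex, and [form_subr_le] turns twice the two edge forms into the factor 4. *)
Lemma vertex_form_le K A x i : nondegenerate_simplex K -> psdmx A -> simplex K x ->
  dotv ((K i - x) *m A) (K i - x) <= 4 * \tr (edge_mx K *m A *m (edge_mx K)^T).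
Proof.
move=> uK pA /(simplexP _ uK) Kx.
have -> : K i - x = \sum_k bary K k x *: (K i - K k).
  under eq_bigr do rewrite scalerBr.
  by rewrite sumrB -scaler_suml bary_sum scale1r bary_combine.
apply: le_trans (form_jensen _ pA Kx (bary_sum K x)) _.
set Q := 4 * _; rewrite -[leRHS]mul1r -(bary_sum K x) mulr_suml /Q.
apply: ler_sum => k _.
rewrite ler_wpM2l//.
have -> : K i - K k = (K i - K ord0) - (K k - K ord0) by rewrite opprB addrA subrK.
apply: le_trans (form_subr_le _ _ pA) _.
by have := edge_form_le K i pA; have := edge_form_le K k pA; lra.
Qed.

(* On the element, the gradient of the interpolation error is controlled through
   its products with the edges: [g E^T] is small, and [g = (z E) A] where
   [z = (g E^T) (E A E^T)^-1]. *)
Lemma interp_gradient_error K u A c x : nondegenerate_simplex K -> pdmx A -> 0 <= c ->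
  convexity_gap (simplex K) u (c *: A) -> open_simplex K x ->
  dotv (gradient u x - interp_grad K u) (gradient u x - interp_grad K u) *
    \det (edge_mx K *m A *m (edge_mx K)^T) <=
  4 * n%:R ^+ 3 * spectral_norm A * c ^+ 2 *
    (\tr (edge_mx K *m A *m (edge_mx K)^T)) ^+ n.+1.
Proof.
move=> uK pA c0 gap Kx; set g := gradient u x - _.
set S := edge_mx K *m A *m (edge_mx K)^T.
have [n0|n0] := posnP n.
  have -> : g = 0 by apply/rowP => i; exfalso; move: (nat_of_ord i) (ltn_ord i) => k; rewrite n0.
  rewrite dotv0l mul0r !mulr_ge0 ?exprn_ge0 ?spectral_norm_ge0//.
  by apply: psd_tr_ge0; apply: pdmx_psd; exact: pdmx_congr.
have pB : psdmx (c *: A) by exact: psdmxZ (pdmx_psd pA).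
have pS : pdmx S by exact: pdmx_congr.
have t0 : 0 <= \tr S by exact/psd_tr_ge0/pdmx_psd.
have Kx' : simplex K x by exact: open_simplexW.
have vb i : dotv ((K i - x) *m (c *: A)) (K i - x) <= 4 * (c * \tr S).
  by rewrite formM_scale mulrCA ler_wpM2l// vertex_form_le//; exact: pdmx_psd.
pose y := g *m (edge_mx K)^T.
(* On an edge the interpolant matches [u] at both ends, so [y 0 j] is a difference of two Taylor
   remainders, each between 0 and half of [4 * (c * \tr S)]. *)
have yb j : `|y 0 j| <= 2 * (c * \tr S).
  have -> : y 0 j = dotv g (K (lift ord0 j) - K ord0).
    rewrite /y mxE dotvE; apply: eq_bigr => k _; congr (_ * _).
    by rewrite mxE /edge_mx mxE.
  have -> : dotv g (K (lift ord0 j) - K ord0) =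
      (u (K ord0) - u x - dotv (gradient u x) (K ord0 - x)) -
      (u (K (lift ord0 j)) - u x - dotv (gradient u x) (K (lift ord0 j) - x)).
    rewrite /g dotvBl interp_grad_edge// !dotvBr; ring.
  have /andP[a1 a2] := gap_gradient_bounds uK pB gap Kx (vertex_simplex ord0 uK).
  have /andP[b1 b2] := gap_gradient_bounds uK pB gap Kx (vertex_simplex (lift ord0 j) uK).
  have := vb ord0; have := vb (lift ord0 j).
  by move: a1 a2 b1 b2; rewrite ler_norml => *; apply/andP; split; lra.
have yy : dotv y y <= n%:R * (2 * (c * \tr S)) ^+ 2.
  rewrite dotvE mulr_natl -[X in _ *+ X](card_ord n) -sumr_const; apply: ler_sum => j _.
  rewrite -expr2 -[y 0 j ^+ 2]real_normK ?num_real// lerXn2r ?nnegrE//.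
  by rewrite mulr_ge0// mulr_ge0.
pose z := y *m invmx S.
have zS : z *m S = y by rewrite /z mulmxKV// pdmx_unit.
have uE : (edge_mx K)^T \in unitmx by rewrite unitmx_tr.
have gE : g = z *m edge_mx K *m A.
  apply: (can_inj (mulmxK uE)); rewrite -/y -zS /S.
  by rewrite !mulmxA.
have gg : dotv g g <= spectral_norm A * dotv (z *m S) z.
  rewrite {1 2}gE; apply: le_trans (psd_image_le_spectral _ (pdmx_psd pA)) _.
  by rewrite (_ : dotv (z *m S) z = dotv (z *m edge_mx K *m A) (z *m edge_mx K))//
    /S !mulmxA dotv_mulmx trmxK.
have d0 := pd_det_gt0 pS.
have sp := spectral_norm_ge0 A.
apply: (@le_trans _ _ (spectral_norm A * (\det S * dotv (z *m S) z))).
  by rewrite mulrC mulrCA ler_wpM2l// ltW.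
have := pd_inverse_form_le z pS; rewrite zS => h.
apply: (@le_trans _ _ (spectral_norm A * (n%:R ^+ 2 * \tr S ^+ n.-1 *
  (n%:R * (2 * (c * \tr S)) ^+ 2)))).
  rewrite ler_wpM2l// (le_trans h)// ler_wpM2l// mulr_ge0// exprn_ge0//.
rewrite le_eqVlt; apply/orP; left; apply/eqP.
(* The squared edge bound and the adjugate account for the two factors; [n0] is needed for the
   exponents to add up. *)
have -> : \tr S ^+ n.+1 = \tr S ^+ 2 * \tr S ^+ n.-1.
  by rewrite -exprD add2n; congr (_ ^+ _); case: (n) n0.
by move: (\tr S) (\tr S ^+ _) => t tn; ring.
Qed.

Lemma coord_le_norm (x : V) i : `|x 0 i| <= `|x|.
Proof.
have /mapP[j Hj e] : `|x 0 i| \in [seq `|x k.1 k.2| | k : 'I_1 * 'I_n].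
  by apply/mapP; exists (ord0, i) => //=; rewrite mem_enum.
by rewrite e; have -> : `|x| = mx_norm x by []; rewrite mx_normrE; apply/bigmax_geP; right => /=; exists j.
Qed.

Lemma dotv_le_norm (a z : V) : `|dotv a z| <= (\sum_i `|a 0 i|) * `|z|.
Proof.
rewrite dotvE; apply: le_trans (ler_norm_sum _ _ _) _; rewrite mulr_suml.
by apply: ler_sum => i _; rewrite normrM ler_wpM2l// coord_le_norm.
Qed.

Lemma form_le_norm A : psdmx A -> exists2 C : R, 0 <= C &
  forall z : V, dotv (z *m A) z <= C * `|z| ^+ 2.
Proof.
move=> pA; have t0 := psd_tr_ge0 pA; exists (n%:R * \tr A * n%:R) => [|z].
  by rewrite mulr_ge0// mulr_ge0.
apply: le_trans (psd_form_le_tr z pA) _; rewrite -[leRHS]mulrA ler_wpM2l ?mulr_ge0//.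
rewrite dotvE mulr_natl -[X in _ *+ X](card_ord n) -sumr_const; apply: ler_sum => i _.
by rewrite -expr2 -[z 0 i ^+ 2]real_normK ?num_real// lerXn2r ?nnegrE// coord_le_norm.
Qed.

Lemma simplex_norm_le K x : nondegenerate_simplex K -> simplex K x ->
  `|x| <= \sum_i `|K i|.
Proof.
move=> uK Kx; rewrite -{1}(bary_combine x uK); apply: le_trans (ler_norm_sum _ _ _) _.
apply: ler_sum => i _; rewrite normrZ.
have := bary_le1 i uK Kx; move/(simplexP _ uK) : Kx => /(_ i) h0 h1.
by rewrite ger0_norm// ler_piMl.
Qed.

Lemma gap_gradient_bounded K u A c : nondegenerate_simplex K -> pdmx A -> 0 <= c ->
  convexity_gap (simplex K) u (c *: A) -> exists2 M : R, 0 <= M &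
  forall x, open_simplex K x -> forall i, `|gradient u x 0 i| <= M.
Proof.
move=> uK pA c0 gap.
pose S := edge_mx K *m A *m (edge_mx K)^T.
have pS : pdmx S by exact: pdmx_congr.
have d0 := pd_det_gt0 pS.
pose D := 4 * n%:R ^+ 3 * spectral_norm A * c ^+ 2 * (\tr S) ^+ n.+1 / \det S.
have D0 : 0 <= D.
  rewrite divr_ge0 ?(ltW d0)// !mulr_ge0 ?exprn_ge0 ?spectral_norm_ge0//.
  by apply: psd_tr_ge0; exact: pdmx_psd.
(* [D] bounds the square of a coordinate, and [D + 1] then bounds the coordinate without a square
   root. *)
exists (D + 1 + \sum_i `|interp_grad K u 0 i|).
  by rewrite addr_ge0 ?addr_ge0// sumr_ge0.
move=> x Kx i.
have := interp_gradient_error uK pA c0 gap Kx; rewrite /= -/S -ler_pdivlMr// -/D.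
set g := gradient u x - _ => gD.
have -> : gradient u x 0 i = g 0 i + interp_grad K u 0 i by rewrite /g !mxE subrK.
apply: le_trans (ler_normD _ _) _; apply: lerD; last first.
  by rewrite (bigD1 i)//= lerDl sumr_ge0.
have : `|g 0 i| ^+ 2 <= D.
  by rewrite real_normK ?num_real// (le_trans (coord_sqr_le_dotvv g i)).
have : 0 <= `|g 0 i| by [].
by move: (`|g 0 i|) D0 => r D0 r0 rD; rewrite leNgt; apply/negP => ?; nra.
Qed.

(** Gradients are available in the open simplex only. A starting point on the boundary is moved
    towards the barycenter by [s]; the gap inequality itself shows that [u] increases by at most a
    multiple of [s], or decreases by at most that much. *)
Lemma gap_lipschitz K u A c : nondegenerate_simplex K -> pdmx A -> 0 <= c ->
  convexity_gap (simplex K) u (c *: A) -> exists2 L : R, 0 <= L &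
  forall x y, simplex K x -> simplex K y -> `|u y - u x| <= L * `|y - x|.
Proof.
move=> uK pA c0 gap.
have pB : psdmx (c *: A) by exact: psdmxZ (pdmx_psd pA).
have [M M0 hM] := gap_gradient_bounded uK pA c0 gap.
have [C C0 hC] := form_le_norm pB.
pose D := (\sum_i `|K i|) + \sum_i `|K i|.
have D0 : 0 <= D by rewrite addr_ge0// sumr_ge0.
have diam x y : simplex K x -> simplex K y -> `|y - x| <= D.
  by move=> Kx Ky; apply: le_trans (ler_normB _ _) _; apply: lerD; exact: simplex_norm_le.
have fb x y : simplex K x -> simplex K y ->
    dotv ((y - x) *m (c *: A)) (y - x) / 2 <= C * D * `|y - x|.
  move=> Kx Ky; rewrite ler_pdivrMr//; apply: le_trans (hC _) _.
  rewrite expr2 -!mulrA ler_wpM2l// mulrA.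
  have := diam _ _ Kx Ky; move: (`|y - x|) (normr_ge0 (y - x)) => r r0 rD.
  by nra.
pose L := n%:R * M + C * D.
have L0 : 0 <= L by rewrite addr_ge0 ?mulr_ge0.
have half x y : open_simplex K x -> simplex K y -> `|u y - u x| <= L * `|y - x|.
  move=> Kx Ky; have Kx' : simplex K x by exact: open_simplexW.
  have /andP[g1 g2] := gap_gradient_bounds uK pB gap Kx Ky.
  have := fb _ _ Kx' Ky; have : `|dotv (gradient u x) (y - x)| <= n%:R * M * `|y - x|.
    apply: le_trans (dotv_le_norm _ _) _; rewrite ler_wpM2r//.
    rewrite mulr_natl -[X in _ *+ X](card_ord n) -sumr_const; apply: ler_sum => i _.
    exact: hM.
  rewrite /L mulrDl ler_norml => /andP[g3 g4] g5.
  have : 0 <= C * D * `|y - x| by rewrite !mulr_ge0.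
  by rewrite ler_norml => g6; apply/andP; split; lra.
exists L => // x y Kx Ky.
pose ce := barycenter K.
have Kc : simplex K ce.
  have := open_simplex_towards_center uK Kx (t := 1); rewrite ltr01 lexx => /(_ isT).
  by rewrite subrr scale0r add0r scale1r; exact: open_simplexW.
pose Q := dotv ((ce - x) *m (c *: A)) (ce - x) / 2.
have Q0 : 0 <= Q by rewrite divr_ge0//; case: pB.
apply: (@le_of_le_add_linear _ _ _ (L * `|ce - x| + `|u ce - u x| + Q) 1) => // s /andP[s0 s1].
pose xs := (1 - s) *: x + s *: ce.
have Kxs : open_simplex K xs by apply: open_simplex_towards_center => //; rewrite s0.
have := half xs y Kxs Ky.
have xsE : y - xs = (y - x) - s *: (ce - x).
  by rewrite /xs; apply/rowP => i; rewrite !mxE; ring.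
have h1 : L * `|y - xs| <= L * `|y - x| + L * `|ce - x| * s.
  rewrite -mulrA -mulrDr ler_wpM2l// xsE; apply: le_trans (ler_normB _ _) _.
  by rewrite lerD2l normrZ (gtr0_norm s0) mulrC.
have := gap x ce s Kx Kc; rewrite (ltW s0) s1 => /(_ isT).
rewrite -/xs -/Q => /andP[g1 g2] hh.
have g3 : Q * (s * (1 - s)) <= Q * s.
  by rewrite ler_wpM2l// ler_piMr ?(ltW s0)//; lra.
have h2 : `|u xs - u x| <= (`|u ce - u x| + Q) * s.
  have -> : u xs - u x = s * (u ce - u x) - ((1 - s) * u x + s * u ce - u xs) by ring.
  apply: le_trans (ler_normB _ _) _; rewrite normrM (gtr0_norm s0) [leRHS]mulrDl; apply: lerD.
    by rewrite mulrC.
  by rewrite ger0_norm// (le_trans g2).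
have -> : u y - u x = (u y - u xs) + (u xs - u x) by ring.
apply: le_trans (ler_normD _ _) _.
by move: hh h1 h2; rewrite !mulrDl; lra.
Qed.

End element_estimates.

(** Continuation: the set of parameters up to which the estimate holds has a supremum, and the local
    estimate at this supremum first includes it and then passes beyond it. *)
Lemma lipschitz_of_local (R : realType) (f : R -> R) (L t : R) : 0 <= t ->
  (forall s, 0 <= s <= t -> \forall r \near s, 0 <= r <= t ->
     `|f r - f s| <= L * `|r - s|) ->
  `|f t - f 0| <= L * t.
Proof.
move=> t0 hf.
pose S := [set s : R | 0 <= s <= t /\ forall r, 0 <= r <= s -> `|f r - f 0| <= L * r].
have S0 : S 0.
  split=> [|r]; first by rewrite lexx t0.
  by move=> /le_anti <-; rewrite subrr normr0 mulr0.
have ubS : ubound S t by move=> s [/andP[]].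
have hS : has_sup S by split; [exists 0|exists t].
set m := sup S.
have m0 : 0 <= m by exact: sup_upper_bound.
have mt : m <= t by apply: ge_sup => //; exists 0.
have below q : 0 <= q < m -> `|f q - f 0| <= L * q.
  move=> /andP[q0 qm]; have [s [_ hs] qs] := sup_gt (ex_intro _ 0 S0) qm.
  by apply: hs; rewrite q0 ltW.
have : \forall r \near m, 0 <= r <= t -> `|f r - f m| <= L * `|r - m|.
  by apply: hf; rewrite m0 mt.
move=> /nbhs_ballP[e /= e0 he].
have near_m r : `|m - r| < e -> 0 <= r <= t -> `|f r - f m| <= L * `|r - m|.
  by move=> h; apply: he.
have at_m : `|f m - f 0| <= L * m.
  have [s Ss sm] := sup_adherent e0 hS; rewrite -/m in sm.
  have sm' : s <= m by exact: sup_upper_bound.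
  case: Ss => /andP[s0 st] /(_ s); rewrite s0 lexx => /(_ isT) h1.
  have := near_m s; rewrite ger0_norm ?subr_ge0// s0 st => /(_ _ isT).
  rewrite distrC (distrC s) (ger0_norm (_ : 0 <= m - s)) ?subr_ge0// => h2.
  have {}h2 : `|f m - f s| <= L * (m - s) by apply: h2; lra.
  have -> : f m - f 0 = (f m - f s) + (f s - f 0) by ring.
  by apply: le_trans (ler_normD _ _) _; lra.
have above q : 0 <= q <= t -> q < m + e -> `|f q - f 0| <= L * q.
  move=> /andP[q0 qt] qm; have [lt|gt|->//] := ltgtP q m; first by apply: below; rewrite q0.
  have := near_m q; rewrite distrC (ger0_norm (_ : 0 <= q - m)) ?subr_ge0 ?(ltW gt)//.
  rewrite q0 qt => /(_ _ isT) h2; have {}h2 : `|f q - f m| <= L * (q - m) by apply: h2; lra.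
  have -> : f q - f 0 = (f q - f m) + (f m - f 0) by ring.
  by apply: le_trans (ler_normD _ _) _; lra.
apply: (above t); first by rewrite t0 lexx.
rewrite ltNge; apply/negP => mt'.
have : S (m + e / 2).
  split=> [|r /andP[r0 rm]]; first by apply/andP; split; lra.
  by apply: above; [apply/andP; split => //; lra|lra].
by move=> /(sup_upper_bound hS); rewrite -/m; lra.
Qed.

(** * The weak gradient of a piecewise Lipschitz function *)

Section step_functions.
Context d (T : measurableType d) (R : realType) (mu : {measure set T -> \bar R}).

(* Neither function needs to be measurable: the integral is a supremum over
   simple functions below. *)
Lemma ge0_le_integral_sup (D : set T) (f g : T -> \bar R) :
  (forall x, D x -> 0 <= f x)%E -> (forall x, D x -> f x <= g x)%E ->
  (\int[mu]_(x in D) f x <= \int[mu]_(x in D) g x)%E.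
Proof.
move=> f0 fg; rewrite !ge0_integralE//; last first.
  by move=> x Dx; apply: le_trans (f0 x Dx) (fg x Dx).
apply: le_ereal_sup => _ [h hf <-]; exists h => // x.
apply: le_trans (hf x) _; rewrite !patchE; case: ifPn => // /set_mem; exact: fg.
Qed.

Definition step N (c : 'I_N -> R) (A : 'I_N -> set T) (x : T) : R :=
  \sum_e c e * \1_(A e) x.

Lemma step_ge0 N (c : 'I_N -> R) (A : 'I_N -> set T) x : (forall e, 0 <= c e) ->
  0 <= step c A x.
Proof. by move=> c0; apply: sumr_ge0 => e _; rewrite mulr_ge0. Qed.

Lemma step_cell N (c : 'I_N -> R) (A : 'I_N -> set T) e x :
  (forall e', A e' x -> e' = e) -> A e x -> step c A x = c e.
Proof.
move=> uA Ax; rewrite /step (bigD1 e)//= big1 => [|e' e'e]; last first.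
  rewrite indicE memNset ?mulr0// => /uA E; by rewrite E eqxx in e'e.
by rewrite indicE mem_set// mulr1 addr0.
Qed.

Lemma step_out N (c : 'I_N -> R) (A : 'I_N -> set T) x :
  (forall e, ~ A e x) -> step c A x = 0.
Proof. by move=> nA; rewrite /step big1// => e _; rewrite indicE memNset ?mulr0. Qed.

Lemma integral_step (D : set T) N (c : 'I_N -> R) (A : 'I_N -> set T) : measurable D ->
  (forall e, 0 <= c e) -> (forall e, measurable (A e)) -> (forall e, A e `<=` D) ->
  (\int[mu]_(x in D) (step c A x)%:E = \sum_e (c e)%:E * mu (A e))%E.
Proof.
move=> mD c0 mA AD; under eq_integral do rewrite /step -sumEFin.
rewrite ge0_integral_sum//.
- apply: eq_bigr => e _; under eq_integral do rewrite EFinM.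
  rewrite ge0_integralZl_EFin//.
  + by rewrite integral_indic// (setIidl (AD e)).
  + by apply/measurable_EFinP; exact: measurable_indic.
- by move=> e; apply/measurable_EFinP; apply: measurable_funM => //; exact: measurable_indic.
- by move=> e x _; rewrite lee_fin mulr_ge0.
Qed.
End step_functions.

Section open_sets.
Context {R : realType} {n : nat}.
Local Notation V := 'rV[R]_n.
Local Notation mu := (@lebesgue_rV R n).

Lemma compact_inner_radius (K Omega : set V) : compact K -> open Omega -> K `<=` Omega ->
  exists2 d : R, 0 < d & forall x y, K x -> `|y| < d -> Omega (x + y).
Proof.
move=> /compact_near_coveringP cK oO KO.
have : \forall y \near (0 : V), K `<=` (fun x => Omega (x + y)).
  apply: (cK V (nbhs (0 : V)) (fun y x => Omega (x + y))) => x Kx.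
  have Ox : nbhs (x + 0) Omega.
    by rewrite addr0; exact: open_nbhs_nbhs (conj oO (KO _ Kx)).
  have : (fun p : V * V => p.1 + p.2) @ (nbhs x, nbhs (0 : V)) --> x + 0.
    by apply: cvgD; [exact: cvg_fst|exact: cvg_snd].
  by move=> /(_ _ Ox).
move=> /nbhs_ballP[d /= d0 hd]; exists d => // x y Kx yd.
by apply: (hd y) => //; rewrite -ball_normE /= sub0r normrN.
Qed.

Lemma measurable_fun_open (Omega : set V) (w : V -> R) : open Omega ->
  (forall x, Omega x -> w y @[y --> x] --> w x) ->
  measurable_fun Omega (w : V -> measurableTypeR R).
Proof.
move=> oO cw; apply: (measurability _ (RGenOpens.measurableE R)).
move=> _ [B [a [b ->]] <-]; apply: open_rV_measurable.
rewrite openE => x [Ox wx]; apply: filterI.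
  exact: open_nbhs_nbhs (conj oO Ox).
apply: (cw x Ox); apply: open_nbhs_nbhs; split => //; exact: interval_open.
Qed.

Lemma bounded_L2 (Omega : set V) (w : V -> R) (M : R) : measurable Omega ->
  (mu Omega < +oo)%E -> measurable_fun Omega (w : V -> measurableTypeR R) ->
  (forall x, Omega x -> `|w x| <= M) -> L2 Omega w.
Proof.
move=> mO fO mw wM; split => //.
apply: (@measurable_bounded_integrable _ _ _ mu (fun x => w x ^+ 2) _ mO) => //.
  exact: measurable_funX.
exists (M ^+ 2); split; first exact: num_real.
move=> y My x Ox /=; apply: le_trans (ltW My).
by rewrite normrX lerXn2r ?nnegrE//; [exact: le_trans (wM x Ox)|exact: wM].
Qed.
End open_sets.

Section piecewise_lipschitz.
Context {R : realType} {n : nat}.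
Local Notation V := 'rV[R]_n.
Local Notation mu := (@lebesgue_rV R n).
Variables (Omega : set V) (N : nat) (T : 'I_N -> 'I_n.+1 -> V).
Hypotheses (n0 : (0 < n)%N) (pO : polyhedral_domain Omega) (mT : simplicial_mesh Omega T).
Variables (w : V -> R) (L : R).
Hypotheses (L0 : 0 <= L)
  (lipw : forall e x y, simplex (T e) x -> simplex (T e) y -> `|w y - w x| <= L * `|y - x|).

Let oO : open Omega. Proof. by case: pO. Qed.

Let mO : measurable Omega. Proof. exact: measurable_domain. Qed.

Let fO : (mu Omega < +oo)%E. Proof. exact: domain_measure_fin mT. Qed.

Let uT e : nondegenerate_simplex (T e). Proof. exact: (mesh_nondegenerate mT). Qed.

Lemma piecewise_lipschitz_near x :
  \forall y \near x, closure Omega y -> `|w y - w x| <= L * `|y - x|.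
Proof.
have := mesh_near mT x; apply: filterS => y hK Oy.
by have [e Ky] := mesh_cover mT Oy; apply: (@lipw e) => //; exact: hK.
Qed.

(** [Omega] need not be convex, so the Lipschitz constant of the elements is propagated only along
    segments inside it, from element to element. *)
Lemma piecewise_lipschitz_segment x z (t : R) : 0 <= t ->
  (forall s, 0 <= s <= t -> Omega (x + s *: z)) ->
  `|w (x + t *: z) - w x| <= L * `|z| * t.
Proof.
move=> t0 seg; have := @lipschitz_of_local R (fun s => w (x + s *: z)) (L * `|z|) t t0.
rewrite scale0r addr0; apply=> s st.
have cl : x + r *: z @[r --> s] --> x + s *: z.
  by apply: cvgD; [exact: cvg_cst|apply: cvgZr_tmp; exact: cvg_id].
have : \forall r \near s, closure Omega (x + r *: z) ->
    `|w (x + r *: z) - w (x + s *: z)| <= L * `|x + r *: z - (x + s *: z)|.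
  exact: cl _ (piecewise_lipschitz_near (x + s *: z)).
apply: filterS => r /= h rt; apply: le_trans (h _) _.
  by apply: subset_closure; exact: seg.
by rewrite opprD addrACA subrr add0r -scalerBl normrZ -mulrA (mulrC `|z|).
Qed.

Lemma piecewise_lipschitz_continuous x : Omega x -> w y @[y --> x] --> w x.
Proof.
move=> Ox; apply/(@cvgrPdist_lt _ _ _ (nbhs x)) => /= e e0.
have nO : \forall y \near x, Omega y by exact: open_nbhs_nbhs (conj oO Ox).
have nb : \forall y \near x, `|x - y| < e / (L + 1).
  apply/nbhs_ballP; exists (e / (L + 1)) => /=; first by rewrite divr_gt0// ltr_pwDr.
  by move=> y; rewrite -ball_normE.
have := piecewise_lipschitz_near x; apply: filterS3 nO nb => y Oy xy h.
rewrite distrC; apply: le_lt_trans (h (subset_closure Oy)) _; rewrite distrC.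
apply: (@le_lt_trans _ _ ((L + 1) * `|x - y|)); first by rewrite ler_wpM2r// lerDl.
by rewrite mulrC -ltr_pdivlMr// ltr_pwDr.
Qed.

Lemma piecewise_lipschitz_measurable : measurable_fun Omega (w : V -> measurableTypeR R).
Proof. exact: measurable_fun_open piecewise_lipschitz_continuous. Qed.

Lemma piecewise_lipschitz_bounded : exists2 M : R, 0 <= M &
  forall x, Omega x -> `|w x| <= M.
Proof.
pose B e := `|w (T e ord0)| + L * (\sum_i `|T e i| + \sum_i `|T e i|).
have B0 e : 0 <= B e by rewrite addr_ge0// mulr_ge0// addr_ge0// sumr_ge0.
exists (\sum_e B e) => [|x Ox]; first by rewrite sumr_ge0.
have [e Kx] := mesh_cover mT (subset_closure Ox).
apply: (@le_trans _ _ (B e)); last by rewrite (bigD1 e)//= lerDl sumr_ge0.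
rewrite -(subrK (w (T e ord0)) (w x)) addrC; apply: le_trans (ler_normD _ _) _.
rewrite lerD2l; have K0 := vertex_simplex ord0 (uT e).
apply: le_trans (lipw K0 Kx) _; rewrite ler_wpM2l//.
by apply: le_trans (ler_normB _ _) _; apply: lerD; apply: simplex_norm_le (uT e) _.
Qed.

Lemma piecewise_lipschitz_L2 : L2 Omega w.
Proof.
have [M _ hM] := piecewise_lipschitz_bounded.
exact: bounded_L2 piecewise_lipschitz_measurable hM.
Qed.

Definition mesh_interior : set V := \bigcup_(e in [set: 'I_N]) open_simplex (T e).

Lemma mesh_interior_sub : mesh_interior `<=` Omega.
Proof. by move=> x [e _]; exact: open_simplex_sub. Qed.

Lemma measurable_mesh_interior : measurable mesh_interior.
Proof.
apply: open_rV_measurable; apply: bigcup_open => e _; exact: open_open_simplex.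
Qed.

Lemma ae_mesh_interior_domain : {ae mu, forall x, Omega x -> mesh_interior x}.
Proof.
have := ae_mesh_interior n0 mT; apply: filterS => x h Ox.
by have [e Kx] := mesh_cover mT (subset_closure Ox); exists e => //; exact: h.
Qed.

Hypothesis derw : forall e x i, open_simplex (T e) x -> derivable w x (delta_mx 0 i).

(** The value 0 on the null set of faces makes the bound [L] hold everywhere. *)
Definition piecewise_gradient : V -> V :=
  fun x => if `[< mesh_interior x >] then gradient w x else 0.

Let z i : V := delta_mx 0 i.

Let zE i j : z i 0 j = (j == i)%:R. Proof. by rewrite /z mxE eqxx. Qed.

Let zN i : `|z i| <= 1.
Proof.
have -> : `|z i| = mx_norm (z i) by []; rewrite mx_normrE.
apply: bigmax_le => // -[a b] _ /=; rewrite mxE.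
by case: eqP; case: eqP => *; rewrite /= ?normr1 ?normr0.
Qed.

Let cvg_dnbhs0 (t : R^nat) : (forall m, 0 < t m) -> t @ \oo --> (0 : R) ->
  t @ \oo --> (0 : R)^'.
Proof.
move=> t0 tc P hP.
have : \forall m \near \oo, t m != 0 -> P (t m) by exact: (tc _ hP).
by apply: filterS => m; apply; rewrite gt_eqF.
Qed.

Let quotient_cvg (t : R^nat) i x : (forall m, 0 < t m) -> t @ \oo --> (0 : R) ->
  mesh_interior x ->
  (t m)^-1 * ((w \_ Omega) (x + t m *: z i) - (w \_ Omega) x) @[m --> \oo] -->
  partial_derivative i w x.
Proof.
move=> t0 tc Ux; have Ox := mesh_interior_sub Ux.
have dw : derivable w x (z i) by case: Ux => e _; exact: derw.
have dc : h^-1 *: (w (h *: z i + x) - w x) @[h --> (0 : R)^'] --> partial_derivative i w x.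
  exact: dw.
have tc' : t @ \oo --> (0 : R)^'.
  exact: cvg_dnbhs0.
have := cvg_comp _ _ tc' dc.
apply: cvg_trans; apply: near_eq_cvg.
have nO : \forall y \near x, Omega y by exact: open_nbhs_nbhs (conj oO Ox).
have cl : x + t m *: z i @[m --> \oo] --> x.
  rewrite -[X in _ --> X]addr0 -(scale0r (z i)).
  by apply: cvgD; [exact: cvg_cst|apply: cvgZr_tmp].
have : \forall m \near \oo, Omega (x + t m *: z i) by exact: cl _ nO.
apply: filterS => m /= Om.
by rewrite !patchE (mem_set Om) (mem_set Ox) (addrC x).
Qed.

Let quotient_bound i x : mesh_interior x -> `|partial_derivative i w x| <= L.
Proof.
move=> [e _ Kx]; have dw : derivable w x (z i) by exact: derw.
have dc : h^-1 *: (w (h *: z i + x) - w x) @[h --> (0 : R)^'] --> partial_derivative i w x.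
  exact: dw.
have dn : `|h^-1 *: (w (h *: z i + x) - w x)| @[h --> (0 : R)^'] --> `|partial_derivative i w x|.
  exact: cvg_norm.
rewrite -(cvg_lim _ dn)//; apply: limr_le; first by apply/cvg_ex; eexists; exact: dn.
have cl : h *: z i + x @[h --> (0 : R)^'] --> x.
  rewrite -[X in _ --> X]add0r -(scale0r (z i)); apply: cvgD; last exact: cvg_cst.
  apply: cvgZr_tmp; exact: (@cvg_within_filter).
have nK : \forall y \near x, open_simplex (T e) y.
  exact: open_nbhs_nbhs (conj (@open_open_simplex _ _ _) Kx).
have h0 : \forall h \near (0 : R)^', h != 0 by exact: nbhs_dnbhs_neq.
have := cl _ nK; apply: filterS2 h0 => h hn0 /= Kh.
rewrite normrZ normfV ler_pdivrMl ?normr_gt0//.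
have := @lipw e _ _ (open_simplexW (uT e) Kx) (open_simplexW (uT e) Kh).
rewrite addrK normrZ => /le_trans; apply.
by rewrite mulrC ler_wpM2r// ler_piMr.
Qed.

Lemma piecewise_gradientE e x : open_simplex (T e) x -> piecewise_gradient x = gradient w x.
Proof. by move=> Kx; rewrite /piecewise_gradient asboolT//; exists e. Qed.

Lemma piecewise_gradient_bounded i x : `|piecewise_gradient x 0 i| <= L.
Proof.
rewrite /piecewise_gradient; case: asboolP => Ux; rewrite mxE ?normr0//.
exact: quotient_bound.
Qed.

(** A partial derivative is a pointwise limit of difference quotients along a sequence of steps;
    extending [w] by zero makes the shifted functions measurable everywhere. *)
Lemma piecewise_gradient_measurable i :
  measurable_fun Omega ((fun x => piecewise_gradient x 0 i) : V -> measurableTypeR R).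
Proof.
pose t (m : nat) : R := m.+1%:R^-1.
have t0 m : 0 < t m by rewrite invr_gt0.
have mw : measurable_fun setT (w \_ Omega : V -> measurableTypeR R).
  exact: (iffLR (measurable_restrictT _ mO) piecewise_lipschitz_measurable).
have mU : measurable_fun mesh_interior (partial_derivative i w : V -> measurableTypeR R).
  apply: (@measurable_fun_cvg _ _ R mesh_interior (fun m x => (t m)^-1 *
    ((w \_ Omega) (x + t m *: z i) - (w \_ Omega) x)) (partial_derivative i w)) => [m|x Ux].
    apply: measurable_funM => //; apply: measurable_funB.
      apply: (measurable_funS measurableT) => //.
      by apply: (measurableT_comp mw); exact: measurable_translate.
    exact: (measurable_funS measurableT).
  by apply: quotient_cvg => //; exact: cvg_harmonic.
have -> : (fun x => piecewise_gradient x 0 i) = partial_derivative i w \_ mesh_interior.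
  apply/funext => x; rewrite patchE /piecewise_gradient; case: asboolP => Ux.
    by rewrite mem_set// mxE.
  by rewrite memNset// mxE.
apply: (measurable_funS measurableT) => //.
exact: (iffLR (measurable_restrictT _ measurable_mesh_interior) mU).
Qed.

(** Integration by parts through difference quotients, so that no face terms appear: translation
    invariance moves the shift from [phi] to [w]. One side converges by [is_derive_mollified], the
    other by dominated convergence, the Lipschitz constant giving the dominating function. *)
Lemma piecewise_weak_partial i :
  weak_partial Omega i w (fun x => piecewise_gradient x 0 i).
Proof.
move=> phi tphi; have [sp [K0 [cK KO pK]]] := tphi.
have tphi' : test_function setT phi by split => //; exists K0.
have Iw : mu.-integrable Omega (EFin \o w) := L2_integrable_rV mO fO piecewise_lipschitz_L2.
have [M M0 hM] := test_function_bounded tphi'.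
have [d d0 hd] := compact_inner_radius cK oO KO.
(* Steps below [d] keep every segment that starts in the support of [phi] inside [Omega]. *)
pose t (m : nat) : R := d / 2 * m.+1%:R^-1.
have t0 m : 0 < t m by rewrite mulr_gt0 ?divr_gt0.
have td m : t m < d.
  apply: (@le_lt_trans _ _ (d / 2)); last by move: d0; lra.
  by rewrite ler_piMr ?divr_ge0 ?(ltW d0)// invf_le1// ler1n.
have tc : t @ \oo --> (0 : R).
  by rewrite -(mulr0 (d / 2)); apply: cvgM; [exact: cvg_cst|exact: cvg_harmonic].
pose F (s : R) := \int[mu]_(x in Omega) (w x * phi (x - s *: z i)).
pose w' := w \_ Omega.
have Iw' : mu.-integrable setT (EFin \o w').
  have := iffLR (integrable_mkcond _ mO) Iw.
  by congr (mu.-integrable _ _); apply/funext => x; rewrite /w' /= !patchE; case: ifP.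
pose q (m : nat) x := (t m)^-1 * (w' (x + t m *: z i) - w' x) * phi x.
have Ish m : mu.-integrable setT (EFin \o (fun x => w' (x + t m *: z i))).
  exact: (integrable_translate (t m *: z i) Iw').
have Iphi (f : V -> R) : mu.-integrable setT (EFin \o f) ->
    mu.-integrable setT (EFin \o (fun x => f x * phi x)).
  move=> If; apply: (@integrableM_bounded _ _ _ mu setT f phi M) => //.
  exact: measurable_smooth.
have Iq m : mu.-integrable setT (EFin \o q m).
  apply: Iphi; apply: integrableZlr => //.
  exact: (integrableB measurableT (Ish m) Iw').
have Fq m : (t m)^-1 * (F (t m) - F 0) = \int[mu]_(x in Omega) q m x.
  have F' s : F s = \int[mu]_x (w' x * phi (x - s *: z i)).
    rewrite /F Rintegral_mkcond; apply: eq_Rintegral => x _.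
    by rewrite /w' !patchE; case: ifP => _ //; rewrite mul0r.
  have Fs s : F s = \int[mu]_x (w' (x + s *: z i) * phi x).
    rewrite F' -(@Rintegral_translate _ _ _ (s *: z i)).
      by apply: eq_Rintegral => x _; rewrite addrK.
    apply: (@integrableM_bounded _ _ _ mu setT w' (fun x => phi (x - s *: z i)) M) => //.
    exact: measurable_shifted.
  have F0 : F 0 = \int[mu]_x (w' x * phi x).
    by rewrite F'; apply: eq_Rintegral => x _; rewrite scale0r subr0.
  have I1 := Iphi _ (Ish m); have I0 := Iphi _ Iw'.
  rewrite Fs F0 -(RintegralB measurableT I1 I0) -(RintegralZl _ _ (integrableB measurableT I1 I0))//.
  rewrite [RHS]Rintegral_mkcond; apply: eq_Rintegral => x _.
  rewrite patchE /q; case: ifPn => Ox; first by ring.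
  rewrite pK ?mulr0 ?subrr ?mulr0// => Kx.
  by move: Ox; rewrite notin_setE; apply; exact: KO.
have dF := is_derive_mollified mO (z i) 0 Iw tphi'.
have dF' : (t m)^-1 * (F (t m) - F 0) @[m --> \oo] -->
    - \int[mu]_(x in Omega) (w x * partial_derivative i phi x).
  have e : - \sum_j z i 0 j * \int[mu]_(x in Omega)
      (w x * partial_derivative j phi (x - 0 *: z i)) =
      - \int[mu]_(x in Omega) (w x * partial_derivative i phi x).
    rewrite (bigD1 i)//= big1 => [|j ji]; last by rewrite zE (negbTE ji) mul0r.
    rewrite addr0 zE eqxx mul1r; apply: (congr1 -%R).
    by apply: eq_Rintegral => x _; rewrite scale0r subr0.
  rewrite e in dF; have dc : h^-1 *: (F (h *: 1 + 0) - F 0) @[h --> (0 : R)^'] -->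
      - \int[mu]_(x in Omega) (w x * partial_derivative i phi x).
    by rewrite -(@derive_val _ _ _ _ _ _ _ dF); exact: (@ex_derive _ _ _ _ _ _ _ dF).
  have tc' : t @ \oo --> (0 : R)^'.
    exact: cvg_dnbhs0.
  have := cvg_comp _ _ tc' dc; rewrite /comp.
  under eq_fun do rewrite addr0 [_ *: 1]mulr1.
  exact.
have qc : \int[mu]_(x in Omega) q m x @[m --> \oo] -->
    \int[mu]_(x in Omega) (piecewise_gradient x 0 i * phi x).
  have mphi : measurable_fun Omega (phi : V -> measurableTypeR R) by exact: measurable_smooth.
  have Ic : mu.-integrable Omega (EFin \o cst (L * M)).
    apply: measurable_bounded_integrable => //.
    by exists (L * M); split; [exact: num_real|move=> y /ltW My x _ /=; rewrite ger0_norm ?mulr_ge0].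
  have mq m := measurable_int _ (integrableS measurableT mO (@subsetT _ _) (Iq m)).
  have mG : measurable_fun Omega (EFin \o (fun x => piecewise_gradient x 0 i * phi x)).
    apply/measurable_EFinP; apply: measurable_funM => //.
    exact: piecewise_gradient_measurable.
  have cq : {ae mu, forall x, Omega x -> (EFin \o q m) x @[m --> \oo] -->
      (piecewise_gradient x 0 i * phi x)%:E}.
    have := ae_mesh_interior_domain; apply: filterS => x hU /hU Ux.
    apply: cvg_EFin; first by apply: nearW.
    apply: cvgM; last exact: cvg_cst.
    have -> : piecewise_gradient x 0 i = partial_derivative i w x.
      by rewrite /piecewise_gradient asboolT// mxE.
    exact: quotient_cvg.
  have bq : {ae mu, forall x m, Omega x -> (`|(EFin \o q m) x| <= (L * M)%:E)%E}.
    apply: aeW => x m Ox; rewrite /= lee_fin /q.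
    have [Kx|nKx] := pselect (K0 x); last by rewrite pK// mulr0 normr0 mulr_ge0.
    rewrite normrM ler_pM// normrM normfV ler_pdivrMl ?normr_gt0 ?gt_eqF//.
    have seg s : 0 <= s <= t m -> Omega (x + s *: z i).
      move=> /andP[s0 st]; apply: hd => //; rewrite normrZ ger0_norm//.
      by apply: (@le_lt_trans _ _ s); [rewrite ler_piMr|exact: le_lt_trans st (td m)].
    have Om : Omega (x + t m *: z i) by apply: seg; rewrite (ltW (t0 m)) lexx.
    rewrite /w' !patchE (mem_set Om) (mem_set Ox) (gtr0_norm (t0 m)).
    apply: le_trans (piecewise_lipschitz_segment (ltW (t0 m)) seg) _.
    by rewrite mulrC ler_wpM2l ?(ltW (t0 m))// ler_piMr.
  have [IG _] := @dominated_convergence _ _ _ mu Omega mO (fun m => EFin \o q m)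
    (EFin \o (fun x => piecewise_gradient x 0 i * phi x)) (EFin \o cst (L * M))
    mq mG cq Ic bq.
  move=> h; apply: (fine_cvg (f := fun m => (\int[mu]_(x in Omega) (q m x)%:E)%E)).
  rewrite fineK; first exact: h.
  exact: integrable_fin_num.
rewrite -[LHS]opprK; congr (- _); rewrite -(cvg_lim _ dF')//.
by under eq_fun do rewrite Fq; apply/cvg_lim.
Qed.

Lemma piecewise_weak_gradient : weak_gradient Omega w piecewise_gradient.
Proof.
split; first exact: piecewise_lipschitz_L2.
move=> i; split; last exact: piecewise_weak_partial.
apply: (@bounded_L2 _ _ _ _ L mO fO (piecewise_gradient_measurable i)) => x _.
exact: piecewise_gradient_bounded.
Qed.

Lemma H1_seminorm_piecewise_le (b : 'I_N -> R) : (forall e, 0 <= b e) ->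
  (forall e x, open_simplex (T e) x -> dotv (gradient w x) (gradient w x) <= b e) ->
  (H1_seminorm Omega w <= ((\sum_e b e * simplex_volume (T e)) `^ 2^-1)%:E)%E.
Proof.
move=> b0 hb; rewrite /H1_seminorm.
(* The seminorm is an infimum over weak gradients, so exhibiting one is enough. *)
apply: ge_ereal_inf; eexists; first by exists piecewise_gradient => //; exact: piecewise_weak_gradient.
rewrite -poweR_EFin; apply: gt0_ler_poweR => //.
- by rewrite in_itv /= leey andbT; apply: integral_ge0 => x _; rewrite lee_fin dotvv_ge0.
- rewrite in_itv /= leey andbT lee_fin sumr_ge0// => e _; rewrite mulr_ge0//.
  by rewrite fine_ge0.
apply: (@le_trans _ _ (\int[mu]_(x in Omega) (step b (fun e => open_simplex (T e)) x)%:E)%E).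
  apply: ge0_le_integral_sup => x _; rewrite lee_fin ?dotvv_ge0//.
  have [[e _ Kx]|nU] := pselect (mesh_interior x).
    rewrite (piecewise_gradientE Kx) (@step_cell _ _ _ _ b _ e)//; first exact: hb.
    move=> e' K'x; symmetry; apply: (open_simplex_disjoint mT Kx).
    exact: open_simplexW.
  by rewrite /piecewise_gradient asboolF// dotv0l step_ge0.
rewrite integral_step//; last 2 first.
- by move=> e; exact: measurable_open_simplex.
- by move=> e; exact: open_simplex_sub.
rewrite -sumEFin; apply: lee_sum => e _.
rewrite EFinM -(open_simplex_measure n0 (uT e)); exact: lexx.
Qed.

End piecewise_lipschitz.

(** * Metric tensors and the error bound *)

Section recovered_average.
Context {R : realType} {n : nat}.
Local Notation V := 'rV[R]_n.

Lemma dotv_mulmxE (A : 'M[R]_n) (x y : V) :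
  dotv (x *m A) y = \sum_i \sum_j (x 0 j * y 0 i) * A j i.
Proof.
rewrite dotvE; apply: eq_bigr => i _; rewrite mxE mulr_suml.
by apply: eq_bigr => j _; rewrite mulrAC.
Qed.

(** For fixed [x] the form is linear in the matrix, so its uniform lower bound survives integration
    against the probability. *)
Lemma average_posdef (S D : set V) (Rec : V -> 'M[R]_n) (A : 'M[R]_n) :
  S `<=` D -> uniformly_posdef D Rec -> is_average Rec S A -> pdmx A.
Proof.
move=> SD [g g0 hg] [dsp [W [P [X [XS hA]]]]].
have pX t : pdmx (Rec (X t)) by apply: loewner_le_scalar (hg _ _) => //; exact/SD/XS.
split.
  apply/matrixP => i j; rewrite mxE (hA j i).2 (hA i j).2; apply: eq_Rintegral => t _.
  by have [e _] := pX t; rewrite -{1}e mxE.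
move=> x x0.
have I j i : P.-integrable setT (EFin \o (fun t => (x 0 j * x 0 i) * Rec (X t) j i)).
  by apply: integrableZlr => //; exact: (hA j i).1.
have I' i : P.-integrable setT (EFin \o (fun t => \sum_j (x 0 j * x 0 i) * Rec (X t) j i)).
  exact: integrable_sumr.
have -> : dotv (x *m A) x = \int[P]_t dotv (x *m Rec (X t)) x.
  under eq_Rintegral do rewrite dotv_mulmxE.
  rewrite Rintegral_sum// dotv_mulmxE; apply: eq_bigr => i _.
  rewrite Rintegral_sum//; apply: eq_bigr => j _.
  by rewrite RintegralZl//; [rewrite (hA j i).2|exact: (hA j i).1].
apply: (@lt_le_trans _ _ (g * dotv x x)); first by rewrite mulr_gt0 ?dotvv_gt0.
have -> : g * dotv x x = \int[P]_t (g * dotv x x).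
  by rewrite Rintegral_cst// [X in fine X](_ : _ = 1%E) ?mulr1//; exact: probability_setT.
apply: le_Rintegral => //.
- exact: finite_measure_integrable_cst.
- under eq_fun do rewrite /= dotv_mulmxE.
  exact: integrable_sumr.
- move=> t _; have /loewner_leP[_ _ /(_ x)] := hg _ (SD _ (XS t)).
  by rewrite mul_mx_scalar dotvZl.
Qed.
End recovered_average.

Section reference_element.
Context {R : realType} {n : nat}.
Local Notation V := 'rV[R]_n.
Implicit Types (K Khat : 'I_n.+1 -> V) (A P : 'M[R]_n).

Lemma tr_congr_le P A : psdmx A ->
  \tr (P *m A *m P^T) <= n%:R * (\sum_i dotv (row i P) (row i P)) * \tr A.
Proof.
move=> pA; rewrite mulrAC mulr_sumr; apply: ler_sum => i _.
apply: le_trans (psd_form_le_tr (row i P) pA).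
rewrite le_eqVlt; apply/orP; left; apply/eqP; rewrite -[LHS]dotv_delta_mx.
by rewrite !mulmxA [LHS]dotv_mulmx trmxK -!rowE.
Qed.

Lemma edge_mx_jac Khat K : nondegenerate_simplex Khat ->
  edge_mx K = edge_mx Khat *m (jac Khat K)^T.
Proof. by move=> uK; rewrite /jac trmxK mulKVmx. Qed.

Definition edge_constant Khat : R :=
  n%:R * (\sum_i dotv (row i (edge_mx Khat)) (row i (edge_mx Khat))) + 1.

(** [4 * n%:R ^+ 3] comes from [interp_gradient_error]; the [n%:R] under the power undoes the
    normalization of the trace in the alignment condition. *)
Definition element_constant Khat : R :=
  4 * n%:R ^+ 3 * (edge_constant Khat * n%:R) ^+ n.+1.

Lemma edge_constant_gt0 Khat : 0 < edge_constant Khat.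
Proof. by rewrite ltr_wpDl// mulr_ge0// sumr_ge0// => i _; exact: dotvv_ge0. Qed.

Lemma element_constant_gt0 Khat : (0 < n)%N -> 0 < element_constant Khat.
Proof.
by move=> n0; rewrite !mulr_gt0 ?exprn_gt0 ?mulr_gt0 ?ltr0n ?edge_constant_gt0.
Qed.

(** [q] is the n-th root of |K|^2 det A. Alignment bounds the trace of [S] by a multiple of [q], and
    [simplex_volume_le] gives [q ^+ n <= \det S]; of the [n.+1] powers of [q] a single one
    survives. *)
Lemma element_gradient_error Khat K (u : V -> R) A (c Cali q : R) x : (0 < n)%N ->
  nondegenerate_simplex Khat -> nondegenerate_simplex K -> pdmx A -> 0 <= c ->
  convexity_gap (simplex K) u (c *: A) -> open_simplex K x ->
  0 <= Cali -> 0 <= q -> q ^+ n = simplex_volume K ^+ 2 * \det A ->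
  n%:R^-1 * \tr ((jac Khat K)^T *m A *m jac Khat K) <= Cali * q ->
  dotv (gradient u x - interp_grad K u) (gradient u x - interp_grad K u) <=
  element_constant Khat * (spectral_norm A * q * c ^+ 2 * Cali ^+ n.+1).
Proof.
move=> n0 uKh uK pA c0 gap Kx Ca0 q0 qn al.
have := interp_gradient_error uK pA c0 gap Kx.
set g := dotv _ _; set S := edge_mx K *m A *m _ => hg.
have g0 : 0 <= g by exact: dotvv_ge0.
have pS : pdmx S by exact: pdmx_congr.
set X := (jac Khat K)^T *m A *m jac Khat K.
have pX : psdmx X.
  case: (pdmx_psd pA) => sA hA; split.
    by rewrite /X !trmx_mul trmxK sA mulmxA.
  by move=> z; rewrite /X !mulmxA dotv_mulmx.
have SE : S = edge_mx Khat *m X *m (edge_mx Khat)^T.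
  by rewrite /S (edge_mx_jac K uKh) /X trmx_mul trmxK !mulmxA.
have e0 := edge_constant_gt0 Khat.
have trS : \tr S <= edge_constant Khat * n%:R * (Cali * q).
  apply: (@le_trans _ _ (edge_constant Khat * \tr X)).
    rewrite SE; apply: le_trans (tr_congr_le _ pX) _.
    by rewrite ler_wpM2r ?psd_tr_ge0// lerDl.
  by rewrite -mulrA ler_wpM2l ?(ltW e0)// -ler_pdivrMl ?ltr0n.
have detS : q ^+ n <= \det S.
  have -> : \det S = \det (edge_mx K) ^+ 2 * \det A.
    by rewrite /S !det_mulmx det_tr expr2 mulrAC.
  rewrite qn ler_wpM2r ?(ltW (pd_det_gt0 pA))//.
  rewrite -[leRHS]real_normK ?num_real// lerXn2r ?nnegrE ?fine_ge0//.
  by rewrite -lee_fin simplex_volumeE// simplex_volume_le.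
have t0 : 0 <= \tr S by exact/psd_tr_ge0/pdmx_psd.
have sp := spectral_norm_ge0 A.
have {}hg : g * q ^+ n <= element_constant Khat *
    (spectral_norm A * q * c ^+ 2 * Cali ^+ n.+1) * q ^+ n.
  apply: (@le_trans _ _ (g * \det S)); first by rewrite ler_wpM2l.
  apply: le_trans hg _.
  apply: (@le_trans _ _ (4 * n%:R ^+ 3 * spectral_norm A * c ^+ 2 *
      (edge_constant Khat * n%:R * (Cali * q)) ^+ n.+1)).
    rewrite ler_wpM2l//; first by rewrite !mulr_ge0// exprn_ge0.
    by rewrite lerXn2r ?nnegrE ?(le_trans t0 trS).
  rewrite /element_constant !exprMn (exprS q).
  rewrite le_eqVlt; apply/orP; left; apply/eqP.
  move: (edge_constant Khat ^+ _) (n%:R ^+ n.+1) (Cali ^+ _) (q ^+ n) => a1 a2 a3 a4.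
  by move: (spectral_norm A) (n%:R ^+ 3) => a5 a6; ring.
(* [q = 0] is absurd: the trace of [S] would vanish, and with it the determinant by
   [pd_det_le_tr]. *)
have [qz|q_neq0] := eqVneq q 0; last by move: hg; rewrite ler_pM2r// exprn_gt0// lt_def q_neq0.
have S0 : \tr S = 0.
  by apply/eqP; rewrite eq_le t0 andbT; move: trS; rewrite qz !mulr0.
have := pd_det_gt0 pS; have := pd_det_le_tr pS; rewrite S0 expr0n.
by rewrite gtn_eqF// => h1 /lt_le_trans /(_ h1); rewrite ltxx.
Qed.

End reference_element.

Section metric_density.
Context {R : realType} {n : nat}.
Implicit Types (A : 'M[R]_n) (v : R).

Lemma powR_expR (a r : R) : expR a `^ r = expR (r * a).
Proof. by rewrite /powR gt_eqF ?expR_gt0// expRK. Qed.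

Lemma ex_expR (a : R) : 0 < a -> exists b, a = expR b.
Proof. by move=> a0; exists (ln a); rewrite lnK. Qed.

(** Writing positive numbers as exponentials turns power identities into linear ones between
    exponents. The cancelling [m] is kept so that [m] times the power of [s] can be bounded by the
    norm of the Hessian. *)
Lemma error_constant (l a b N p m s : R) : (0 < n)%N -> 0 < l -> 0 < a -> 0 < b ->
  0 < N -> 0 < p -> 0 < m -> 0 <= s ->
  (l * a `^ n.+1%:R * (b * (N^-1 * s)) `^ (n.+2%:R / n%:R) * (N * p `^ 2)) `^ 2^-1 =
  l `^ 2^-1 * a `^ (n.+1%:R / 2) * b `^ (n.+2%:R / (2 * n%:R)) * (p / m) *
    N `^ (- n%:R^-1) * (m * s `^ (n.+2%:R / (2 * n%:R))).
Proof.
move=> n0 l0 a0 b0 N0 p0 m0.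
have nn0 : n%:R != 0 :> R by rewrite pnatr_eq0 -lt0n.
rewrite le_eqVlt => /predU1P[<-|s0].
  have r0 : n.+2%:R / n%:R != 0 :> R by rewrite mulf_neq0 ?invr_eq0.
  have r1 : n.+2%:R / (2 * n%:R) != 0 :> R by rewrite mulf_neq0 ?invr_eq0 ?mulf_neq0.
  by rewrite 2!mulr0 (powR0 r0) (powR0 r1) !mulr0 mul0r powR0 ?invr_eq0.
have [b' ->] := ex_expR b0; have [a' ->] := ex_expR a0; have [p' ->] := ex_expR p0.
have [m' ->] := ex_expR m0; have [l' ->] := ex_expR l0; have [N' ->] := ex_expR N0.
have [s' ->] := ex_expR s0.
rewrite !(powR_expR, =^~ expRN, =^~ expRD); congr expR.
rewrite -(addn2 n) -(addn1 n) !natrD; field.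
by rewrite nn0.
Qed.

(** The closed form of the square root of the determinant of [metric_tensor A], computed in
    [sqrt_det_metric_tensor]. *)
Definition density A : R :=
  \det A `^ n.+2%:R^-1 * spectral_norm A `^ (n%:R / n.+2%:R).

Lemma density_ge0 A : 0 <= density A.
Proof. by rewrite mulr_ge0// powR_ge0. Qed.

Lemma metric_scale_gt0 A : (0 < n)%N -> pdmx A ->
  0 < \det A `^ (- n.+2%:R^-1) * spectral_norm A `^ (2 / n.+2%:R).
Proof. by move=> n0 pA; rewrite mulr_gt0// powR_gt0 ?pd_det_gt0 ?pd_spectral_gt0. Qed.

Lemma sqrt_det_metric_tensor A : (0 < n)%N -> pdmx A ->
  Num.sqrt (\det (metric_tensor A)) = density A.
Proof.
move=> n0 pA; have s0 := metric_scale_gt0 n0 pA.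
rewrite -powR12_sqrt; last by rewrite detZ mulr_ge0 ?exprn_ge0 ?(ltW s0) ?(ltW (pd_det_gt0 pA)).
rewrite detZ -powR_mulrn ?(ltW s0)// /density.
have [a ->] := ex_expR (pd_det_gt0 pA).
have [b ->] := ex_expR (pd_spectral_gt0 n0 pA).
rewrite !powR_expR -!expRD !powR_expR -!expRD !powR_expR; congr expR.
have k0 : n.+2%:R != 0 :> R by rewrite pnatr_eq0.
have -> : n%:R = n.+2%:R - 2 :> R by rewrite -addn2 natrD addrK.
by field.
Qed.

(** Both sides of the alignment condition are homogeneous of degree one in the metric, so its scalar
    factor cancels and the condition is one on [A] alone. *)
Lemma metric_alignment A (F : 'M[R]_n) (v Cali : R) : (0 < n)%N -> pdmx A -> 0 <= v ->
  n%:R^-1 * \tr (F^T *m metric_tensor A *m F) <=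
    Cali * v `^ (2 / n%:R) * \det (metric_tensor A) `^ n%:R^-1 ->
  n%:R^-1 * \tr (F^T *m A *m F) <= Cali * (v ^+ 2 * \det A) `^ n%:R^-1.
Proof.
move=> n0 pA v0; have s0 := metric_scale_gt0 n0 pA.
have d0 := ltW (pd_det_gt0 pA).
rewrite /metric_tensor; move: (_ * _) s0 => s s0.
rewrite -scalemxAr -scalemxAl mxtraceZ detZ (@powRM _ (s ^+ n)) ?exprn_ge0 ?(ltW s0)//.
rewrite -(powR_mulrn _ (ltW s0)) -powRrM mulfV ?pnatr_eq0 -?lt0n// powRr1 ?(ltW s0)//.
rewrite powRM ?sqr_ge0// -(powR_mulrn _ v0) -powRrM.
by rewrite mulrCA [leRHS]mulrCA ler_pM2l// mulrA.
Qed.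

(** The exponents of the metric tensor are tuned to this identity: equidistributing the density
    equidistributes the geometric part of the element error. *)
Lemma density_power A v : (0 < n)%N -> pdmx A -> 0 <= v ->
  (v * density A) `^ (n.+2%:R / n%:R) =
  v * (spectral_norm A * (v ^+ 2 * \det A) `^ n%:R^-1).
Proof.
move=> n0 pA; have nn0 : n%:R != 0 :> R by rewrite pnatr_eq0 -lt0n.
have k0 : n.+2%:R != 0 :> R by rewrite pnatr_eq0.
rewrite le_eqVlt => /predU1P[<-|v0]; first by rewrite !mul0r powR0// mulf_neq0 ?invr_eq0.
rewrite /density -powR_mulrn ?(ltW v0)//.
have [a ->] := ex_expR (pd_det_gt0 pA).
have [b ->] := ex_expR (pd_spectral_gt0 n0 pA).
have [c ->] := ex_expR v0.
rewrite !powR_expR -!expRD !powR_expR -!expRD; congr expR.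
have e : n.+2%:R = n%:R + 2 :> R by rewrite -addn2 natrD.
by move: k0; rewrite e => k0; field; rewrite k0 nn0.
Qed.

End metric_density.

(** * Summation over the mesh and comparison with the Hessian *)

Section error_bound.
Context {R : realType} {n : nat}.
Local Notation V := 'rV[R]_n.
Local Notation mu := (@lebesgue_rV R n).
Variables (Omega : set V) (N : nat) (T : 'I_N -> 'I_n.+1 -> V).
Hypotheses (n0 : (0 < n)%N) (pO : polyhedral_domain Omega) (mT : simplicial_mesh Omega T).
Variables (u : V -> R) (H : V -> 'M[R]_n) (RK : 'I_N -> 'M[R]_n) (cm cp : 'I_N -> R).
Hypotheses (cu : {within closure Omega, continuous u}) (wH : weak_hessian Omega u H)
  (pH : ae_uniformly_posdef Omega H) (pR : forall e, pdmx (RK e))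
  (eigR : forall e, {ae mu, forall x, simplex (T e) x ->
     forall a, eigenvalue (invmx (RK e) *m H x) a -> cm e <= a <= cp e}).

Let oO : open Omega. Proof. by case: pO. Qed.

Let uT e : nondegenerate_simplex (T e). Proof. exact: (mesh_nondegenerate mT). Qed.

Let subO e : open_simplex (T e) `<=` Omega. Proof. exact: open_simplex_sub. Qed.

(** The sign of [cp e] is not assumed; its absolute value is a legitimate coefficient for
    [convexity_gap], and only its square reaches the final bound. *)
Lemma hessian_bounds_ae : {ae mu, forall x, forall e, open_simplex (T e) x -> pdmx (H x) /\
  forall z, cm e * dotv (z *m RK e) z <= dotv (z *m H x) z <= `|cp e| * dotv (z *m RK e) z}.
Proof.
apply: (@filter_forall _ _ (fun e x => open_simplex (T e) x -> pdmx (H x) /\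
  forall z, cm e * dotv (z *m RK e) z <= dotv (z *m H x) z <= `|cp e| * dotv (z *m RK e) z)
  (almost_everywhere mu)) => e.
have [g g0 hg] := pH; have := eigR e; apply: filterS2 hg => x hg hx Kx.
have pHx := loewner_le_scalar g0 (hg (subO Kx)); split => // z.
have /andP[l r] := form_bounds_of_eigenvalues n0 (pR e) pHx.1 (hx (open_simplexW (uT e) Kx)) z.
rewrite l (le_trans r)// ler_wpM2r ?ler_norm//; case: (pdmx_psd (pR e)) => _; exact.
Qed.

Let cu_open x : Omega x -> u y @[y --> x] --> u x.
Proof.
move=> Ox P hP; have /subspace_continuousP /(_ x (subset_closure Ox)) := cu.
move=> /(_ P hP); rewrite /= /nbhs /= => hw.
have nO : \forall y \near x, Omega y by exact: open_nbhs_nbhs (conj oO Ox).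
by move: hw; apply: filterS2 nO => y Oy; apply; exact: subset_closure.
Qed.

Lemma recovered_gap e : convexity_gap (simplex (T e)) u (`|cp e| *: RK e).
Proof.
have pB : psdmx (`|cp e| *: RK e) by exact: psdmxZ (pdmx_psd (pR e)).
apply: convexity_gap_closed pB _ cu _ => //.
  by move=> x; exact: mesh_sub_closure.
have [G wu wG] := wH; move=> x y t Kx Ky t01.
have := @weak_hessian_interpolation_open R n Omega (measurable_domain pO)
  (domain_measure_fin pO mT) u G H wu wG (open_simplex (T e)) x y
  (dotv ((y - x) *m (`|cp e| *: RK e)) (y - x)) t.
apply=> //.
- exact: open_open_simplex.
- by move=> p q s Kp Kq; exact: open_simplex_conv.
- by move=> p /subO; exact: cu_open.
have := hessian_bounds_ae; apply: filterS => p hp Kp.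
have [/pdmx_psd[_ pHp] /(_ (y - x))/andP[_ h]] := hp e Kp.
by rewrite pHp formM_scale.
Qed.

Definition interp_error : V -> R := (u \- mesh_interp T u)%R.

Lemma interp_error_lipschitz : exists2 L : R, 0 <= L & forall e x y,
  simplex (T e) x -> simplex (T e) y -> `|interp_error y - interp_error x| <= L * `|y - x|.
Proof.
have /choice[L hL] e : exists L : R, 0 <= L /\
    forall x y, simplex (T e) x -> simplex (T e) y -> `|u y - u x| <= L * `|y - x|.
  by have [L L0 hL] := gap_lipschitz (uT e) (pR e) (normr_ge0 _) (@recovered_gap e); exists L.
pose D e := L e + \sum_i `|interp_grad (T e) u 0 i|.
have D0 e : 0 <= D e by rewrite addr_ge0 ?(hL e).1// sumr_ge0.
exists (\sum_e D e) => [|e x y Kx Ky]; first by rewrite sumr_ge0.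
apply: (@le_trans _ _ (D e * `|y - x|)); last first.
  by rewrite ler_wpM2r// (bigD1 e)//= lerDl sumr_ge0.
rewrite /interp_error /= (mesh_interpE mT _ Kx) (mesh_interpE mT _ Ky).
have -> : u y - interp (T e) u y - (u x - interp (T e) u x) =
  (u y - u x) - (interp (T e) u y - interp (T e) u x) by ring.
rewrite interp_diff mulrDl; apply: le_trans (ler_normB _ _) _.
by apply: lerD; [exact: (hL e).2|exact: dotv_le_norm].
Qed.

Lemma is_derive_interp_error e x i : open_simplex (T e) x ->
  is_derive x (delta_mx 0 i) interp_error
    ((gradient u x - interp_grad (T e) u) 0 i).
Proof.
move=> Kx.
have pB : psdmx (`|cp e| *: RK e) by exact: psdmxZ (pdmx_psd (pR e)).
have du : derivable u x (delta_mx 0 i).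
  exact: (gap_derivable (uT e) pB (@recovered_gap e) Kx).
have nK : \forall y \near x, open_simplex (T e) y.
  exact: open_nbhs_nbhs (conj (@open_open_simplex _ _ _) Kx).
have eqn : \forall y \near x, (fun y => u y - interp (T e) u y) y = interp_error y.
  apply: filterS nK => y Ky; rewrite /interp_error /=.
  by rewrite (mesh_interpE mT _ (open_simplexW (uT e) Ky)).
apply: (near_eq_is_derive (f := (u \- interp (T e) u)%R)) => //.
have di : is_derive x (delta_mx 0 i : V) (interp (T e) u) (interp_grad (T e) u 0 i).
  apply: (@expansion_derive _ _ _ _ _ _ 0 1) => // h _.
  by rewrite interp_diff (addrC x) addrK dotvZr dotv_delta subrr normr0 mul0r.
rewrite !mxE; apply: is_deriveB; exact: derivableP.
Qed.

Lemma gradient_interp_error e x : open_simplex (T e) x ->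
  gradient interp_error x = gradient u x - interp_grad (T e) u.
Proof.
move=> Kx; apply/rowP => i; rewrite [LHS]mxE /partial_derivative.
by have h := is_derive_interp_error i Kx; rewrite derive_val.
Qed.

Variables (Khat : 'I_n.+1 -> V) (Ceq Cali : R).
Hypotheses (uKh : nondegenerate_simplex Khat) (Cali1 : 1 <= Cali) (Ceq1 : 1 <= Ceq)
  (qu : quasi_uniform Khat Ceq Cali T (fun e => metric_tensor (RK e))).

Definition mesh_density : R := \sum_e simplex_volume (T e) * density (RK e).

Let Cali0 : 0 <= Cali. Proof. exact: le_trans Cali1. Qed.

Let Ceq0 : 0 <= Ceq. Proof. exact: le_trans Ceq1. Qed.

Let vol0 e : 0 <= simplex_volume (T e). Proof. by rewrite fine_ge0. Qed.

Lemma mesh_density_ge0 : 0 <= mesh_density.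
Proof. by apply: sumr_ge0 => e _; rewrite mulr_ge0// density_ge0. Qed.

Let const0 : 0 <= element_constant Khat * Cali ^+ n.+1.
Proof. by apply: mulr_ge0; [exact/ltW/element_constant_gt0|exact: exprn_ge0]. Qed.

Let bound e : R := element_constant Khat * (spectral_norm (RK e) *
  (simplex_volume (T e) ^+ 2 * \det (RK e)) `^ n%:R^-1 * `|cp e| ^+ 2 * Cali ^+ n.+1).

Let bound0 e : 0 <= bound e.
Proof.
rewrite mulr_ge0 ?(ltW (element_constant_gt0 _ n0))//.
by rewrite !mulr_ge0 ?exprn_ge0 ?spectral_norm_ge0 ?powR_ge0.
Qed.

Let bound_sum :
  \sum_e bound e * simplex_volume (T e) <= element_constant Khat * Cali ^+ n.+1 *
    (Ceq * (N%:R^-1 * mesh_density)) `^ (n.+2%:R / n%:R) * \sum_e cp e ^+ 2.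
Proof.
rewrite mulr_sumr; apply: ler_sum => e _.
have p0 : 0 <= n.+2%:R / n%:R :> R by rewrite divr_ge0.
have eq : simplex_volume (T e) * density (RK e) <= Ceq * (N%:R^-1 * mesh_density).
  have := qu.1 e; rewrite (sqrt_det_metric_tensor n0 (pR e)).
  by under eq_bigr do rewrite (sqrt_det_metric_tensor n0 (pR _)).
have := ge0_ler_powR p0 _ _ eq; rewrite !nnegrE => /(_ _ _)/Wrap[].
  by rewrite mulr_ge0// density_ge0.
  by rewrite !mulr_ge0// mesh_density_ge0.
rewrite (density_power n0 (pR e) (vol0 e)) /bound real_normK ?num_real//.
have c0 : 0 <= element_constant Khat * Cali ^+ n.+1 * cp e ^+ 2.
  by apply: mulr_ge0 const0 (sqr_ge0 _).
move=> /(ler_wpM2l c0).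
rewrite [X in _ <= X -> _]mulrAC; apply: le_trans.
by rewrite le_eqVlt; apply/orP; left; apply/eqP; ring.
Qed.

Lemma H1_seminorm_interp_error_le :
  (H1_seminorm Omega interp_error <= ((element_constant Khat * Cali ^+ n.+1 *
    (Ceq * (N%:R^-1 * mesh_density)) `^ (n.+2%:R / n%:R) * \sum_e cp e ^+ 2) `^ 2^-1)%:E)%E.
Proof.
have [L L0 hL] := interp_error_lipschitz.
have dw e x i : open_simplex (T e) x -> derivable interp_error x (delta_mx 0 i).
  by move=> Kx; exact: (@ex_derive _ _ _ _ _ _ _ (is_derive_interp_error i Kx)).
apply: le_trans (H1_seminorm_piecewise_le n0 pO mT L0 hL dw bound0 _) _.
  move=> e x Kx; rewrite (gradient_interp_error Kx) /bound.
  have d0 := ltW (pd_det_gt0 (pR e)).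
  apply: (element_gradient_error n0 uKh (uT e) (pR e)) => //.
  - exact: recovered_gap.
  - exact: powR_ge0.
  - rewrite -powR_mulrn ?powR_ge0// -powRrM mulVf ?pnatr_eq0 -?lt0n// powRr1//.
    by rewrite mulr_ge0 ?sqr_ge0.
  - by apply: (metric_alignment n0 (pR e) (vol0 e)); exact: qu.2.
rewrite lee_fin; apply: ge0_ler_powR => //; rewrite ?nnegrE//.
  by apply: sumr_ge0 => e _; rewrite mulr_ge0.
apply: mulr_ge0; first by apply: mulr_ge0 const0 (powR_ge0 _ _).
by apply: sumr_ge0 => e _; exact: sqr_ge0.
Qed.

Variable CRm : R.
Hypotheses (CRm0 : 0 < CRm) (CRm_le : forall e, CRm <= cm e).

Let hessian_power x := spectral_norm (\det (H x) `^ n%:R^-1 *: H x) `^ (n%:R / n.+2%:R).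

(** The root of the determinant and the spectral norm each yield one factor [CRm]; the power n/(n+2)
    is applied to their product. *)
Let density_le_hessian e x : pdmx (H x) ->
  (forall z, CRm * dotv (z *m RK e) z <= dotv (z *m H x) z) ->
  CRm `^ (2 * n%:R / n.+2%:R) * density (RK e) <= hessian_power x.
Proof.
move=> pHx le_H; have dR := pd_det_gt0 (pR e); have sR := pd_spectral_gt0 n0 (pR e).
have nn0 : n%:R != 0 :> R by rewrite pnatr_eq0 -lt0n.
have k0 : n.+2%:R != 0 :> R by rewrite pnatr_eq0.
have det_le : CRm ^+ n * \det (RK e) <= \det (H x).
  rewrite -detZ; apply: (pd_det_le (pdmxZ CRm0 (pR e)) pHx) => z.
  by rewrite formM_scale.
have root_le : CRm * \det (RK e) `^ n%:R^-1 <= \det (H x) `^ n%:R^-1.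
  have := ge0_ler_powR (_ : 0 <= n%:R^-1) _ _ det_le; rewrite !nnegrE => /(_ _ _ _)/Wrap[] //.
  - by rewrite mulr_ge0 ?exprn_ge0 ?(ltW CRm0) ?(ltW dR).
  - exact: ltW (pd_det_gt0 pHx).
  rewrite powRM ?exprn_ge0 ?(ltW CRm0) ?(ltW dR)//.
  by rewrite -powR_mulrn ?(ltW CRm0)// -powRrM mulfV// powRr1// ltW.
have c0 : 0 <= CRm * (CRm * \det (RK e) `^ n%:R^-1).
  by rewrite !mulr_ge0 ?powR_ge0 ?(ltW CRm0).
have pB : psdmx (\det (H x) `^ n%:R^-1 *: H x).
  by apply/pdmx_psd/pdmxZ => //; rewrite powR_gt0 ?pd_det_gt0.
have form_le z : CRm * (CRm * \det (RK e) `^ n%:R^-1) * dotv (z *m RK e) z <=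
    dotv (z *m (\det (H x) `^ n%:R^-1 *: H x)) z.
  rewrite formM_scale mulrAC mulrC ler_pM//.
  - by rewrite mulr_ge0 ?powR_ge0 ?(ltW CRm0).
  - by rewrite mulr_ge0 ?(ltW CRm0)//; case: (pdmx_psd (pR e)) => _; exact.
have norm_le := psd_spectral_le c0 (pdmx_psd (pR e)) pB form_le.
have := ge0_ler_powR (_ : 0 <= n%:R / n.+2%:R) _ _ norm_le.
rewrite !nnegrE => /(_ _ _ _)/Wrap[] //.
- by rewrite mulr_ge0 ?(ltW sR).
- exact: spectral_norm_ge0.
apply: le_trans; rewrite le_eqVlt; apply/orP; left; apply/eqP.
rewrite /density.
have [a ->] := ex_expR dR; have [b ->] := ex_expR sR; have [c ->] := ex_expR CRm0.
rewrite !(powR_expR, =^~ expRD); congr expR.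
by move: n.+2%:R n%:R k0 nn0 => k m k0 m0; field; rewrite k0 m0.
Qed.

Lemma mesh_density_le_integral :
  ((CRm `^ (2 * n%:R / n.+2%:R) * mesh_density)%:E <=
   \int[mu]_(x in Omega) (spectral_norm (\det (H x) `^ n%:R^-1 *: H x)
     `^ (n%:R / n.+2%:R))%:E)%E.
Proof.
have [Z [mZ Z0 hZ]] := hessian_bounds_ae.
(* Off the exceptional null set the density bound holds at every point, so a step function lies
   below the integrand and the integrals compare without measurability of the latter. *)
pose A e := open_simplex (T e) `\` Z.
have mA e : measurable (A e) by apply: measurableD mZ; exact: measurable_open_simplex.
pose c e : R := CRm `^ (2 * n%:R / n.+2%:R) * density (RK e).
have c0 e : 0 <= c e by rewrite mulr_ge0 ?powR_ge0 ?density_ge0.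
apply: (@le_trans _ _ (\int[mu]_(x in Omega) (step c A x)%:E)%E).
  rewrite (integral_step _ (measurable_domain pO))//; last by move=> e x [+ _]; exact: subO.
  rewrite /mesh_density mulr_sumr -sumEFin; apply: lee_sum => e _.
  rewrite (mulrC (simplex_volume _)) mulrA -/(c e) EFinM.
  apply: lee_wpmul2l; first by rewrite lee_fin.
  rewrite -(open_simplex_measure n0 (uT e)).
  apply: (@le_trans _ _ (mu (A e `|` Z))).
    apply: le_measure; rewrite ?inE.
    - exact: measurable_open_simplex.
    - exact: measurableU.
    - by move=> x Kx; have [Zx|nZx] := pselect (Z x); [right|left].
  apply: le_trans (measureU2 _ _ _) _ => //.
  by rewrite [X in (_ + X)%E](_ : _ = 0%E) ?adde0.
apply: ge0_le_integral_sup => x Ox; rewrite lee_fin ?step_ge0//.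
have [[e Ax]|nA] := pselect (exists e, A e x); last first.
  by rewrite step_out ?powR_ge0// => e Ax; apply: nA; exists e.
have [Kx nZx] := Ax; rewrite (@step_cell _ _ _ _ c A e)//; last first.
  move=> e' [K'x _]; symmetry; apply: (open_simplex_disjoint mT Kx).
  exact: open_simplexW.
have /(_ e Kx)[pHx hx] : forall e, open_simplex (T e) x -> pdmx (H x) /\ forall z,
    cm e * dotv (z *m RK e) z <= dotv (z *m H x) z <= `|cp e| * dotv (z *m RK e) z.
  by apply: contrapT => h; apply: nZx; exact: hZ.
apply: density_le_hessian => // z; have /andP[h _] := hx z.
by apply: le_trans h; rewrite ler_wpM2r//; case: (pdmx_psd (pR e)) => _; exact.
Qed.

Lemma mesh_density_le_Lp :
  ((CRm * mesh_density `^ (n.+2%:R / (2 * n%:R)))%:E <=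
   Lp_spectral Omega (n%:R / n.+2%:R) (fun x => \det (H x) `^ n%:R^-1 *: H x) `^ 2^-1)%E.
Proof.
have nn0 : n%:R != 0 :> R by rewrite pnatr_eq0 -lt0n.
have k0 : n.+2%:R != 0 :> R by rewrite pnatr_eq0.
have m0 : 0 <= CRm `^ (2 * n%:R / n.+2%:R) * mesh_density.
  by rewrite mulr_ge0 ?powR_ge0 ?mesh_density_ge0.
have -> : CRm * mesh_density `^ (n.+2%:R / (2 * n%:R)) =
  ((CRm `^ (2 * n%:R / n.+2%:R) * mesh_density) `^ (n%:R / n.+2%:R)^-1) `^ 2^-1.
  rewrite !powRM ?powR_ge0 ?mesh_density_ge0// -!powRrM.
  rewrite -{1}(powRr1 (ltW CRm0)); congr (_ `^ _ * _ `^ _).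
    by move: n.+2%:R n%:R k0 nn0 => k m k1 m1; field; rewrite k1 m1.
  by move: n.+2%:R n%:R k0 nn0 => k m k1 m1; field; rewrite k1 m1.
rewrite -!poweR_EFin; apply: gt0_ler_poweR => //.
- by rewrite in_itv; apply/andP; split; [exact: poweR_ge0|exact: leey].
- by rewrite in_itv; apply/andP; split; [exact: poweR_ge0|exact: leey].
apply: gt0_ler_poweR; first by rewrite invr_ge0 divr_ge0.
- by rewrite in_itv /= leey andbT lee_fin.
- by rewrite in_itv /= leey andbT; apply: integral_ge0 => x _; rewrite lee_fin powR_ge0.
exact: mesh_density_le_integral.
Qed.

Variable CRp : R.
Hypotheses (CRp0 : 0 < CRp) (CRp_ge : Num.sqrt (N%:R^-1 * \sum_e cp e ^+ 2) <= CRp).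

Let N_gt0 : (0 < N)%N.
Proof.
case: pO => _ _ [x Ox] _; have [e _] := mesh_cover mT (subset_closure Ox).
by apply: leq_trans (ltn_ord e).
Qed.

Let sum_cp_le : \sum_e cp e ^+ 2 <= N%:R * CRp ^+ 2.
Proof.
have s0 : 0 <= N%:R^-1 * \sum_e cp e ^+ 2.
  by rewrite mulr_ge0// sumr_ge0// => e _; exact: sqr_ge0.
rewrite -ler_pdivrMl ?ltr0n// -(sqr_sqrtr s0) lerXn2r ?nnegrE ?sqrtr_ge0//.
exact: ltW.
Qed.

Lemma interp_error_le : (H1_seminorm Omega interp_error <=
  (Num.sqrt (element_constant Khat) * Cali `^ (n.+1%:R / 2) * Ceq `^ (n.+2%:R / (2 * n%:R)) *
    (CRp / CRm) * N%:R `^ (- n%:R^-1))%:E *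
  Lp_spectral Omega (n%:R / n.+2%:R) (fun x => \det (H x) `^ n%:R^-1 *: H x) `^ 2^-1)%E.
Proof.
have nn0 : n%:R != 0 :> R by rewrite pnatr_eq0 -lt0n.
have k0 : n.+2%:R != 0 :> R by rewrite pnatr_eq0.
have ec0 := ltW (element_constant_gt0 Khat n0).
apply: le_trans H1_seminorm_interp_error_le _.
apply: le_trans _ (lee_wpmul2l _ mesh_density_le_Lp); last first.
  by rewrite lee_fin !mulr_ge0 ?sqrtr_ge0 ?powR_ge0 ?invr_ge0 ?(ltW CRp0) ?(ltW CRm0).
rewrite -EFinM lee_fin.
set B := element_constant Khat * _ * _; have B0 : 0 <= B.
  by apply: mulr_ge0 const0 (powR_ge0 _ _).
apply: (@le_trans _ _ ((B * (N%:R * CRp ^+ 2)) `^ 2^-1)).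
  apply: ge0_ler_powR; rewrite ?nnegrE//.
  - by apply: mulr_ge0 => //; apply: sumr_ge0 => e _; exact: sqr_ge0.
  - by apply: mulr_ge0 => //; rewrite mulr_ge0 ?sqr_ge0.
  - exact: ler_wpM2l.
rewrite le_eqVlt; apply/orP; left; apply/eqP; rewrite /B.
rewrite -(powR_mulrn _ Cali0) -(powR_mulrn _ (ltW CRp0)) -powR12_sqrt//.
apply: error_constant => //; first exact: element_constant_gt0.
- exact: lt_le_trans Cali1.
- exact: lt_le_trans Ceq1.
- by rewrite ltr0n.
- exact: mesh_density_ge0.
Qed.

End error_bound.

Theorem theorem2p1 (R : realType) (d : nat) (d_gt0 : (0 < d)%N)
    (Khat : 'I_d.+1 -> 'rV[R]_d) (Khat_nondeg : nondegenerate_simplex Khat)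
    (Khat_vol : simplex_volume Khat = 1) (Ccea : R) (Ccea_gt0 : 0 < Ccea) :
  exists2 C : R, 0 < C &
  forall (Omega : set 'rV[R]_d) (L : diff_op) (f g u : 'rV[R]_d -> R)
      (H : 'rV[R]_d -> 'M[R]_d)
      (I : Type) (N : I -> nat) (T : forall h, 'I_(N h) -> 'I_d.+1 -> 'rV[R]_d)
      (uh : I -> 'rV[R]_d -> R)
      (Rec : I -> 'rV[R]_d -> 'M[R]_d) (RK : forall h, 'I_(N h) -> 'M[R]_d)
      (CRmK CRpK : forall h, 'I_(N h) -> R) (CRm CRp Ceq Cali : R),
  polyhedral_domain Omega ->
  elliptic Omega L ->
  L2 Omega f ->
  bvp_solution Omega L f g u ->
  weak_hessian Omega u H ->
  (forall h, simplicial_mesh Omega (T h)) ->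
  (forall h, fe_solution Omega L f g (T h) (uh h)) ->
  (forall h (Pu : 'rV[R]_d -> R), nodal_interpolant Omega (T h) u Pu ->
     (H1_seminorm Omega (u \- uh h)%R <=
      Ccea%:E * H1_seminorm Omega (u \- Pu)%R)%E) ->
  ae_uniformly_posdef Omega H ->
  (forall h, uniformly_posdef (closure Omega) (Rec h)) ->
  (forall h e, is_average (Rec h) (simplex (T h e)) (RK h e)) ->
  (forall h e, {ae @lebesgue_rV R d, forall x, simplex (T h e) x ->
     forall a : R, eigenvalue (invmx (RK h e) *m H x) a ->
     CRmK h e <= a <= CRpK h e}) ->
  0 < CRm -> 0 < CRp ->
  (forall h e, CRm <= CRmK h e) ->
  (forall h, Num.sqrt ((N h)%:R^-1 * \sum_e CRpK h e ^+ 2) <= CRp) ->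
  1 <= Ceq -> 1 <= Cali ->
  forall h,
  quasi_uniform Khat Ceq Cali (T h) (fun e => metric_tensor (RK h e)) ->
  (H1_seminorm Omega (u \- uh h)%R <=
   (C * Cali `^ (d.+1%:R / 2) * Ceq `^ (d.+2%:R / (2 * d%:R)) *
    (CRp / CRm) * (N h)%:R `^ (- d%:R^-1))%:E *
   Lp_spectral Omega (d%:R / d.+2%:R)
     (fun x => (\det (H x) `^ d%:R^-1) *: H x) `^ 2^-1)%E.

Proof.
exists (Ccea * Num.sqrt (element_constant Khat)).
  by rewrite mulr_gt0// sqrtr_gt0 element_constant_gt0.
move=> Omega L f g u H I N T uh Rec RK CRmK CRpK CRm CRp Ceq Cali.
move=> pO _ _ [cu _ _] wH mT _ cea pH pRec avg eig CRm0 CRp0 CRm_le CRp_ge Ceq1 Cali1 h qu.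
have pR e : pdmx (RK h e).
  by apply: average_posdef (pRec h) (avg h e) => x; exact: mesh_sub_closure (mT h) _ _.
apply: le_trans (cea h _ (mesh_interp_nodal (mT h) u)) _.
rewrite -!(mulrA Ccea) EFinM -muleA; apply: lee_wpmul2l; first by rewrite lee_fin ltW.
exact: (interp_error_le d_gt0 pO (mT h) cu wH pH pR (eig h) Khat_nondeg Cali1 Ceq1 qu
  CRm0 (CRm_le h) CRp0 (CRp_ge h)).
Qed.
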